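(* Let $0<\alpha<Q$, $\Phi\in\mathcal{Y}$, $b\in BMO(X)$, $\beta\in(0,1)$, let $\varphi:(0,\infty)\to(0,\infty)$ be measurable, and put $\eta(t)=\varphi(t)^\beta$ and $\Psi(t)=\Phi(t^{1/\beta})$. Consider the condition $(\ast)$ there is a constant $C>0$, independent of $t$, such that $t^\alpha\varphi(t)\le C\varphi(t)^\beta$ for all $t>0$. 1. If $\Phi\in\Delta_2\cap\nabla_2$ and $\varphi$ satisfies, with a constant $C>0$ independent of $r$, $$\sup_{r<t<\infty}\Big(1+\ln\frac tr\Big)\Phi^{-1}(t^{-Q})\,\operatorname*{ess\,inf}_{t<s<\infty}\frac{\varphi(s)}{\Phi^{-1}(s^{-Q})}\le C\,\varphi(r)\quad\text{for all }r>0,$$ then the condition $$r^\alpha\varphi(r)+\int_r^\infty\Big(1+\ln\frac tr\Big)\varphi(t)\,t^\alpha\frac{dt}{t}\le C\varphi(r)^\beta\quad\text{for all }r>0,$$ where $C>0$ does not depend on $r$, is sufficient for the boundedness of $[b,I_\alpha]$ from $M_{\Phi,\varphi}(X)$ to $M_{\Psi,\eta}(X)$. 2. If $\Phi\in\Delta_2$ and $\varphi\in\mathcal{G}_\Phi$, then condition $(\ast)$ is necessary for the boundedness of $|b,I_\alpha|$ from $M_{\Phi,\varphi}(X)$ to $M_{\Psi,\eta}(X)$. 3. Let $\Phi\in\Delta_2\cap\nabla_2$. If $\varphi\in\mathcal{G}_\Phi$ satisfies the conditions $$\sup_{r<t<\infty}\Big(1+\ln\frac tr\Big)\varphi(t)\le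 C\,\varphi(r)\quad\text{and}\quad\int_r^\infty\Big(1+\ln\frac tr\Big)\varphi(t)\,t^\alpha\frac{dt}{t}\le C\,r^\alpha\varphi(r)$$ for all $r>0$, where $C>0$ does not depend on $r$, then condition $(\ast)$ is necessary and sufficient for the boundedness of $|b,I_\alpha|$ from $M_{\Phi,\varphi}(X)$ to $M_{\Psi,\eta}(X)$.
   Context: $(X,d,\mu)$ is a space of homogeneous type: $X$ is a topological space with a quasi-distance $d$ (i.e. $d(x,y)\ge 0$, $d(x,y)=0$ iff $x=y$, $d(x,y)=d(y,x)$, $d(x,y)\le K_1(d(x,z)+d(z,y))$) and a positive measure $\mu$; the balls $B(x,r)=\{y\in X:d(x,y)<r\}$, $r>0$, form a basis of neighborhoods of $x$; $\mu$ is defined on a $\sigma$-algebra containing the balls, and $0<\mu(B(x,2r))\le K_2\mu(B(x,r))<\infty$; $K_1,K_2\ge1$ are constants independent of $x,y,z,r$. Standing assumptions: $\mu(X)=\infty$; the compactly supported continuous functions are dense in $L_1(X,\mu)$; $X$ is $Q$-homogeneous for some $Q>0$, i.e. $K_3^{-1}r^Q\le\mu(B(x,r))\le K_3r^Q$ for all $x\in X$, $r>0$, with a constant $K_3\ge1$. A Young function is a convex, left-continuous $\Phi:[0,\infty)\to[0,\infty]$ with $\lim_{r\to+0}\Phi(r)=\Phi(0)=0$ and $\lim_{r\to\infty}\Phi(r)=\infty$. $\mathcal{Y}$ is the set of Young functions with $0<\Phi(r)<\infty$ for $0<r<\infty$. $\Phi^{-1}(s)=\inf\{r\ge0:\Phi(r)>s\}$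 ($\inf\emptyset=\infty$). $\Phi\in\Delta_2$ means $\Phi(2r)\le k\Phi(r)$ for all $r>0$, for some $k>1$; $\Phi\in\nabla_2$ means $\Phi(r)\le\frac1{2k}\Phi(kr)$ for all $r\ge0$, for some $k>1$. $L_\Phi(X)$ is the set of $f\in L_1^{\rm loc}(X)$ with $\int_X\Phi(\epsilon|f|)d\mu<\infty$ for some $\epsilon>0$, with $\|f\|_{L_\Phi}=\inf\{\lambda>0:\int_X\Phi(|f(x)|/\lambda)d\mu(x)\le1\}$; $\|f\|_{L_\Phi(B)}=\|f\chi_B\|_{L_\Phi}$; $L_\Phi^{\rm loc}(X)$ is the set of $f$ with $f\chi_B\in L_\Phi(X)$ for all balls $B$. For a positive measurable $\varphi$ on $(0,\infty)$, $M_{\Phi,\varphi}(X)$ is the set of $f\in L_\Phi^{\rm loc}(X)$ with $\|f\|_{M_{\Phi,\varphi}}=\sup_{x\in X,r>0}\varphi(r)^{-1}\Phi^{-1}(\mu(B(x,r))^{-1})\|f\|_{L_\Phi(B(x,r))}<\infty$. A function $\varphi:(0,\infty)\to(0,\infty)$ is almost increasing (resp. almost decreasing) if there is $C>0$ with $\varphi(r)\le C\varphi(s)$ (resp. $\varphi(r)\ge C\varphi(s)$) for $r\le s$. $\mathcal{G}_\Phi$ is the set of almost decreasing $\varphi:(0,\infty)\to(0,\infty)$ such that $t\mapsto\varphi(t)/\Phi^{-1}(t^{-Q})$ is almost increasing. $BMO(X)$ is the set of $b\in L_1^{\rm loc}(X)$ with $\|b\|_*=\sup_{x\in X,r>0}\frac1{\mu(B(x,r))}\int_{B(x,r)}|b(y)-b_{B(x,r)}|d\mu(y)<\infty$,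 where $b_B=\frac1{\mu(B)}\int_Bb\,d\mu$. $I_\alpha f(x)=\int_X\frac{f(y)}{d(x,y)^{Q-\alpha}}d\mu(y)$; $[b,I_\alpha]f(x)=\int_X\frac{b(x)-b(y)}{d(x,y)^{Q-\alpha}}f(y)d\mu(y)$; $|b,I_\alpha|f(x)=\int_X\frac{|b(x)-b(y)|}{d(x,y)^{Q-\alpha}}f(y)d\mu(y)$. An operator $T$ is bounded from $A$ to $A'$ if there is $C>0$ with $\|Tf\|_{A'}\le C\|f\|_A$ for all $f\in A$.
   Formalization: In parts 2 and 3, necessity of (∗) is derived from boundedness of |b,I_α| for every b in BMO(X), since for a single constant b the claim fails; membership of Tf in the target space is asserted when Tf is measurable, the norm inequality always. *)

(* Defs.v *)
From HB Require Import structures.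
From mathcomp Require Import all_boot all_order all_algebra.
From mathcomp Require Import all_classical all_reals all_analysis.
From mathcomp Require Import ess_sup_inf.

Set Implicit Arguments.
Unset Strict Implicit.
Unset Printing Implicit Defensive.

Import Order.TTheory GRing.Theory Num.Theory.
Import numFieldNormedType.Exports.

Local Open Scope classical_set_scope.
Local Open Scope ring_scope.
Local Open Scope ereal_scope.

(* No compatibility between the topology and the sigma-algebra is required
   beyond the axioms of [homogeneous_type]. *)
#[short(type="topMeasurableType")]
HB.structure Definition TopMeasurable (disp : measure_display) :=
  {T of Measurable disp T & Topological T}.

Section homogeneous_type.
Context {R : realType} {disp : measure_display} {X : topMeasurableType disp}.
Implicit Types (d : X -> X -> R) (mu : {measure set X -> \bar R}).

Definition qball d (x : X) (r : R) : set X := [set y | (d x y < r)%R].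

Record quasi_distance d (K1 : R) : Prop := QuasiDistance {
  qdist_ge0 : forall x y, (0 <= d x y)%R ;
  qdist_eq0 : forall x y, d x y = 0%R <-> x = y ;
  qdist_sym : forall x y, d x y = d y x ;
  qdist_triangle : forall x y z, (d x y <= K1 * (d x z + d z y))%R }.

Definition balls_nbhs_basis d : Prop :=
  forall (x : X) (A : set X),
    nbhs x A <-> exists2 r : R, (0 < r)%R & qball d x r `<=` A.

Definition doubling d mu (K2 : R) : Prop :=
  forall x (r : R), (0 < r)%R ->
    [/\ 0 < mu (qball d x (2 * r)),
        mu (qball d x (2 * r)) <= K2%:E * mu (qball d x r) &
        K2%:E * mu (qball d x r) < +oo].

Definition homogeneous_type d mu : Prop :=
  [/\ exists2 K1 : R, (1 <= K1)%R & quasi_distance d K1,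
      balls_nbhs_basis d,
      forall x (r : R), (0 < r)%R -> measurable (qball d x r) &
      exists2 K2 : R, (1 <= K2)%R & doubling d mu K2].

Definition Q_homogeneous d mu (Q : R) : Prop :=
  exists2 K3 : R, (1 <= K3)%R &
    forall x (r : R), (0 < r)%R ->
      (K3^-1 * r `^ Q)%:E <= mu (qball d x r) <= (K3 * r `^ Q)%:E.

Definition compactly_supported (g : X -> R) : Prop :=
  compact (closure [set x | g x != 0%R]).

Definition Cc_dense_L1 mu : Prop :=
  forall f : X -> R, mu.-integrable setT (EFin \o f) ->
  forall e : R, (0 < e)%R ->
  exists g : X -> R,
    [/\ continuous g, compactly_supported g,
        mu.-integrable setT (EFin \o g) &
        \int[mu]_x `|f x - g x|%:E < e%:E].

End homogeneous_type.

(* A function [0, oo) -> [0, oo] is represented by Phi : R -> \bar R, of which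
   only the values at nonnegative arguments matter. *)
Section young.
Context {R : realType}.
Implicit Types (Phi : R -> \bar R).

Record young Phi : Prop := Young {
  young_ge0 : forall r, (0 <= r)%R -> 0 <= Phi r ;
  young_convex : forall x y t : R, (0 <= x)%R -> (0 <= y)%R -> (0 <= t <= 1)%R ->
    Phi (t * x + (1 - t) * y)%R <= t%:E * Phi x + (1 - t)%:E * Phi y ;
  young_left_continuous : forall r : R, (0 < r)%R ->
    Phi x @[x --> r^'-] --> Phi r ;
  young_lim0 : Phi x @[x --> 0%R^'+] --> 0 ;
  young0 : Phi 0%R = 0 ;
  young_limy : Phi x @[x --> +oo%R] --> +oo }.

Definition youngY Phi : Prop :=
  young Phi /\ forall r, (0 < r)%R -> 0 < Phi r < +oo.

Definition young_inv Phi (s : \bar R) : \bar R :=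
  ereal_inf [set r%:E | r in [set r : R | (0 <= r)%R /\ s < Phi r]].

Definition Delta2 Phi : Prop :=
  exists2 k : R, (1 < k)%R & forall r, (0 < r)%R -> Phi (2 * r)%R <= k%:E * Phi r.

Definition nabla2 Phi : Prop :=
  exists2 k : R, (1 < k)%R &
    forall r, (0 <= r)%R -> Phi r <= ((2 * k)^-1)%:E * Phi (k * r)%R.

Definition almost_increasing (g : R -> \bar R) : Prop :=
  exists2 C : R, (0 < C)%R &
    forall r s, (0 < r)%R -> (r <= s)%R -> g r <= C%:E * g s.

Definition almost_decreasing (g : R -> \bar R) : Prop :=
  exists2 C : R, (0 < C)%R &
    forall r s, (0 < r)%R -> (r <= s)%R -> C%:E * g s <= g r.

Definition young_ratio Phi (Q : R) (phi : R -> R) (t : R) : \bar R :=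
  (phi t)%:E / young_inv Phi (t `^ (- Q))%:E.

Definition classG Phi (Q : R) (phi : R -> R) : Prop :=
  almost_decreasing (EFin \o phi) /\ almost_increasing (young_ratio Phi Q phi).

Definition ess_inf_above (t : R) (g : R -> \bar R) : \bar R :=
  ess_inf (mrestr (@lebesgue_measure R) (measurable_itv `]t, +oo[)) g.

End young.

Section function_spaces.
Context {R : realType} {disp : measure_display} {X : topMeasurableType disp}.
Variables (d : X -> X -> R) (mu : {measure set X -> \bar R}).
Implicit Types (Phi : R -> \bar R) (phi : R -> R) (f b : X -> R).

(* Local means on balls, as for the other local spaces below. *)
Definition L1loc f : Prop :=
  measurable_fun setT f /\
  forall x (r : R), (0 < r)%R -> mu.-integrable (qball d x r) (EFin \o f).

Definition orlicz Phi f : Prop :=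
  L1loc f /\ exists2 e : R, (0 < e)%R & \int[mu]_x Phi (e * `|f x|)%R < +oo.

Definition luxemburg Phi f : \bar R :=
  ereal_inf [set l%:E | l in
    [set l : R | (0 < l)%R /\ \int[mu]_x Phi (`|f x| / l)%R <= 1]].

Definition cut f (B : set X) : X -> R := fun x => (f x * \1_B x)%R.

Definition orlicz_loc Phi f : Prop :=
  forall x (r : R), (0 < r)%R -> orlicz Phi (cut f (qball d x r)).

Definition morrey_norm Phi phi f : \bar R :=
  ereal_sup [set ((phi p.2)^-1)%:E * young_inv Phi (mu (qball d p.1 p.2))^-1
                   * luxemburg Phi (cut f (qball d p.1 p.2))
            | p in [set p : X * R | (0 < p.2)%R]].

Definition morrey Phi phi f : Prop :=
  orlicz_loc Phi f /\ morrey_norm Phi phi f < +oo.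

Definition mean b (B : set X) : R :=
  ((fine (mu B))^-1 * \int[mu]_(y in B) b y)%R.

Definition bmo_norm b : \bar R :=
  ereal_sup [set (mu (qball d p.1 p.2))^-1 *
                 \int[mu]_(y in qball d p.1 p.2)
                    `|b y - mean b (qball d p.1 p.2)|%:E
            | p in [set p : X * R | (0 < p.2)%R]].

Definition BMO b : Prop := L1loc b /\ bmo_norm b < +oo.

Definition integral_operator (k : X -> X -> R) f : X -> R :=
  fun x => (\int[mu]_y (k x y * f y))%R.

(* The kernel is 0 on the diagonal; points are mu-null in a Q-homogeneous
   space, so this convention does not affect the operator. *)
Definition commutator_kernel (Q alpha : R) b (x y : X) : R :=
  ((b x - b y) / d x y `^ (Q - alpha))%R.

Definition abs_commutator_kernel (Q alpha : R) b (x y : X) : R :=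
  (`|b x - b y| / d x y `^ (Q - alpha))%R.

(* Boundedness from M_{Phi,phi} to M_{Psi,eta}.  [integral_operator] takes a
   default value where the defining integral diverges, so absolute convergence
   almost everywhere is part of the definition.  The quasi-distance need not be
   jointly measurable, so T f need not be measurable; the norm inequality is
   imposed in all cases (the integral of a nonnegative nonmeasurable function
   being the supremum of the integrals of the simple functions below it), and
   membership in the target space when T f is measurable. *)
Definition morrey_bounded (k : X -> X -> R) Phi phi (Psi : R -> \bar R)
    (eta : R -> R) : Prop :=
  exists2 C : R, (0 < C)%R & forall f, morrey Phi phi f ->
    [/\ {ae mu, forall x, mu.-integrable setT (fun y => (k x y * f y)%:E)},
        measurable_fun setT (integral_operator k f) ->
          morrey Psi eta (integral_operator k f) &
        morrey_norm Psi eta (integral_operator k f)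
          <= C%:E * morrey_norm Phi phi f].

End function_spaces.

(* Main.v *)
Require Import Defs.
From mathcomp Require Import all_boot all_order all_algebra.
From mathcomp Require Import all_classical all_reals all_analysis.
From mathcomp Require Import measurable_realfun ess_sup_inf.
From mathcomp Require Import ring lra zify.

(* Sufficiency. Put w(t) = Phi^-1(t^-Q) ess inf_{s > t} phi(s) / Phi^-1(s^-Q). If
   the Morrey norm of f is less than N, then D(t) ~ N w(t) bounds the normalised
   Orlicz mean of f on every ball of radius t. The supremum condition makes D halve
   under a fixed dilation and bounds it by N phi, and the pointwise condition gives
   D(t) <= C N t^(-alpha / (1 - beta)). By the John-Nirenberg inequality and
   nabla_2, for x in B(x0, r) outside a small exceptional set Bad_i, the means of
   exp(delta |b(x) - b(y)|) |f(y)| over all the balls B(x, t) are at most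
   C 2^i D(r). Splitting the integral of |b(x) - b(y)| d(x, y)^(alpha - Q) |f(y)|
   at the scale where N t^(-alpha / (1 - beta)) equals this level, in the manner of
   Hedberg, bounds it by C N^(1 - beta) (2^i D(r))^beta, the exponential absorbing
   the factor |b(x) - b(y)|. The sets Bad_i decay fast enough for these bounds to
   sum to a modular estimate for Psi on B(x0, r).

   Necessity. Let b be the indicator function of every other annulus
   M^(n-1) <= d(x0, y) < M^n. Both values of b are taken on a fixed proportion of
   B = B(x0, M^n), so |b, I_alpha| sends the indicator of B to a function which is
   at least c M^(n alpha) on B; compare the norms of the two functions. *)

Set Implicit Arguments.
Unset Strict Implicit.
Unset Printing Implicit Defensive.

Import Order.TTheory GRing.Theory Num.Theory.
Import numFieldNormedType.Exports.

Local Open Scope classical_set_scope.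
Local Open Scope ring_scope.

(** * Geometry of Q-homogeneous spaces *)

(** Two obstacles shape the proof. The first is measurability: a union of uncountably many balls, or
    the image of a function under the operator, need not be measurable. Suprema over balls are
    therefore reduced to a countable family, exceptional sets are enclosed in measurable ones, and
    the operator enters only through inequalities between integrals that are monotone without
    measurability. The second is the logarithmic drift of the means of [b] from scale to scale. A
    dilation moves these means by a bounded amount, so for small [delta] the exponential weight
    grows at most by the factor 2 that the halving of D gives back, and no logarithm survives. The
    modular is summed directly over the dyadic levels [2 ^+ i], as in Marcinkiewicz interpolation.
    There nabla_2 supplies a power growth exponent [sigma > 1] of Phi, which leaves room for an
    exponent [s] with [1 < s < sigma], while each factor [k] lost to the doubling of Phi is paid by
    a factor [(2 * k)^-1] coming from the exponential decay of the oscillation of [b]. *)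

Section lower_integral.
Context {R : realType} {disp : measure_display} {T : measurableType disp}.
Variable mu : {measure set T -> \bar R}.
Local Open Scope ereal_scope.

Import HBNNSimple.

(* The integral of a nonnegative function being a supremum over the simple
   functions below it, monotonicity needs no measurability. *)
Lemma le_lower_integral (D : set T) (f g : T -> \bar R) :
  (forall x, D x -> 0 <= f x) -> (forall x, D x -> f x <= g x) ->
  \int[mu]_(x in D) f x <= \int[mu]_(x in D) g x.
Proof.
move=> f0 fg; rewrite integral_mkcond [leRHS]integral_mkcond.
have f0' x : 0 <= (f \_ D) x by rewrite patchE; case: ifPn => // /set_mem/f0.
have fg' x : (f \_ D) x <= (g \_ D) x.
  by rewrite !patchE; case: ifPn => // /set_mem/fg.
rewrite !ge0_integralTE//; last by move=> x; exact: le_trans (fg' x).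
apply: ereal_sup_le => _ [h hf <-]; exists h => // x.
exact: le_trans (fg' x).
Qed.

Lemma le_lower_integral_subset (A B : set T) (f : T -> \bar R) : A `<=` B ->
  (forall x, B x -> 0 <= f x) ->
  \int[mu]_(x in A) f x <= \int[mu]_(x in B) f x.
Proof.
move=> AB f0; rewrite integral_mkcond [leRHS]integral_mkcond.
apply: le_lower_integral => x _.
  by rewrite patchE; case: ifPn => // /set_mem/AB/f0.
rewrite !patchE; case: ifPn => [/set_mem/AB/mem_set ->//|_].
by case: ifPn => // /set_mem/f0.
Qed.

Lemma integral_cst_EFin (D : set T) (r : R) : measurable D ->
  \int[mu]_(_ in D) r%:E = r%:E * mu D.
Proof. by move=> mD; rewrite integral_cst. Qed.

Lemma ge0_integral_restr (A B : set T) (f : T -> R) : A `<=` B ->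
  \int[mu]_(x in B) (f x * \1_A x)%:E = \int[mu]_(x in A) (f x)%:E.
Proof.
move=> AB; rewrite integral_mkcond [RHS]integral_mkcond; apply: eq_integral.
move=> x _; rewrite !patchE indicE.
have [xA|xA] := boolP (x \in A); last by rewrite mulr0; case: ifP.
by rewrite mulr1 (mem_set (AB _ (set_mem xA))).
Qed.

End lower_integral.

Section geometry.
Context {R : realType} {disp : measure_display} {X : topMeasurableType disp}.
Variables (d : X -> X -> R) (mu : {measure set X -> \bar R}) (Q K1 K3 : R).

Record Qspace : Prop := MkQspace {
  K1_ge1 : 1 <= K1 ;
  K3_ge1 : 1 <= K3 ;
  Q_gt0 : 0 < Q ;
  Qspace_dist : quasi_distance d K1 ;
  Qspace_nbhs : balls_nbhs_basis d ;
  Qspace_measurable : forall x r, 0 < r -> measurable (qball d x r) ;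
  Qspace_ball : forall x r, 0 < r ->
    ((K3^-1 * r `^ Q)%:E <= mu (qball d x r) <= (K3 * r `^ Q)%:E)%E }.

Hypothesis HX : Qspace.
Local Notation B := (qball d).

Let K1_gt0 : 0 < K1. Proof. exact: lt_le_trans (K1_ge1 HX). Qed.
Let K3_gt0 : 0 < K3. Proof. exact: lt_le_trans (K3_ge1 HX). Qed.

Lemma Qdist_ge0 x y : 0 <= d x y.
Proof. exact: (qdist_ge0 (Qspace_dist HX)). Qed.

Lemma Qdist_sym x y : d x y = d y x.
Proof. exact: (qdist_sym (Qspace_dist HX)). Qed.

Lemma Qdist_xx x : d x x = 0.
Proof. by apply/(qdist_eq0 (Qspace_dist HX)). Qed.

Lemma qball_center x r : 0 < r -> B x r x.
Proof. by move=> r0; rewrite /qball /= Qdist_xx. Qed.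

Lemma qball_le x r s : r <= s -> B x r `<=` B x s.
Proof. by move=> rs y /=; rewrite /qball/= => /lt_le_trans; exact. Qed.

Lemma qball_shift x y s t : d x y < s -> B y t `<=` B x (K1 * (s + t)).
Proof.
move=> xys z; rewrite /qball /= => yzt.
apply: le_lt_trans (qdist_triangle (Qspace_dist HX) x z y) _.
by rewrite ltr_pM2l//; lra.
Qed.

Lemma measurable_qball x r : measurable (B x r).
Proof.
have [r0|r0] := ltrP 0 r; first exact: Qspace_measurable.
rewrite (_ : B x r = set0)//; apply/seteqP; split => // y /=.
by rewrite /qball/= => /lt_le_trans/(_ r0); rewrite ltNge Qdist_ge0.
Qed.
Hint Resolve measurable_qball : core.

Lemma qball_mu_ge x r : 0 < r -> ((K3^-1 * r `^ Q)%:E <= mu (B x r))%E.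
Proof. by move=> r0; have /andP[] := Qspace_ball HX x r0. Qed.

Lemma qball_mu_le x r : 0 < r -> (mu (B x r) <= (K3 * r `^ Q)%:E)%E.
Proof. by move=> r0; have /andP[] := Qspace_ball HX x r0. Qed.

Lemma qball_mu_fin x r : 0 < r -> mu (B x r) \is a fin_num.
Proof.
move=> r0; rewrite ge0_fin_numE//.
by apply: le_lt_trans (qball_mu_le x r0) _; rewrite ltry.
Qed.

Lemma measurable_dist x : measurable_fun setT (d x).
Proof.
move=> mT; apply: (measurability _ (RGenInftyO.measurableE R)) => //.
move=> _ [_ [r ->] <-]; rewrite setTI.
by rewrite (_ : _ @^-1` _ = B x r)//; apply/seteqP; split => y /=; rewrite in_itv.
Qed.

Lemma qball_bigcup x : \bigcup_n B x n.+1%:R = setT.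
Proof.
apply/seteqP; split => // y _; exists (Num.trunc (d x y)) => //.
exact: truncnS_gt.
Qed.

Section vitali.
Variables (c : nat -> X) (r : nat -> R).
Hypothesis r_gt0 : forall n, 0 < r n.

(** If a ball meets another of radius [r] at least its own, its points are within [2 * K1 * r] of a
    common point; one more triangle inequality gives this factor. *)
Definition dilation : R := K1 * (1 + 2 * K1).

Lemma dilation_ge1 : 1 <= dilation.
Proof. by have := K1_ge1 HX; rewrite /dilation; nra. Qed.

Lemma qball_dilation i j : r i <= r j -> B (c i) (r i) `&` B (c j) (r j) !=set0 ->
  B (c i) (r i) `<=` B (c j) (dilation * r j).
Proof.
move=> ij [z [iz jz]] y iy.
have zy : d z y < K1 * (r j + r j).
  rewrite -/(qball d z _ y); apply: (@qball_le _ (K1 * (r i + r i))).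
    by rewrite ler_pM2l//; lra.
  by apply: (@qball_shift z (c i)) => //; rewrite Qdist_sym.
rewrite (_ : dilation * _ = K1 * (r j + K1 * (r j + r j))); first exact: (qball_shift jz).
by rewrite /dilation; ring.
Qed.

(** Greedy selection from the largest ball down. The list is sorted by increasing radius and the
    induction treats the tail first, so a rejected head meets a selected ball that is at least as
    large. *)
Lemma vitali_finite (s : seq nat) : exists D : seq nat,
  [/\ uniq D, {subset D <= s},
      trivIset [set` D] (fun i => B (c i) (r i)) &
      forall i, i \in s -> exists2 j, j \in D &
        B (c i) (r i) `<=` B (c j) (dilation * r j)].
Proof.
pose LE i j := r i <= r j.
have LEtr : transitive LE by move=> ? ? ?; exact: le_trans.
have dil i : B (c i) (r i) `<=` B (c i) (dilation * r i).
  by apply: qball_le; rewrite ler_peMl ?dilation_ge1// ltW.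
wlog : s / sorted LE s.
  have : sorted LE (sort LE s) by apply: sort_sorted => x y; exact: le_total.
  move=> /[swap] /[apply] -[D [uD Ds tD H]]; exists D; split => //.
  - by move=> x /Ds; rewrite mem_sort.
  - by move=> i; rewrite -(mem_sort LE) => /H.
elim: s => [_|i s IH]; first by exists nil.
move=> /= ps; have [D [uD Ds tD H]] := IH (path_sorted ps).
have les j : j \in D -> r i <= r j.
  by move=> /Ds; have /allP := order_path_min LEtr ps; exact.
have [[j jD ij]|K] := pselect (exists2 j, j \in D &
    B (c i) (r i) `&` B (c j) (r j) !=set0).
  exists D; split => //; first by move=> x /Ds; rewrite inE orbC => ->.
  move=> k; rewrite inE => /predU1P[->|/H//].
  by exists j => //; apply: qball_dilation => //; exact: les.
have iD j : j \in D -> B (c i) (r i) `&` B (c j) (r j) = set0.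
  by move=> jD; apply/eqP/negPn/negP => /set0P ij; apply: K; exists j.
exists (i :: D); split => /=.
- rewrite uD andbT; apply/negP => /iD; rewrite setIid => /seteqP[+ _].
  by move=> /(_ (c i)); apply; exact: qball_center.
- by move=> x; rewrite !inE => /predU1P[->|/Ds ->]; rewrite ?eqxx ?orbT.
- move=> k l /=; rewrite !inE => /predU1P[->|kD] /predU1P[->|lD] //.
  + by rewrite iD// => -[].
  + by rewrite setIC iD// => -[].
  + exact: tD.
- move=> k; rewrite inE => /predU1P[->|/H [j jD kj]].
    by exists i; rewrite ?inE ?eqxx.
  by exists j => //; rewrite inE jD orbT.
Qed.

Lemma measure_bigsetU_seq_le (F : nat -> set X) (s : seq nat) :
  (forall i, measurable (F i)) ->
  (mu (\big[setU/set0]_(i <- s) F i) <= \sum_(i <- s) mu (F i))%E.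
Proof.
move=> mF; elim: s => [|i s IH]; first by rewrite !big_nil measure0.
rewrite !big_cons; apply: le_trans (measureU2 _ _ _) _ => //.
  exact: bigsetU_measurable.
exact: leeD2l.
Qed.

(* Vitali covering in integrated form: only local bounds on the pieces [E i]
   lying in a common dilated ball are needed. *)
Lemma vitali_measure_le (P : set nat) (E : nat -> set X) (theta : R)
    (g : X -> R) : 0 <= theta -> (forall i, measurable (E i)) ->
  measurable_fun setT g -> (forall x, 0 <= g x) ->
  (forall j, P j ->
    mu (\bigcup_(i in [set i | P i /\
          B (c i) (r i) `<=` B (c j) (dilation * r j)]) E i)
      <= (theta * r j `^ Q)%:E)%E ->
  (forall j, P j -> (r j `^ Q)%:E <= \int[mu]_(x in B (c j) (r j)) (g x)%:E)%E ->
  (mu (\bigcup_(i in P) E i) <= theta%:E * \int[mu]_x (g x)%:E)%E.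
Proof.
move=> theta0 mE mg g0 hE hg.
(* Only finite families can be sorted by radius; the countable union is reached by continuity of the
   measure from below. *)
pose F n := \bigcup_(i in P `&` `I_n) E i.
have mF n : measurable (F n) by exact: bigcup_measurable.
have FE : \bigcup_n F n = \bigcup_(i in P) E i.
  apply/seteqP; split => [x [n _ [i [Pi _] Ei]]|x [i Pi Ei]]; first by exists i.
  by exists i.+1 => //; exists i => //; split => /=.
have ndF : {homo F : n m / (n <= m)%N >-> (n <= m)%O}.
  move=> n m nm; apply/subsetPset => x [i [Pi ni] Ei]; exists i => //.
  by split => //=; exact: leq_trans ni nm.
have cF := @nondecreasing_cvg_mu _ _ _ mu _ mF (bigcup_measurable (fun n _ => mF n)) ndF.
rewrite -FE -(cvg_lim _ cF)//; apply: lime_le; first by apply/cvg_ex; eexists; exact: cF.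
apply: nearW => n /=.
have [D [uD Ds tD H]] := vitali_finite [seq i <- iota 0 n | `[< P i >]].
pose G j := \bigcup_(i in [set i | P i /\
          B (c i) (r i) `<=` B (c j) (dilation * r j)]) E i.
have mG j : measurable (G j) by exact: bigcup_measurable.
have DP j : j \in D -> P j by move=> /Ds; rewrite mem_filter => /andP[/asboolP].
apply: (@le_trans _ _ (mu (\big[setU/set0]_(j <- D) G j))).
  apply: le_measure; rewrite ?inE//; first exact: bigsetU_measurable.
  move=> x [i [Pi ni] Ei]; have [|j jD ij] := H i.
    by rewrite mem_filter mem_iota/= (asboolT Pi).
  by rewrite -bigcup_seq; exists j => //; exists i.
apply: le_trans (measure_bigsetU_seq_le _ mG) _.
apply: (@le_trans _ _ (\sum_(j <- D) (theta%:E *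
    \int[mu]_(x in B (c j) (r j)) (g x)%:E))%E).
  rewrite big_seq [leRHS]big_seq; apply: lee_sum => j /DP Pj.
  apply: le_trans (hE _ Pj) _; rewrite EFinM; apply: lee_wpmul2l; first by rewrite lee_fin.
  exact: hg.
have intg0 A : (0 <= \int[mu]_(x in A) (g x)%:E)%E.
  by apply: integral_ge0 => x _; rewrite lee_fin.
rewrite -ge0_sume_distrr//; apply: lee_wpmul2l; first by rewrite lee_fin.
rewrite -(@ge0_integral_bigsetU _ _ _ _ _ (fun j => B (c j) (r j)))//.
- by apply: le_lower_integral_subset => // x _; rewrite lee_fin.
- by apply: measurable_funTS; exact/measurable_EFinP.
- by move=> x _; rewrite lee_fin.
Qed.

End vitali.

(** Packing argument: without a finite net there are arbitrarily long [e]-separated lists in the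
    ball, and the disjoint small balls around their points would outweigh a slightly larger ball. *)
Lemma qball_net (x0 : X) (rho e : R) : 0 < rho -> 0 < e ->
  exists s : seq X, forall x, B x0 rho x -> exists2 y, y \in s & d x y < e.
Proof.
move=> rho0 e0; apply: contrapT => nonet.
have sep n : exists s : seq X, [/\ size s = n,
    forall y, y \in s -> B x0 rho y & pairwise (fun x y => e <= d x y) s].
  elim: n => [|n [s [sn sB sp]]]; first by exists nil.
  have [x [xB xs]] : exists x, B x0 rho x /\ forall y, y \in s -> e <= d x y.
    apply: contrapT => H; apply: nonet; exists s => x xB.
    apply: contrapT => H'; apply: H; exists x; split => // y ys.
    by rewrite leNgt; apply/negP => xy; apply: H'; exists y.
  exists (x :: s); split => /=; first by rewrite sn.
  - by move=> y; rewrite inE => /predU1P[->|/sB].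
  - by rewrite sp andbT; apply/allP.
(* Two balls of radius [a] that meet have centres at distance less than [K1 * (a + a) = e]. *)
pose a := e / (2 * K1).
have a0 : 0 < a by rewrite divr_gt0// mulr_gt0.
have V0 : 0 < K3^-1 * a `^ Q by rewrite mulr_gt0 ?invr_gt0 ?powR_gt0.
pose V := K3 * (K1 * (rho + a)) `^ Q.
have := truncnS_gt (V / (K3^-1 * a `^ Q)).
set n := (Num.trunc _).+1; rewrite ltr_pdivrMr// => nV.
have [s [sn sB sp]] := sep n.
pose F i := B (nth x0 s i) a.
have disj i j : (i < j < n)%N -> F i `&` F j = set0.
  move=> /andP[ij jn]; apply/eqP/negPn/negP => /set0P [z [iz jz]].
  have := pairwiseP x0 sp i j; rewrite !inE sn => /(_ (ltn_trans ij jn) jn ij).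
  have : d (nth x0 s i) (nth x0 s j) < K1 * (a + a).
    by apply: qball_shift iz _ _; rewrite /qball/= Qdist_sym.
  have -> : K1 * (a + a) = e by rewrite /a; field; rewrite gt_eqF.
  by move=> /lt_le_trans H /H; rewrite ltxx.
have tF : trivIset `I_n F.
  apply/trivIsetP => i j /= ni nj; rewrite neq_ltn => /orP[ij|ji].
    by apply: disj; rewrite ij.
  by rewrite setIC; apply: disj; rewrite ji.
have FB : \big[setU/set0]_(i < n) F i `<=` B x0 (K1 * (rho + a)).
  rewrite -bigcup_mkord => z [i /= ni]; apply: qball_shift.
  by apply: sB; apply: mem_nth; rewrite sn.
have mF : measurable (\big[setU/set0]_(i < n) F i).
  by apply: bigsetU_measurable => i _; exact: measurable_qball.
have : (mu (\big[setU/set0]_(i < n) F i) <= V%:E)%E.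
  apply: (@le_trans _ _ (mu (B x0 (K1 * (rho + a))))); last first.
    by apply: qball_mu_le; rewrite mulr_gt0// addr_gt0.
  by apply: le_measure; rewrite ?inE.
rewrite measure_semi_additive_ord_I//; last by move=> k _; exact: measurable_qball.
move=> HV.
have : ((n%:R * (K3^-1 * a `^ Q))%:E <= V%:E)%E.
  apply: le_trans HV; rewrite mulr_natl -[in leLHS](card_ord n) -sumr_const -sumEFin.
  by apply: lee_sum => i _; exact: qball_mu_ge.
by rewrite lee_fin leNgt nV.
Qed.

Lemma dense_seq (x0 : X) : exists D : nat -> X,
  forall x e, 0 < e -> exists n, d x (D n) < e.
Proof.
have H (p : nat * nat) : exists s : seq X,
    forall x, B x0 p.1.+1%:R x -> exists2 y, y \in s & d x y < p.2.+1%:R^-1.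
  by apply: qball_net.
have [s hs] := choice H.
exists (fun n => if unpickle n is Some (p, i) then nth x0 (s p) i else x0).
move=> x e e0.
have xB : B x0 (Num.trunc (d x0 x)).+1%:R x by exact: truncnS_gt.
have [y ys xy] := hs (Num.trunc (d x0 x), Num.trunc e^-1) x xB.
exists (pickle ((Num.trunc (d x0 x), Num.trunc e^-1), index y (s (Num.trunc (d x0 x), Num.trunc
  e^-1)))).
rewrite pickleK nth_index//; apply: lt_trans xy _ => /=.
by rewrite invf_plt ?posrE//; exact: truncnS_gt.
Qed.

(** A radius of at most [4 * K1 * t] around a centre within [t] of the point gives
    [K1 * (t + 4 * K1 * t)], and [1 <= K1]. *)
Definition cover_cst : R := 5 * K1 ^+ 2.

(** Centres run through a dense sequence and radii through the positive rationals. Every ball is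
    trapped between a member and a comparable ball, so a supremum over all balls becomes one over a
    countable family, and its superlevel sets are enclosed in measurable sets. *)
Lemma qball_family (x0 : X) : exists (c : nat -> X) (r : nat -> R),
  (forall n, 0 < r n) /\
  forall x t, 0 < t -> exists n, [/\ B x t `<=` B (c n) (r n),
    B (c n) (r n) `<=` B x (cover_cst * t) & r n <= cover_cst * t].
Proof.
have [D hD] := dense_seq x0.
pose c n := if (unpickle n : option (nat * nat * nat)) is Some (i, k, m) then D i else x0.
pose r n := if (unpickle n : option (nat * nat * nat)) is Some (i, k, m) then
  m.+1%:R / k.+1%:R else (1 : R).
exists c, r; split; first by move=> n; rewrite /r; case: unpickle => [[[i k] m]|].
move=> x t t0; have [i xi] := hD x t t0.
have K1g := K1_ge1 HX.
pose u := 2 * K1 * t; have u0 : 0 < u by rewrite /u; nra.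
pose k := Num.trunc u^-1; pose m := Num.trunc (u * k.+1%:R).
have k1 : 1 < u * k.+1%:R.
  by rewrite mulrC -ltr_pdivrMr// div1r; exact: truncnS_gt.
have /andP[m1 m2] : m%:R <= u * k.+1%:R < m.+1%:R.
  by apply: truncn_itv; rewrite mulr_ge0// ltW.
pose q : R := m.+1%:R / k.+1%:R.
have q1 : u <= q by rewrite /q ler_pdivlMr// ltW.
have q2 : q <= 2 * u.
  by rewrite /q ler_pdivrMr// -mulrA -natr1; lra.
have u2 : u <= 2 * K1 * t by [].
exists (pickle (i, k, m)); rewrite /c /r pickleK -/q; split.
- apply: (@subset_trans _ (B (D i) (K1 * (t + t)))).
    by apply: qball_shift; rewrite Qdist_sym.
  by apply: qball_le; apply: le_trans q1; rewrite /u; lra.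
- apply: (@subset_trans _ (B x (K1 * (t + q)))); first exact: qball_shift.
  apply: qball_le; rewrite /cover_cst expr2 -mulrA [leRHS]mulrCA -mulrA.
  rewrite ler_pM2l//; nra.
- rewrite /cover_cst; apply: le_trans q2 _; rewrite /u; nra.
Qed.

End geometry.

Section negligible.
Context {R : realType} {disp : measure_display} {T : measurableType disp}.
Variable mu : {measure set T -> \bar R}.

Lemma measurable_gt (g : T -> R) (a : R) :
  measurable_fun setT g -> measurable [set x | a < g x].
Proof.
move=> mg; have := mg measurableT `]a, +oo[%classic (measurable_itv _).
by rewrite setTI; congr measurable; apply/seteqP; split => x /=; rewrite in_itv/= andbT.
Qed.

Lemma markov_measure_le (g : T -> R) (a : R) : 0 < a ->
  measurable_fun setT g -> (forall x, 0 <= g x) ->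
  (mu [set x | (a < g x)%R] <= a^-1%:E * \int[mu]_x (g x)%:E)%E.
Proof.
move=> a0 mg g0; have mA := measurable_gt a mg.
rewrite -[leLHS]mul1e -(mulVf (lt0r_neq0 a0)) EFinM -muleA.
apply: lee_wpmul2l; first by rewrite lee_fin invr_ge0 ltW.
rewrite -integral_cst_EFin//; apply: (@le_trans _ _ (\int[mu]_(x in [set x | (a < g x)%R])
  (g x)%:E)%E).
  by apply: le_lower_integral => x /=; rewrite lee_fin; [rewrite ltW|exact: ltW].
by apply: le_lower_integral_subset => // x _; rewrite lee_fin.
Qed.

Lemma negligible_small (S : set T) :
  (forall e : R, 0 < e ->
    exists A, [/\ measurable A, S `<=` A & (mu A <= e%:E)%E]) ->
  mu.-negligible S.
Proof.
move=> H.
have /choice[A hA] (m : nat) : exists A,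
    [/\ measurable A, S `<=` A & (mu A <= (m.+1%:R^-1)%:E)%E] by apply: H.
have mA : measurable (\bigcap_m A m) by apply: bigcapT_measurable => m; case: (hA m).
exists (\bigcap_m A m); split => //; last by move=> x Sx m _; case: (hA m) => _ + _; exact.
apply/eqP; rewrite eq_le measure_ge0 andbT; apply/lee_addgt0Pr => e e0.
rewrite add0e; case: (hA (Num.trunc e^-1)) => mAm _ le.
apply: (@le_trans _ _ (mu (A (Num.trunc e^-1)))).
  by apply: le_measure; rewrite ?inE//; exact: bigcap_inf.
apply: le_trans le _; rewrite lee_fin invf_ple ?posrE//; apply/ltW.
exact: truncnS_gt.
Qed.

End negligible.

(** * Maximal function and differentiation of integrals *)

Section differentiation.
Context {R : realType} {disp : measure_display} {X : topMeasurableType disp}.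
Variables (d : X -> X -> R) (mu : {measure set X -> \bar R}) (Q K1 K3 : R).
Hypothesis HX : Qspace d mu Q K1 K3.
Local Notation B := (qball d).

Let K1_gt0 : 0 < K1. Proof. exact: lt_le_trans (K1_ge1 HX). Qed.
Let K3_gt0 : 0 < K3. Proof. exact: lt_le_trans (K3_ge1 HX). Qed.
Let mB x r : measurable (B x r). Proof. exact: (measurable_qball HX). Qed.

Lemma cover_cst_gt0 : 0 < cover_cst K1.
Proof. by rewrite /cover_cst mulr_gt0// exprn_gt0. Qed.

Lemma dilation_gt0 : 0 < dilation K1.
Proof. exact: lt_le_trans (dilation_ge1 HX). Qed.

(** Weak type (1,1) of the Hardy-Littlewood maximal function. The set [U] is a union of members of
    the countable family, hence measurable, and the Vitali covering bounds its measure. *)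
Lemma weak_type_maximal (x0 : X) (g : X -> R) (lambda : R) : 0 < lambda ->
  measurable_fun setT g -> (forall x, 0 <= g x) ->
  exists U, [/\ measurable U,
    forall x t, 0 < t -> ((lambda * t `^ Q)%:E < \int[mu]_(y in B x t) (g y)%:E)%E -> U x &
    (mu U <= (K3 * (dilation K1 * cover_cst K1) `^ Q / lambda)%:E
                * \int[mu]_x (g x)%:E)%E].
Proof.
move=> l0 mg g0; have [c [r [r0 hcr]]] := qball_family HX x0.
pose k := (cover_cst K1) `^ Q.
have k0 : 0 < k by rewrite powR_gt0// cover_cst_gt0.
pose P n := (((lambda / k) * r n `^ Q)%:E < \int[mu]_(y in B (c n) (r n)) (g y)%:E)%E.
exists (\bigcup_(n in P) B (c n) (r n)); split.
- by apply: bigcup_measurable => n _.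
- move=> x t t0 xt; have [n [sub _ rn]] := hcr x t t0.
  exists n; last by exact: sub _ (qball_center HX x t0).
  apply: (@lt_le_trans _ _ (\int[mu]_(y in B x t) (g y)%:E)%E); last first.
    by apply: le_lower_integral_subset => // y _; rewrite lee_fin.
  apply: le_lt_trans xt; rewrite lee_fin -mulrA ler_pM2l// mulrC ler_pdivrMr//.
  rewrite -powRM ?(ltW t0) ?(ltW cover_cst_gt0)//; apply: ge0_ler_powR.
  + exact: ltW (Q_gt0 HX).
  + by rewrite nnegrE ltW.
  + by rewrite nnegrE mulr_ge0 ?(ltW t0) ?(ltW cover_cst_gt0).
  + by rewrite mulrC.
have lk : 0 <= (lambda / k)^-1 by rewrite invr_ge0 divr_ge0 ?ltW.
apply: le_trans (@vitali_measure_le _ _ _ _ _ _ _ _ HX c r r0 P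
  (fun n => B (c n) (r n)) (K3 * dilation K1 `^ Q)
  (fun x => (lambda / k)^-1 * g x) _ _ _ _ _ _) _ => //.
- by rewrite mulr_ge0 ?powR_ge0 ?ltW.
- exact: measurable_funM.
- by move=> x; rewrite mulr_ge0.
- move=> j Pj; apply: (@le_trans _ _ (mu (B (c j) (dilation K1 * r j)))).
    apply: le_measure; rewrite ?inE//; first by apply: bigcup_measurable => n _.
    by move=> x [i [Pi sub] xi]; exact: sub.
  apply: le_trans (qball_mu_le HX _ _) _; first by rewrite mulr_gt0 ?dilation_gt0.
  by rewrite lee_fin powRM ?(ltW dilation_gt0) ?(ltW (r0 _))// mulrA.
- move=> j Pj; under eq_integral do rewrite EFinM.
  rewrite ge0_integralZl_EFin//; last first.
  + by apply: measurable_funTS; exact/measurable_EFinP.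
  + by move=> x _; rewrite lee_fin.
  rewrite -[leLHS]mul1e -(mulVf (lt0r_neq0 (divr_gt0 l0 k0))) EFinM -muleA.
  by apply: lee_wpmul2l; rewrite ?lee_fin// -EFinM; exact: ltW.
- under eq_integral do rewrite EFinM.
  rewrite ge0_integralZl_EFin//; last first.
  + by apply: measurable_funTS; exact/measurable_EFinP.
  + by move=> x _; rewrite lee_fin.
  rewrite muleA -EFinM powRM ?(ltW dilation_gt0) ?(ltW cover_cst_gt0)// -/k.
  apply: lee_wpmul2r; first by apply: integral_ge0 => x _; rewrite lee_fin.
  by rewrite lee_fin invf_div !mulrA.
Qed.

Hypothesis Cc_dense : Cc_dense_L1 mu.

(** One half of the Lebesgue differentiation theorem. Replace [g] by a continuous [h] close to it in
    L1. Off a set of small measure both [|g - h|] and its means are at most [e / 4], and continuity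
    of [h] then makes some small mean of [g] exceed [lambda]. *)
Lemma differentiation_gt (x0 : X) (g : X -> R) (lambda tau : R) : 0 < tau ->
  mu.-integrable setT (EFin \o g) -> (forall x, 0 <= g x) -> 0 <= lambda ->
  mu.-negligible [set x | lambda < g x /\ forall t, 0 < t < tau ->
    (\int[mu]_(y in B x t) (g y)%:E <= lambda%:E * mu (B x t))%E].
Proof.
move=> tau0 ig g0 l0.
have mg : measurable_fun setT g by apply/measurable_EFinP; exact: measurable_int ig.
pose S e := [set x | lambda + e < g x /\ forall t, 0 < t < tau ->
    (\int[mu]_(y in B x t) (g y)%:E <= lambda%:E * mu (B x t))%E].
suff HS (n : nat) : mu.-negligible (S n.+1%:R^-1).
  apply: negligibleS (negligible_bigcup HS) => x [lx hx].
  exists (Num.trunc (g x - lambda)^-1) => //; split => //.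
  rewrite -ltrBrDl invf_plt ?posrE ?subr_gt0//; exact: truncnS_gt.
set e := n.+1%:R^-1; have e0 : 0 < e by rewrite invr_gt0.
apply: negligible_small => eps eps0.
(* The factor [K3^-1] turns a bound by [a] times the power Q of the radius into a bound by [e / 4]
   times the measure of the ball. *)
pose a := e / 4 * K3^-1.
have a0 : 0 < a by rewrite mulr_gt0 ?invr_gt0 ?divr_gt0.
pose C := K3 * (dilation K1 * cover_cst K1) `^ Q / a + (e / 4)^-1.
have C0 : 0 < C.
  apply: addr_gt0; last by rewrite invr_gt0 divr_gt0.
  rewrite divr_gt0 // mulr_gt0 // powR_gt0 // mulr_gt0 //;
    [exact: dilation_gt0|exact: cover_cst_gt0].
have [h [ch _ ih gh]] := Cc_dense ig (divr_gt0 eps0 C0).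
have mh : measurable_fun setT h by apply/measurable_EFinP; exact: measurable_int ih.
pose f x := `|g x - h x|.
have mf : measurable_fun setT f.
  by apply: measurableT_comp => //; exact: measurable_funB.
have f0 x : 0 <= f x by rewrite /f.
have [U [mU hU Ule]] := weak_type_maximal x0 a0 mf f0.
exists (U `|` [set x | e / 4 < f x]); split.
- by apply: measurableU => //; exact: measurable_gt.
- move=> x [gx hx]; have [fx|fx] := ltrP (e / 4) (f x); first by right.
  left; apply: contrapT => nUx.
  have hf t : 0 < t -> (\int[mu]_(y in B x t) (f y)%:E <= (e / 4)%:E * mu (B x t))%E.
    move=> t0; apply: (@le_trans _ _ (a * t `^ Q)%:E).
      by rewrite leNgt; apply/negP => /(hU _ _ t0).
    rewrite /a -mulrA EFinM; apply: lee_wpmul2l; first by rewrite lee_fin ltW// divr_gt0.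
    exact: qball_mu_ge HX _ _ t0.
  have hx' : lambda + e / 2 < h x.
    by move: fx gx; rewrite /f ler_norml => /andP[_]; lra.
  have [t /andP[t0 tt] sub] : exists2 t, 0 < t < tau & B x t `<=` [set y | lambda + e / 2 < h y].
    have : nbhs x (h @^-1` [set z | lambda + e / 2 < z]) by apply: ch; exact: lt_nbhsr.
    move=> /(Qspace_nbhs HX)[t t0 sub].
    exists (Num.min t (tau / 2)).
      by rewrite lt_min gt_min t0 divr_gt0//=; apply/orP; right; lra.
    by apply: subset_trans sub; apply: qball_le; rewrite ge_min lexx.
  have fm := qball_mu_fin HX x t0.
  have : ((lambda + e / 2)%:E * mu (B x t) <= (lambda + e / 4)%:E * mu (B x t))%E.
    rewrite -integral_cst_EFin// [in leRHS]EFinD [leRHS]muleDl ?fin_num_adde_defl//.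
    apply: (@le_trans _ _ (\int[mu]_(y in B x t) ((g y)%:E + (f y)%:E))%E); last first.
      rewrite ge0_integralD//; first last.
      - by apply: measurable_funTS; exact/measurable_EFinP.
      - by move=> y _; rewrite lee_fin.
      - by apply: measurable_funTS; exact/measurable_EFinP.
      - by move=> y _; rewrite lee_fin.
      by apply: leeD; [apply: hx; rewrite t0|exact: hf].
    apply: le_lower_integral => y /=; first by rewrite lee_fin; lra.
    move=> /sub /= hy; rewrite -EFinD lee_fin.
    have : h y - g y <= f y by rewrite /f distrC ler_norm.
    by lra.
  rewrite lee_pmul2r//; last first.
    apply: lt_le_trans (qball_mu_ge HX _ t0).
    by rewrite lte_fin mulr_gt0 ?invr_gt0 ?powR_gt0.
  by rewrite lee_fin; lra.
apply: le_trans (measureU2 _ _ _) _ => //; first exact: measurable_gt.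
have if0 : (0 <= \int[mu]_x (f x)%:E)%E.
  by apply: integral_ge0 => x _; rewrite lee_fin.
have e40 : 0 < e / 4 by rewrite divr_gt0.
apply: le_trans (leeD Ule (markov_measure_le mu e40 mf f0)) _.
rewrite -ge0_muleDl; last 2 first.
- by rewrite lee_fin mulr_ge0 ?invr_ge0 ?(ltW a0)// mulr_ge0 ?powR_ge0 ?ltW.
- by rewrite lee_fin invr_ge0 ltW.
rewrite -EFinD -/C -[eps](divfK (lt0r_neq0 C0)) [in leRHS]mulrC [in leRHS]EFinM.
by apply: lee_wpmul2l; rewrite ?lee_fin; exact: ltW.
Qed.

End differentiation.

(** * Integrals and series of nonnegative functions *)

Section nonnegative.
Context {R : realType} {disp : measure_display} {T : measurableType disp}.
Variable mu : {measure set T -> \bar R}.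
Implicit Types (D : set T) (g h : T -> R).

Lemma ge0_integralZ_fun D g (k : R) : measurable D -> measurable_fun setT g ->
  (forall x, 0 <= g x) -> 0 <= k ->
  (\int[mu]_(x in D) (k * g x)%:E = k%:E * \int[mu]_(x in D) (g x)%:E)%E.
Proof.
move=> mD mg g0 k0; under eq_integral do rewrite EFinM.
apply: ge0_integralZl_EFin => //; first by move=> x _; rewrite lee_fin.
by apply: measurable_funTS; exact/measurable_EFinP.
Qed.

Lemma ge0_integralD_fun D g h : measurable D -> measurable_fun setT g ->
  measurable_fun setT h -> (forall x, 0 <= g x) -> (forall x, 0 <= h x) ->
  (\int[mu]_(x in D) (g x + h x)%:E =
   \int[mu]_(x in D) (g x)%:E + \int[mu]_(x in D) (h x)%:E)%E.
Proof.
move=> mD mg mh g0 h0; under eq_integral do rewrite EFinD.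
apply: ge0_integralD => //.
- by move=> x _; rewrite lee_fin.
- by apply: measurable_funTS; exact/measurable_EFinP.
- by move=> x _; rewrite lee_fin.
- by apply: measurable_funTS; exact/measurable_EFinP.
Qed.

Lemma integral_EFin_ge0 D g : (forall x, 0 <= g x) ->
  (0 <= \int[mu]_(x in D) (g x)%:E)%E.
Proof. by move=> g0; apply: integral_ge0 => x _; rewrite lee_fin. Qed.

Lemma le_integral_EFin D g h : (forall x, D x -> 0 <= g x) ->
  (forall x, D x -> g x <= h x) ->
  (\int[mu]_(x in D) (g x)%:E <= \int[mu]_(x in D) (h x)%:E)%E.
Proof. by move=> g0 gh; apply: le_lower_integral => x Dx; rewrite lee_fin; auto. Qed.

Lemma le_integral_subset_EFin (A B : set T) g : A `<=` B -> (forall x, 0 <= g x) ->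
  (\int[mu]_(x in A) (g x)%:E <= \int[mu]_(x in B) (g x)%:E)%E.
Proof. by move=> AB g0; apply: le_lower_integral_subset => // x _; rewrite lee_fin. Qed.

Lemma nneseries_le (u : nat -> \bar R) (M : \bar R) : (forall n, 0 <= u n)%E ->
  (forall n, \sum_(0 <= i < n) u i <= M)%E -> (\sum_(n <oo) u n <= M)%E.
Proof.
move=> u0 uM; apply: lime_le; last exact: nearW.
by apply: is_cvg_nneseries => n _ _.
Qed.

Lemma nneseries_ge_term (u : nat -> \bar R) n : (forall n, 0 <= u n)%E ->
  (u n <= \sum_(n <oo) u n)%E.
Proof.
move=> u0; apply: le_trans (nneseries_lim_ge n.+1 _) => //.
by rewrite big_nat_recr//= leeDr// sume_ge0.
Qed.

Lemma nneseries_geometric_le (u : nat -> \bar R) (a z : R) : 0 <= a -> 0 <= z < 1 ->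
  (forall n, 0 <= u n)%E -> (forall n, u n <= (a * z ^+ n)%:E)%E ->
  (\sum_(n <oo) u n <= (a / (1 - z))%:E)%E.
Proof.
move=> a0 /andP[z0 z1] u0 uz; apply: nneseries_le => // n.
apply: (@le_trans _ _ (\sum_(0 <= i < n) (a * z ^+ i)%:E)%E); first exact: lee_sum.
rewrite sumEFin lee_fin ler_pdivlMr ?subr_gt0//.
have -> : (\sum_(0 <= i < n) a * z ^+ i) * (1 - z) = a * (1 - z ^+ n).
  rewrite -mulr_sumr -mulrA; congr (_ * _); elim: n => [|n IH].
    by rewrite big_geq// mul0r subrr.
  by rewrite big_nat_recr//= mulrDl IH exprS; ring.
by rewrite ler_piMr// gerBl exprn_ge0.
Qed.

End nonnegative.

(** * The John-Nirenberg inequality *)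

Section john_nirenberg.
Context {R : realType} {disp : measure_display} {X : topMeasurableType disp}.
Variables (d : X -> X -> R) (mu : {measure set X -> \bar R}) (Q K1 K3 : R).
Hypothesis HX : Qspace d mu Q K1 K3.
Local Notation B := (qball d).

Let K1_gt0 : 0 < K1. Proof. exact: lt_le_trans (K1_ge1 HX). Qed.
Let K3_gt0 : 0 < K3. Proof. exact: lt_le_trans (K3_ge1 HX). Qed.
Let Q0 : 0 <= Q. Proof. exact: ltW (Q_gt0 HX). Qed.
Let mB x r : measurable (B x r). Proof. exact: (measurable_qball HX). Qed.

Lemma powRQ_le (s t : R) : 0 <= s -> s <= t -> s `^ Q <= t `^ Q.
Proof.
by move=> s0 st; apply: ge0_ler_powR; rewrite // nnegrE//; exact: le_trans st.
Qed.

Variables (b : X -> R) (A : R).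
Local Notation m x r := (mean mu b (B x r)).

Record bmo_data : Prop := BmoData {
  bmo_measurable : measurable_fun setT b ;
  bmo_integrable : forall x r, 0 < r -> mu.-integrable (B x r) (EFin \o b) ;
  bmo_gt0 : 0 < A ;
  bmo_osc : forall x r, 0 < r ->
    (\int[mu]_(y in B x r) `|b y - m x r|%:E <= (A * r `^ Q)%:E)%E }.

Hypothesis Hb : bmo_data.
Let mb := bmo_measurable Hb.
Let A0 := bmo_gt0 Hb.

Lemma measurable_osc (c : R) : measurable_fun setT (fun y => `|b y - c|).
Proof. by apply: measurableT_comp => //; apply: measurable_funB. Qed.

Lemma mean_dist x r (c : R) : 0 < r ->
  (`|m x r - c|%:E * mu (B x r) <= \int[mu]_(y in B x r) `|b y - c|%:E)%E.
Proof.
move=> r0; have fm := qball_mu_fin HX x r0.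
have mpos : 0 < fine (mu (B x r)).
  rewrite fine_gt0// -ge0_fin_numE// fm andbT.
  apply: lt_le_trans (qball_mu_ge HX _ r0).
  by rewrite lte_fin mulr_gt0 ?invr_gt0 ?powR_gt0.
have ib := bmo_integrable Hb x r0.
have ic : mu.-integrable (B x r) (EFin \o cst c).
  apply/integrableP; split; first by apply/measurable_EFinP; exact: measurable_cst.
  by rewrite (@integral_cst_EFin _ _ _ mu _ `|c|)// lte_mul_pinfty// -ge0_fin_numE.
have ibc : mu.-integrable (B x r) (EFin \o (fun y => b y - c)).
  by apply: eq_integrable (integrableB (mB x r) ib ic).
have -> : m x r - c = (fine (mu (B x r)))^-1 * \int[mu]_(y in B x r) (b y - c).
  rewrite (RintegralB _ ib ic)// /mean mulrBr; congr (_ - _).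
  by rewrite /cst/= Rintegral_cst// mulrCA mulVf ?mulr1 ?gt_eqF.
rewrite normrM ger0_norm ?invr_ge0 ?(ltW mpos)// -{2}(fineK fm) -EFinM.
rewrite mulrAC mulVf ?gt_eqF// mul1r.
apply: (@le_trans _ _ (\int[mu]_(y in B x r) `|b y - c|)%R%:E).
  by rewrite lee_fin; apply: le_normr_Rintegral.
rewrite /Rintegral fineK//; apply: integrable_fin_num => //.
exact: integrable_norm ibc.
Qed.

Lemma mean_dist_le x r (c I : R) : 0 < r ->
  (\int[mu]_(y in B x r) `|b y - c|%:E <= (I * r `^ Q)%:E)%E ->
  `|m x r - c| <= K3 * I.
Proof.
move=> r0 HI; have := le_trans (mean_dist x c r0) HI.
move=> /(le_trans (lee_wpmul2l _ (qball_mu_ge HX x r0))).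
rewrite lee_fin normr_ge0 => /(_ isT); rewrite -EFinM lee_fin mulrA.
by rewrite ler_pM2r ?powR_gt0// ler_pdivrMr// mulrC.
Qed.

Lemma osc_subset x r y s k (c I : R) : 0 < r -> 0 < k -> s <= k * r -> 0 < s ->
  0 <= I -> B x r `<=` B y s ->
  (\int[mu]_(z in B y s) `|b z - c|%:E <= (I * s `^ Q)%:E)%E ->
  (\int[mu]_(z in B x r) `|b z - c|%:E <= (I * k `^ Q * r `^ Q)%:E)%E.
Proof.
move=> r0 k0 skr s0 I0 sub H.
apply: le_trans (le_integral_subset_EFin mu sub _) _; first by [].
apply: le_trans H _; rewrite lee_fin -mulrA ler_wpM2l//.
by rewrite -powRM ?(ltW k0) ?(ltW r0)//; apply: powRQ_le => //; exact: ltW.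
Qed.

Lemma mean_nested x r y s k : 0 < r -> 0 < k -> s <= k * r -> 0 < s ->
  B x r `<=` B y s -> `|m x r - m y s| <= K3 * (A * k `^ Q).
Proof.
move=> r0 k0 skr s0 sub; apply: mean_dist_le => //.
by apply: (osc_subset r0 k0 skr s0 (ltW A0) sub); exact: (bmo_osc Hb).
Qed.

Lemma osc_double x r k : 0 < r -> 1 <= k ->
  (\int[mu]_(y in B x (k * r)) `|b y - m x r|%:E <=
     ((A * k `^ Q + K3 * (A * k `^ Q) * (K3 * k `^ Q)) * r `^ Q)%:E)%E.
Proof.
move=> r0 k1; have k0 : 0 < k by exact: lt_le_trans k1.
have kr : 0 < k * r by rewrite mulr_gt0.
have sub : B x r `<=` B x (k * r) by apply: qball_le; rewrite ler_peMl// ltW.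
apply: (@le_trans _ _ (\int[mu]_(y in B x (k * r))
  (`|b y - m x (k * r)| + `|m x r - m x (k * r)|)%:E)%E).
  apply: le_integral_EFin => // y _; rewrite (distrC (m x r)).
  by apply: le_trans (ler_normD _ _); rewrite addrA subrK.
rewrite ge0_integralD_fun//; last exact: measurable_osc.
rewrite mulrDl EFinD; apply: leeD.
  apply: le_trans (bmo_osc Hb _ kr) _.
  by rewrite lee_fin powRM ?(ltW k0) ?(ltW r0)// mulrA.
rewrite integral_cst_EFin//.
apply: (@le_trans _ _ ((K3 * (A * k `^ Q))%:E * (K3 * (k * r) `^ Q)%:E)%E).
  by apply: lee_pmul; rewrite ?lee_fin//; [exact: mean_nested|exact: qball_mu_le HX _ _ kr].
by rewrite -EFinM lee_fin powRM ?(ltW k0) ?(ltW r0)// !mulrA.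
Qed.

End john_nirenberg.

(** Among the scales [r / M ^+ j], the largest one where the mean exceeds [l] has a good
    predecessor. The factor with [M] in the hypothesis at [t] pays for rounding [t] up to one of
    these scales. *)
Lemma stopping_scale (R : realType) (I : R -> \bar R) (Q l M r t : R) :
  0 <= Q -> 0 <= l -> 2 <= M -> (forall s s', s <= s' -> (I s <= I s')%E) ->
  0 < t < r -> ((l * r `^ Q)%:E >= I r)%E ->
  ((l * M `^ Q * t `^ Q)%:E < I t)%E ->
  exists s, [/\ 0 < s, M * s <= r, ((l * s `^ Q)%:E < I s)%E &
    (I (M * s)%R <= (l * (M * s) `^ Q)%:E)%E].
Proof.
move=> Q0 l0 M2 Imono /andP[t0 tr] Ir It.
have M0 : 0 < M by lra.
have r0 : 0 < r by exact: lt_trans tr.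
have s0 k : 0 < r / M ^+ k by rewrite divr_gt0// exprn_gt0.
have exk : exists k, r / M ^+ k < t.
  exists (Num.trunc (r / t)).+1; set k := (Num.trunc _).+1.
  rewrite ltr_pdivrMr ?exprn_gt0// mulrC -ltr_pdivrMr//.
  apply: lt_trans (truncnS_gt _) _; rewrite -/k.
  apply: (@lt_le_trans _ _ (2 ^+ k)); first by rewrite -natrX ltr_nat ltn_expl.
  by rewrite lerXn2r ?nnegrE// ltW.
have MS k : M * (r / M ^+ k.+1) = r / M ^+ k.
  by rewrite exprS; field; rewrite !gt_eqF ?exprn_gt0.
case: (ex_minnP exk) => -[|k]; first by rewrite expr0 divr1 => /lt_trans/(_ tr); rewrite ltxx.
move=> kt kmin.
pose P j := ((l * (r / M ^+ j) `^ Q)%:E < I (r / M ^+ j)%R)%E.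
have exP : exists j, P j.
  exists k; rewrite /P.
  have tk : t <= r / M ^+ k by rewrite leNgt; apply/negP => /kmin; rewrite ltnn.
  apply: lt_le_trans (Imono _ _ tk); apply: le_lt_trans It.
  rewrite lee_fin -mulrA ler_wpM2l// -powRM ?(ltW M0) ?(ltW t0)//.
  apply: ge0_ler_powR => //; rewrite ?nnegrE; [exact: ltW|by rewrite mulr_ge0// ltW|].
  by rewrite -MS ler_pM2l// ltW.
case: (ex_minnP exP) => -[|j] Pj jmin.
  by move: Pj; rewrite /P expr0 divr1 ltNge Ir.
exists (r / M ^+ j.+1); split => //.
  by rewrite MS ler_pdivrMr ?exprn_gt0// ler_peMr ?(ltW r0)// exprn_ege1//; lra.
by rewrite MS leNgt; apply/negP => /jmin; rewrite ltnn.
Qed.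

Section john_nirenberg_decay.
Context {R : realType} {disp : measure_display} {X : topMeasurableType disp}.
Variables (d : X -> X -> R) (mu : {measure set X -> \bar R}) (Q K1 K3 : R).
Hypothesis HX : Qspace d mu Q K1 K3.
Hypothesis Cc_dense : Cc_dense_L1 mu.
Local Notation B := (qball d).
Variables (b : X -> R) (A : R).
Hypothesis Hb : bmo_data d mu Q b A.
Local Notation m x r := (mean mu b (B x r)).

Let K1_gt0 : 0 < K1. Proof. exact: lt_le_trans (K1_ge1 HX). Qed.
Let K3_gt0 : 0 < K3. Proof. exact: lt_le_trans (K3_ge1 HX). Qed.
Let Q0 : 0 <= Q. Proof. exact: ltW (Q_gt0 HX). Qed.
Let mB x r : measurable (B x r). Proof. exact: (measurable_qball HX). Qed.
Let mb := bmo_measurable Hb.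
Let A0 := bmo_gt0 Hb.
Local Notation M0 := (cover_cst K1).
Local Notation Kd := (dilation K1).
Let M0_gt0 : 0 < M0. Proof. exact: (cover_cst_gt0 HX). Qed.
Let Kd_gt0 : 0 < Kd. Proof. exact: (dilation_gt0 HX). Qed.

Lemma measurable_osc_gt (c a : R) : measurable [set y | a < `|b y - c|].
Proof. by apply: measurable_gt; exact: measurable_osc Hb c. Qed.

(** [M] makes the [Kd]-dilate of a family member around a point lie in the [M]-dilate of the ball it
    covers. [A2] bounds the oscillation over the [2 * K1]-dilate. [l1] is chosen so that the Vitali
    sum of the stopping balls yields exactly one factor 1/2. In [Lambda], two factors [K3] compare
    radii through measures and one turns an integral bound into a bound on means. *)
Let M := K1 * (M0 + Kd * M0).
Let A2 := A * (2 * K1) `^ Q + K3 * (A * (2 * K1) `^ Q) * (K3 * (2 * K1) `^ Q).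
Let l1 := 2 * (Kd `^ Q * M0 `^ Q * A2).
Let Lambda := K3 * (l1 * (K3 ^+ 2 * M `^ Q)).

(* [Calderon-Zygmund] at height [l1]: off a null set, the points of a ball where
   [b] is far from its mean lie in balls on whose dilates the mean of [b] has
   moved by at most [Lambda]. *)
Lemma stopping_cover (c : nat -> X) (r : nat -> R) x t :
  (forall n, 0 < r n) ->
  (forall x t, 0 < t -> exists n, [/\ B x t `<=` B (c n) (r n),
    B (c n) (r n) `<=` B x (M0 * t) & r n <= M0 * t]) -> 0 < t ->
  let g y := `|b y - m x t| * \1_(B x (2 * K1 * t)) y in
  exists N, [/\ measurable N, mu N = 0%E &
    forall y, B x t y -> Lambda < `|b y - m x t| -> ~ N y ->
    exists n, [/\ B (c n) (r n) y,
      ((l1 / M0 `^ Q * r n `^ Q)%:E < \int[mu]_(z in B (c n) (r n)) (g z)%:E)%E &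
      `|m (c n) (Kd * r n) - m x t| <= Lambda]].
Proof.
move=> r0 hcr t0 g.
have K1g := K1_ge1 HX.
have k1 : 1 <= 2 * K1 by lra.
have A2_0 : 0 <= A2 by rewrite /A2 addr_ge0// !mulr_ge0 ?powR_ge0 ?ltW.
have l1_0 : 0 <= l1 by rewrite /l1 !mulr_ge0 ?powR_ge0.
have ob := osc_double HX Hb x t0 k1; rewrite -/A2 in ob.
have one : 1 `^ Q = 1 :> R by rewrite powR1.
have Kd1 : 1 <= Kd `^ Q.
  by rewrite -[leLHS]one; apply: (powRQ_le HX) => //; exact: dilation_ge1 HX.
have M01 : 1 <= M0 `^ Q.
  rewrite -[leLHS]one; apply: (powRQ_le HX) => //.
  by rewrite /cover_cst expr2; nra.
have A2l1 : A2 <= l1.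
  rewrite /l1 mulrCA -[leLHS]mul1r.
  by have := mulr_ege1 Kd1 M01; nra.
have M2 : 2 <= M.
  rewrite /M /cover_cst /dilation expr2; nra.
have g0 y : 0 <= g y by rewrite /g mulr_ge0.
have gE S : measurable S -> S `<=` B x (2 * K1 * t) ->
    (\int[mu]_(y in S) (g y)%:E = \int[mu]_(y in S) `|b y - m x t|%:E)%E.
  move=> mS sub; apply: eq_integral => y /set_mem/sub By.
  by rewrite /g indicE mem_set// mulr1.
have subB y s : B x t y -> s <= t -> B y s `<=` B x (2 * K1 * t).
  move=> xy st; apply: (@subset_trans _ (B x (K1 * (t + s)))); first exact: (qball_shift HX).
  by apply: (qball_le); nra.
have mg : measurable_fun setT g.
  by apply: measurable_funM; [exact: measurable_osc Hb _|exact: measurable_indic].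
have intg : (\int[mu]_y (g y)%:E <= (A2 * t `^ Q)%:E)%E.
  by rewrite /g ge0_integral_restr.
have ig : mu.-integrable setT (EFin \o g).
  apply/integrableP; split; first exact/measurable_EFinP.
  under eq_integral do rewrite /= ger0_norm//.
  by apply: le_lt_trans intg _; rewrite ltry.
have KM0 : 0 <= K3 * (l1 * M `^ Q) by rewrite mulr_ge0 ?(ltW K3_gt0)// mulr_ge0// powR_ge0.
have DG := differentiation_gt HX Cc_dense x t0 ig g0 KM0.
have [N [mN N0 HN]] := DG.
exists N; split => // y xy Ly nNy.
have K31 := K3_ge1 HX.
(* If the means on all small balls around [y] stayed below this height, differentiation would place
   [y] in the null set [N]. *)
have [s /andP[s0 st] Hs] : exists2 s, 0 < s < t &
    ((l1 * M `^ Q * s `^ Q)%:E < \int[mu]_(z in B y s) `|b z - m x t|%:E)%E.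
  apply: contrapT => nex; apply: nNy; apply: HN; split.
    rewrite /g indicE mem_set ?mulr1; last first.
      by apply: qball_le xy; nra.
    apply: le_lt_trans Ly; rewrite /Lambda ler_pM2l//.
    rewrite ler_wpM2l// ler_peMl ?powR_ge0//.
    by rewrite exprn_ege1.
  move=> s /andP[s0 st]; rewrite gE//; last exact: subB xy (ltW st).
  apply: (@le_trans _ _ (l1 * M `^ Q * s `^ Q)%:E).
    by rewrite leNgt; apply/negP => Hs; apply: nex; exists s => //; rewrite s0.
  apply: le_trans (lee_wpmul2l _ (qball_mu_ge HX y s0)); last by rewrite lee_fin.
  rewrite -EFinM lee_fin (_ : K3 * _ * _ = l1 * M `^ Q * s `^ Q)//.
  by field; rewrite gt_eqF.
have Imono s1 s2 : s1 <= s2 -> (\int[mu]_(z in B y s1) `|b z - m x t|%:E <=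
    \int[mu]_(z in B y s2) `|b z - m x t|%:E)%E.
  by move=> s12; apply: le_integral_subset_EFin => //; exact: qball_le.
have It : (\int[mu]_(z in B y t) `|b z - m x t|%:E <= (l1 * t `^ Q)%:E)%E.
  apply: (@le_trans _ _ (A2 * t `^ Q)%:E); last by rewrite lee_fin ler_wpM2r ?powR_ge0.
  apply: le_trans ob; apply: le_integral_subset_EFin => //; exact: subB.
have st' : 0 < s < t by rewrite s0.
have [u [u0 Mu Hu HMu]] :=
  @stopping_scale _ (fun s => (\int[mu]_(z in B y s) `|b z - m x t|%:E)%E) Q l1 M t s
    Q0 l1_0 M2 Imono st' It Hs.
have [n [sub1 sub2 rn]] := hcr y u u0.
have ut : u <= t by apply: le_trans Mu; rewrite ler_peMl ?ltW//; lra.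
exists n; split.
- exact: sub1 _ (qball_center HX y u0).
- apply: (@lt_le_trans _ _ (\int[mu]_(z in B y u) (g z)%:E)%E); last first.
    exact: le_integral_subset_EFin.
  rewrite gE//; last exact: subB xy ut.
  apply: le_lt_trans Hu; rewrite lee_fin -mulrA ler_wpM2l// mulrC ler_pdivrMr ?powR_gt0//.
  rewrite -powRM ?(ltW u0) ?(ltW M0_gt0)//.
  by apply: (powRQ_le HX); [exact: ltW|rewrite mulrC].
- have rn0 := r0 n.
  have Kr0 : 0 < Kd * r n by rewrite mulr_gt0.
  apply: (mean_dist_le HX Hb Kr0).
  apply: (@le_trans _ _ (l1 * (M * u) `^ Q)%:E).
    apply: le_trans HMu; apply: le_integral_subset_EFin => //.
    apply: (@subset_trans _ (B y (K1 * (M0 * u + Kd * r n)))).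
      by apply: (qball_shift HX); apply: sub2; exact: (qball_center HX).
    apply: qball_le; rewrite /M -mulrA ler_pM2l// mulrDl lerD2l -mulrA.
    by rewrite ler_pM2l.
  rewrite lee_fin -[leRHS]mulrA ler_wpM2l// (powRM _ _ (ltW u0)); last exact: le_trans M2.
  rewrite (mulrC (K3 ^+ 2)) -[leRHS]mulrA ler_wpM2l ?powR_ge0//.
  have := le_trans (qball_mu_ge HX y u0) (le_trans (le_measure mu (mem_set (mB _ _))
    (mem_set (mB _ _)) sub1) (qball_mu_le HX _ rn0)).
  rewrite lee_fin ler_pdivrMl// => H; rewrite expr2 -mulrA.
  apply: le_trans H _; rewrite !ler_pM2l//.
  by apply: (powRQ_le HX); [exact: ltW|rewrite ler_peMl ?(ltW rn0)//; exact: dilation_ge1 HX].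
Qed.

(** Induction on the height. On the dilate of a stopping ball the mean has moved by at most
    [Lambda], so exceeding [(k + 1) * Lambda] on the large ball forces exceeding [k * Lambda] on the
    dilate; the Vitali sum over stopping balls then contributes the factor 1/2. *)
Lemma john_nirenberg_decay : 0 < Lambda /\ forall k x t, 0 < t ->
  (mu (B x t `&` [set y | (k%:R * Lambda < `|b y - m x t|)%R]) <=
    (K3 * 2^-1 ^+ k * t `^ Q)%:E)%E.
Proof.
have K1g := K1_ge1 HX.
have k1 : 1 <= 2 * K1 by lra.
have k10 : 0 < 2 * K1 by lra.
have A2_0 : 0 < A2 by rewrite /A2 addr_gt0// !mulr_gt0// ?powR_gt0.
have l1_0 : 0 < l1 by rewrite /l1 !mulr_gt0// ?powR_gt0.
have M_0 : 0 < M by rewrite /M mulr_gt0// addr_gt0// mulr_gt0.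
have L0 : 0 < Lambda by rewrite /Lambda !mulr_gt0// ?powR_gt0// exprn_gt0.
split => //; elim => [|k IH] x t t0.
  rewrite expr0 mulr1; apply: le_trans (qball_mu_le HX x t0).
  by apply: le_measure; rewrite ?inE//; apply: measurableI => //; exact: measurable_osc_gt.
have [c [r [r0 hcr]]] := qball_family HX x.
have [N [mN N0 HN]] := stopping_cover x r0 hcr t0.
pose g y := `|b y - m x t| * \1_(B x (2 * K1 * t)) y.
have g0 y : 0 <= g y by rewrite /g mulr_ge0.
have mg : measurable_fun setT g.
  by apply: measurable_funM; [exact: measurable_osc Hb _|exact: measurable_indic].
have intg : (\int[mu]_y (g y)%:E <= (A2 * t `^ Q)%:E)%E.
  by rewrite /g ge0_integral_restr//; exact: (osc_double HX Hb x t0 k1).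
set E := B x t `&` _.
have mE : measurable E by apply: measurableI => //; exact: measurable_osc_gt.
pose P n := ((l1 / M0 `^ Q * r n `^ Q)%:E < \int[mu]_(z in B (c n) (r n)) (g z)%:E)%E /\
      `|m (c n) (Kd * r n) - m x t| <= Lambda.
pose F n := B (c n) (r n) `&` E.
have mF n : measurable (F n) by exact: measurableI.
have sub : E `<=` N `|` \bigcup_(n in P) F n.
  move=> y Ey; have [Ny|nNy] := pselect (N y); [by left|right].
  have [xy Ly] := Ey.
  have [|n [yn Pn1 Pn2]] := HN y xy _ nNy.
    by apply: le_lt_trans Ly; rewrite ler_peMl ?(ltW L0)// ler1n.
  by exists n.
have mbF : measurable (\bigcup_(n in P) F n) by exact: bigcup_measurable.
have th0 : 0 <= K3 * 2^-1 ^+ k * Kd `^ Q.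
  by rewrite !mulr_ge0 ?powR_ge0 ?exprn_ge0 ?(ltW K3_gt0).
have lM : 0 <= (l1 / M0 `^ Q)^-1 by rewrite invr_ge0 divr_ge0 ?powR_ge0 ?ltW.
have V : (mu (\bigcup_(n in P) F n) <= (K3 * 2^-1 ^+ k * Kd `^ Q)%:E *
     \int[mu]_y ((l1 / M0 `^ Q)^-1 * g y)%:E)%E.
  apply: (@vitali_measure_le _ _ _ _ _ _ _ _ HX c r r0 P F _ (fun y => (l1 / M0 `^ Q)^-1 * g y)
    th0 mF).
  - exact: measurable_funM.
  - by move=> y; rewrite mulr_ge0.
  (* The induction hypothesis is applied on the dilated ball, which contains all the pieces charged
     to [j]. *)
  - move=> j [Pj1 Pj2]; have Kr : 0 < Kd * r j by rewrite mulr_gt0.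
    rewrite -mulrA -powRM ?(ltW Kd_gt0) ?(ltW (r0 j))//.
    apply: le_trans (IH (c j) (Kd * r j) Kr).
    apply: le_measure; rewrite ?inE; first exact: bigcup_measurable.
      by apply: measurableI => //; exact: measurable_osc_gt.
    move=> y [i [Pi ij] [yi [xy Ly]]]; split; first exact: ij.
    move: Ly => /=; rewrite -natr1 mulrDl mul1r => Ly.
    have := ler_normD (b y - m (c j) (Kd * r j)) (m (c j) (Kd * r j) - m x t).
    by rewrite addrA subrK; lra.
  - move=> j [Pj _]; rewrite ge0_integralZ_fun//.
    rewrite -[leLHS]mul1e -(mulVf (lt0r_neq0 (divr_gt0 l1_0 (powR_gt0 Q M0_gt0)))) EFinM -muleA.
    by apply: lee_wpmul2l; rewrite ?lee_fin// -EFinM; exact: ltW.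
apply: (@le_trans _ _ (mu (N `|` \bigcup_(n in P) F n))).
  by apply: le_measure; rewrite ?inE//; exact: measurableU.
apply: le_trans (measureU2 _ mN mbF) _; rewrite [X in (X + _)%E]N0 add0e.
apply: le_trans V _; rewrite ge0_integralZ_fun//.
apply: le_trans (lee_wpmul2l _ (lee_wpmul2l _ intg)) _; rewrite ?lee_fin//.
have key (a e w p h q : R) : a != 0 -> w != 0 -> p != 0 ->
    e * h * w * ((2 * (w * p * a) / p)^-1 * (a * q)) = e * (h * 2^-1) * q.
  by move=> a0 d0 p0; field; rewrite a0 d0 p0.
by rewrite /l1 key ?exprSr ?gt_eqF ?powR_gt0.
Qed.

Lemma john_nirenberg : exists2 d0, 0 < d0 & forall x t, 0 < t ->
  (\int[mu]_(y in B x t) (expR (d0 * `|b y - m x t|))%:E <= (7 * K3 * t `^ Q)%:E)%E.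
Proof.
have [L0 H] := john_nirenberg_decay.
(* Each further height [Lambda] multiplies the exponential by 3/2 and the measure by 1/2. The layers
   form a series of ratio 3/4, whose sum is [6 * K3]; the constant 1 adds [K3]. *)
pose d0 := ln (3 / 2) / Lambda.
have l0 : 0 < ln (3 / 2 : R) by rewrite ln_gt0//; lra.
exists d0 => [|x t t0]; first by rewrite divr_gt0.
pose S k := B x t `&` [set y | (k%:R * Lambda < `|b y - m x t|)%R].
have mS k : measurable (S k) by apply: measurableI => //; exact: measurable_osc_gt.
pose u (k : nat) y := ((3 / 2 : R) ^+ k.+1 * \1_(S k) y)%:E.
have u0 k y : (0 <= u k y)%E by rewrite lee_fin mulr_ge0// exprn_ge0//; lra.
have mu_u k : measurable_fun (B x t) (u k).
  apply/measurable_EFinP; apply: measurable_funM => //; exact: measurable_indic.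
apply: (@le_trans _ _ (\int[mu]_(y in B x t) (1 + \sum_(k <oo) u k y))%E).
  apply: le_lower_integral => y xy; first by rewrite lee_fin expR_ge0.
  (* A point of zero oscillation lies in no layer [S k], since the inequality there is strict; the
     summand 1 accounts for it. *)
  have [v0|v0] := eqVneq (`|b y - m x t|) 0.
    by rewrite v0 mulr0 expR0 leeDl// nneseries_ge0.
  set v := `|b y - m x t|; have vpos : 0 < v by rewrite lt_def v0 /v /=.
  have [k /andP[k1 k2]] : exists k, k%:R * Lambda < v <= k.+1%:R * Lambda.
    have : exists k, v <= k.+1%:R * Lambda.
      exists (Num.trunc (v / Lambda)); rewrite -ler_pdivrMr//; apply/ltW.
      exact: truncnS_gt.
    move=> exk; case: (ex_minnP exk) => -[|k] vk kmin.
      by exists 0%N; rewrite mul0r vpos.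
    exists k.+1; rewrite vk andbT ltNge; apply/negP => /kmin.
    by rewrite ltnn.
  apply: (@le_trans _ _ (u k y)); last first.
    apply: le_trans (@nneseries_ge_term _ (fun k => u k y) k _) _ => //.
    by rewrite leeDr.
  rewrite /u indicE mem_set ?mulr1; last by split.
  have p0 : 0 < 3 / 2 :> R by lra.
  rewrite lee_fin -[leRHS]lnK ?posrE ?exprn_gt0// ler_expR lnXn//.
  rewrite /d0 mulrAC ler_pdivrMr// -[ln _ *+ _]mulr_natr -[leRHS]mulrA ler_pM2l//.
rewrite ge0_integralD//; first last.
- by apply: ge0_emeasurable_sum.
- by move=> y _; apply: nneseries_ge0.
rewrite integral_cst// mul1e integral_nneseries//.
have HS : (\sum_(k <oo) \int[mu]_(y in B x t) u k y <= (3 / 2 * K3 * t `^ Q / (1 - 3 / 4))%:E)%E.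
  apply: nneseries_geometric_le.
  - by rewrite !mulr_ge0 ?powR_ge0 ?(ltW K3_gt0)//; lra.
  - by lra.
  - by move=> k; apply: integral_ge0.
  - move=> k; rewrite /u ge0_integralZ_fun//.
    rewrite integral_indic// setIC setIA setIid -/(S k).
    apply: le_trans (lee_wpmul2l _ (H k x t t0)) _; first by rewrite lee_fin exprn_ge0//; lra.
    rewrite -EFinM lee_fin exprS.
    rewrite (_ : 3 / 4 = 3 / 2 * 2^-1); last by field.
    by rewrite [_ ^+ k in leRHS]exprMn; lra.
apply: le_trans (leeD (qball_mu_le HX x t0) HS) _.
rewrite -EFinD lee_fin (_ : 1 - 3 / 4 = 4^-1) ?invrK; last by field.
by have := mulr_ge0 (ltW K3_gt0) (powR_ge0 t Q); lra.
Qed.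

End john_nirenberg_decay.

Lemma powR_inv (R : realType) (u p : R) : 0 <= u -> u^-1 `^ p = (u `^ p)^-1.
Proof. by move=> u0; rewrite -(powR_inv1 u0) powRAC powR_inv1 ?powR_ge0. Qed.

Lemma powR_exprn (R : realType) (u p : R) n : 0 <= u -> (u ^+ n) `^ p = (u `^ p) ^+ n.
Proof.
by move=> u0; rewrite -(powR_mulrn n u0) -(powR_mulrn n (powR_ge0 u p)) powRAC.
Qed.

Lemma powR_div (R : realType) (u v p : R) : 0 <= u -> 0 <= v ->
  (u / v) `^ p = u `^ p / v `^ p.
Proof. by move=> u0 v0; rewrite powRM ?invr_ge0// powR_inv. Qed.

(** * Exponential control of oscillation over a countable family of balls *)

Section exponential_levels.
Context {R : realType} {disp : measure_display} {X : topMeasurableType disp}.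
Variables (d : X -> X -> R) (mu : {measure set X -> \bar R}) (Q K1 K3 : R).
Hypothesis HX : Qspace d mu Q K1 K3.
Local Notation B := (qball d).
Variables (b : X -> R) (A : R).
Hypothesis Hb : bmo_data d mu Q b A.
Local Notation m x r := (mean mu b (B x r)).
Variables (d0 J : R).
Hypotheses (d0_gt0 : 0 < d0) (J_ge0 : 0 <= J).
Hypothesis Hjn : forall x t, 0 < t ->
  (\int[mu]_(y in B x t) (expR (d0 * `|b y - m x t|))%:E <= (J * t `^ Q)%:E)%E.

Let K1_gt0 : 0 < K1. Proof. exact: lt_le_trans (K1_ge1 HX). Qed.
Let K3_gt0 : 0 < K3. Proof. exact: lt_le_trans (K3_ge1 HX). Qed.
Let Q0 : 0 <= Q. Proof. exact: ltW (Q_gt0 HX). Qed.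
Let mB x r : measurable (B x r). Proof. exact: (measurable_qball HX). Qed.
Let mb := bmo_measurable Hb.
Local Notation M0 := (cover_cst K1).
Local Notation Kd := (dilation K1).

Lemma measurable_expR_osc (e c : R) :
  measurable_fun setT (fun y => expR (e * `|b y - c|)).
Proof.
by apply: measurableT_comp => //; apply: measurable_funM => //; exact: measurable_osc Hb c.
Qed.

(** Jensen's inequality from the tangent of the exponential at [a]. The term [expR a * a] is added
    on both sides so that only nonnegative functions are integrated. *)
Lemma jensen_osc x r c a : 0 < r -> a <= d0 * `|m x r - c| ->
  ((expR a)%:E * mu (B x r) <=
   \int[mu]_(y in B x r) (expR (d0 * `|b y - c|))%:E)%E.
Proof.
move=> r0 ha; have fm := qball_mu_fin HX x r0.
have [a0|a0] := ltrP a 0.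
  rewrite -integral_cst_EFin//; apply: le_integral_EFin => y _; first exact: expR_ge0.
  by rewrite ler_expR; apply: le_trans (ltW a0) _; rewrite mulr_ge0 ?(ltW d0_gt0).
have c0 : 0 <= expR a * a by rewrite mulr_ge0 ?expR_ge0.
have mo := measurable_osc Hb c.
have : ((expR a)%:E * mu (B x r) + (expR a * a)%:E * mu (B x r) <=
    \int[mu]_(y in B x r) (expR (d0 * `|b y - c|))%:E + (expR a * a)%:E * mu (B x r))%E.
  apply: (@le_trans _ _ ((expR a)%:E * mu (B x r) + (expR a * d0)%:E *
      \int[mu]_(y in B x r) `|b y - c|%:E)%E).
    apply: leeD2l; rewrite !EFinM -!muleA; apply: lee_wpmul2l; first by rewrite lee_fin expR_ge0.
    apply: (@le_trans _ _ (d0%:E * (`|m x r - c|%:E * mu (B x r)))%E).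
      by rewrite muleA -EFinM; apply: lee_wpmul2r => //.
    apply: lee_wpmul2l; first by rewrite lee_fin ltW.
    exact: (mean_dist HX Hb).
  rewrite -!integral_cst_EFin// -ge0_integralZ_fun//; last by rewrite mulr_ge0 ?expR_ge0// ltW.
  rewrite -!ge0_integralD_fun//; first last.
  - by move=> y; rewrite mulr_ge0// mulr_ge0 ?expR_ge0// ltW.
  - exact: measurable_funM.
  - exact: measurable_expR_osc.
  apply: le_integral_EFin => y _.
    by rewrite addr_ge0 ?expR_ge0// mulr_ge0// mulr_ge0 ?expR_ge0// ltW.
  set v := `|b y - c|.
  rewrite -[d0 * v in leRHS](subrK a) [in leRHS]expRD.
  have := expR_ge1Dx (d0 * v - a); have := expR_gt0 a.
  by move: (expR (d0 * v - a)) (expR a) => u w; nra.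
by rewrite leeD2rE// fin_numM.
Qed.

Section family.
Variables (c : nat -> X) (r : nat -> R).
Hypothesis r_gt0 : forall n, 0 < r n.
Local Notation mm n := (m (c n) (r n)).

Definition sup_osc_cst := J * (1 + K3 ^+ 2 * Kd `^ Q).

Lemma sup_osc_cst_ge0 : 0 <= sup_osc_cst.
Proof. by rewrite /sup_osc_cst mulr_ge0// addr_ge0// mulr_ge0 ?powR_ge0// exprn_ge0// ltW. Qed.

(** If [b x] is farther than [L] from the mean over a member ball, then either [b x] or that mean is
    farther than [L / 2] from the mean over the large ball. Markov bounds the first set; the balls
    of the second kind are summed by Vitali, Jensen making each of them expensive. *)
Lemma sup_osc y rho L : 0 < rho ->
  (mu (\bigcup_(n in [set n | B (c n) (r n) `<=` B y rho])
     (B (c n) (r n) `&` [set x | (L < `|b x - mm n|)%R])) <=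
   (sup_osc_cst * expR (- (d0 * L / 2)) * rho `^ Q)%:E)%E.
Proof.
move=> rho0; set a := d0 * L / 2.
pose g x := expR (d0 * `|b x - m y rho|) * \1_(B y rho) x.
have g0 x : 0 <= g x by rewrite /g mulr_ge0 ?expR_ge0.
have mg : measurable_fun setT g.
  by apply: measurable_funM; [exact: measurable_expR_osc|exact: measurable_indic].
have intg : (\int[mu]_x (g x)%:E <= (J * rho `^ Q)%:E)%E.
  by rewrite /g ge0_integral_restr//; exact: Hjn.
pose P n := B (c n) (r n) `<=` B y rho /\ L / 2 < `|mm n - m y rho|.
pose U1 := [set x | expR a < g x].
pose U2 := \bigcup_(n in P) B (c n) (r n).
have mU1 : measurable U1 by exact: measurable_gt.
have mU2 : measurable U2 by exact: bigcup_measurable.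
have mW n : measurable (B (c n) (r n) `&` [set x | L < `|b x - mm n|]).
  by apply: measurableI => //; apply: measurable_gt; exact: measurable_osc Hb _.
apply: (@le_trans _ _ (mu (U1 `|` U2))).
  apply: le_measure; rewrite ?inE; [exact: bigcup_measurable|exact: measurableU|].
  move=> x [n sub [xn Ln]].
  have [h|h] := ltrP (L / 2) `|mm n - m y rho|; first by right; exists n.
  left; rewrite /U1 /= /g indicE mem_set ?mulr1; last exact: sub.
  rewrite ltr_expR /a -mulrA ltr_pM2l//.
  move: Ln; have := ler_normD (b x - m y rho) (m y rho - mm n).
  by rewrite addrA subrK (distrC (m y rho)) /=; lra.
apply: le_trans (measureU2 _ mU1 mU2) _.
have th : 0 <= K3 * Kd `^ Q by rewrite mulr_ge0 ?powR_ge0// ltW.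
have ka : 0 <= K3 * expR (- a) by rewrite mulr_ge0 ?expR_ge0// ltW.
have V : (mu U2 <= (K3 * Kd `^ Q)%:E * \int[mu]_x (K3 * expR (- a) * g x)%:E)%E.
  apply: (@vitali_measure_le _ _ _ _ _ _ _ _ HX c r r_gt0 P
    (fun n => B (c n) (r n)) _ (fun x => K3 * expR (- a) * g x) th) => //.
  - exact: measurable_funM.
  - by move=> x; rewrite mulr_ge0.
  - move=> j Pj; apply: (@le_trans _ _ (mu (B (c j) (Kd * r j)))).
      apply: le_measure; rewrite ?inE//; first exact: bigcup_measurable.
      by move=> x [i [Pi sub] xi]; exact: sub.
    have Kd0 := dilation_gt0 HX.
    apply: le_trans (qball_mu_le HX _ _) _; first by rewrite mulr_gt0.
    by rewrite lee_fin powRM ?(ltW Kd0) ?(ltW (r_gt0 _))// mulrA.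
  - move=> j [sub Lj]; rewrite ge0_integralZ_fun//.
    rewrite (_ : \int[mu]_(x in B (c j) (r j)) (g x)%:E =
        \int[mu]_(x in B (c j) (r j)) (expR (d0 * `|b x - m y rho|))%:E)%E; last first.
      apply: eq_integral => x /set_mem/sub xy.
      by rewrite /g indicE mem_set// mulr1.
    have aj : a <= d0 * `|mm j - m y rho| by rewrite /a -mulrA ler_pM2l// ltW.
    apply: le_trans (lee_wpmul2l _ (jensen_osc (r_gt0 j) aj)); last by rewrite lee_fin.
    rewrite muleA -EFinM -mulrA expRN mulVf ?gt_eqF ?expR_gt0// mulr1.
    apply: le_trans (lee_wpmul2l _ (qball_mu_ge HX (c j) (r_gt0 j))); last by rewrite lee_fin ltW.
    by rewrite -EFinM mulrA divff ?mul1r ?gt_eqF.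
apply: le_trans (leeD (markov_measure_le mu (expR_gt0 a) mg g0) V) _.
rewrite ge0_integralZ_fun// muleA -EFinM -ge0_muleDl ?lee_fin; first last.
- by rewrite mulr_ge0.
- by rewrite invr_ge0 expR_ge0.
apply: le_trans (lee_wpmul2l _ intg) _.
  by rewrite lee_fin; apply: addr_ge0; [rewrite invr_ge0 expR_ge0|exact: mulr_ge0].
by rewrite -EFinM lee_fin /sup_osc_cst -expRN expr2; nra.
Qed.

Variables (s : R).
Hypothesis s_gt1 : 1 < s.

(** Part of the superlevel set of a maximal function of [h], built on means of order [s], where one
    and the same ball also sees a large oscillation of [b]. *)
Definition level_set (h : X -> R) (a L : R) : set X :=
  \bigcup_(n in [set n | ((a `^ s * r n `^ Q)%:E <
                     \int[mu]_(x in B (c n) (r n)) (h x `^ s)%:E)%E])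
    (B (c n) (r n) `&` [set x | L < `|b x - mm n|]).

Lemma measurable_level_set (h : X -> R) a L : measurable (level_set h a L).
Proof.
apply: bigcup_measurable => n _; apply: measurableI => //.
by apply: measurable_gt; exact: measurable_osc Hb _.
Qed.

Let kappa := (2 * K3)^-1.

(** A weak type bound with a gain: the balls are selected by the means of [h], and [sup_osc]
    replaces the measure of each dilated ball by an exponentially small fraction of it. The
    truncation to large values of [h] is what later allows summation over levels. *)
Lemma level_set_le (h : X -> R) a L : 0 < a -> measurable_fun setT h -> (forall x, 0 <= h x) ->
  (mu (level_set h a L) <=
   (2 * sup_osc_cst * Kd `^ Q * expR (- (d0 * L / 2)))%:E *
   \int[mu]_x ((h x / a) `^ s * \1_[set x | (kappa * a < h x)%R] x)%:E)%E.
Proof.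
move=> a0 mh h0.
have as0 : 0 < a `^ s by rewrite powR_gt0.
have s0 : 0 <= s by have := s_gt1; lra.
have K31 := K3_ge1 HX.
have k0 : 0 < kappa by rewrite invr_gt0; lra.
have k1 : kappa <= 1 by rewrite invf_le1; lra.
have mhs : measurable_fun setT (fun x => h x `^ s).
  exact: (measurableT_comp (measurable_powR s)).
pose g x := 2 * ((h x / a) `^ s * \1_[set x | kappa * a < h x] x).
have g0 x : 0 <= g x by rewrite /g !mulr_ge0// powR_ge0.
have mk : measurable_fun setT (\1_[set x | kappa * a < h x] : X -> R).
  by apply: measurable_indic; exact: measurable_gt.
have mg' : measurable_fun setT (fun x => (h x / a) `^ s * \1_[set x | kappa * a < h x] x).
  apply: measurable_funM => //.
  by apply: (measurableT_comp (measurable_powR s)); exact: measurable_funM.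
have mg : measurable_fun setT g by exact: measurable_funM.
pose theta := sup_osc_cst * expR (- (d0 * L / 2)) * Kd `^ Q.
have th : 0 <= theta.
  apply: mulr_ge0; last exact: powR_ge0.
  by apply: mulr_ge0; [exact: sup_osc_cst_ge0|exact: expR_ge0].
apply: (@le_trans _ _ (theta%:E * \int[mu]_x (g x)%:E)%E); last first.
  rewrite /g ge0_integralZ_fun//; last by move=> x; rewrite mulr_ge0// powR_ge0.
  rewrite muleA -EFinM (_ : theta * 2 = 2 * sup_osc_cst * Kd `^ Q * expR (- (d0 * L / 2)))//.
  by rewrite /theta; ring.
apply: (@vitali_measure_le _ _ _ _ _ _ _ _ HX c r r_gt0 _
    (fun n => B (c n) (r n) `&` [set x | L < `|b x - mm n|]) _ g th) => //.
- move=> n; apply: measurableI => //.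
  by apply: measurable_gt; exact: measurable_osc Hb _.
- move=> j Pj; have Kd0 := dilation_gt0 HX.
  have Kr : 0 < Kd * r j by rewrite mulr_gt0.
  rewrite /theta -mulrA -powRM ?(ltW Kd0) ?(ltW (r_gt0 _))//.
  apply: le_trans (sup_osc (c j) L Kr); apply: le_measure; rewrite ?inE.
  + apply: bigcup_measurable => n _; apply: measurableI => //.
    by apply: measurable_gt; exact: measurable_osc Hb _.
  + apply: bigcup_measurable => n _; apply: measurableI => //.
    by apply: measurable_gt; exact: measurable_osc Hb _.
  + by move=> x [n [Pn sub] xn]; exists n.
- move=> j Pj; have rj := r_gt0 j.
  have fr : (r j `^ Q)%:E \is a fin_num by [].
  (* Points where [h <= kappa * a] carry at most half of the local mass. *)
  have H : ((2 * r j `^ Q)%:E <= \int[mu]_(x in B (c j) (r j)) (g x)%:E + (r j `^ Q)%:E)%E.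
    apply: (@le_trans _ _ (\int[mu]_(x in B (c j) (r j)) ((2 / a `^ s) * h x `^ s)%:E)%E).
      rewrite ge0_integralZ_fun//; first last.
      - by rewrite divr_ge0// ltW.
      - by move=> y; exact: powR_ge0.
      apply: le_trans (lee_wpmul2l _ (ltW Pj)); last by rewrite lee_fin divr_ge0// ltW.
      by rewrite -EFinM lee_fin mulrA divfK// gt_eqF.
    apply: (@le_trans _ _ (\int[mu]_(x in B (c j) (r j)) (g x + K3^-1)%:E)%E).
      apply: le_integral_EFin => x _; first by rewrite mulr_ge0 ?powR_ge0// divr_ge0// ltW.
      have -> : 2 / a `^ s * h x `^ s = 2 * (h x / a) `^ s.
        by rewrite powR_div ?(ltW a0)// -mulrA [_^-1 * _]mulrC.
      rewrite /g indicE; have [xk|xk] := ltrP (kappa * a) (h x).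
        by rewrite mem_set// mulr1 lerDl invr_ge0 ltW.
      rewrite memNset ?mulr0 ?add0r; last by move=> /= /lt_le_trans/(_ xk); rewrite ltxx.
      apply: (@le_trans _ _ (2 * kappa)); last by rewrite /kappa invfM mulrA divff ?mul1r.
      rewrite ler_pM2l//; apply: (@le_trans _ _ (kappa `^ s)); last first.
        by apply: ge1r_powR; [rewrite k0|exact: ltW].
      apply: ge0_ler_powR; rewrite ?nnegrE// ?divr_ge0// ?(ltW a0) ?(ltW k0)//.
      by rewrite ler_pdivrMr.
    rewrite ge0_integralD_fun//; last by move=> _; rewrite invr_ge0 ltW.
    apply: leeD2l; rewrite integral_cst_EFin//.
    apply: le_trans (lee_wpmul2l _ (qball_mu_le HX (c j) rj)) _;
      first by rewrite lee_fin invr_ge0 ltW.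
    by rewrite -EFinM lee_fin mulrA mulVf ?mul1r// gt_eqF.
  by move: H; rewrite mulr_natl mulr2n EFinD leeD2rE.
Qed.

(** Young's inequality with exponents [s / (s - 1)] and [s], by comparing [v] with the value
    [expR (delta * w / (s - 1))] that balances the two terms. *)
Lemma exp_young delta w v : 0 <= v -> 0 <= w -> delta * (s / (s - 1)) <= d0 ->
  expR (delta * w) * v <= expR (d0 * w) + v `^ s.
Proof.
move=> v0 w0 hd; have s1 : 0 < s - 1 by rewrite subr_gt0.
have [h|h] := lerP v (expR (delta * w / (s - 1))).
  apply: ler_wpDr; first exact: powR_ge0.
  apply: le_trans (ler_wpM2l (expR_ge0 _) h) _; rewrite -expRD ler_expR.
  rewrite (_ : _ + _ = delta * (s / (s - 1)) * w); first exact: ler_wpM2r.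
  by field; rewrite gt_eqF.
apply: ler_wpDl; first exact: expR_ge0.
have vpos : 0 < v by apply: lt_trans h; exact: expR_gt0.
rewrite -(@mulr_powRB1 _ v s)//; last by exact: lt_trans s_gt1.
rewrite mulrC ler_pM2l//.
rewrite (_ : expR _ = expR (delta * w / (s - 1)) `^ (s - 1)).
  by apply: ge0_ler_powR; rewrite ?nnegrE ?expR_ge0// ltW.
by rewrite -expRM divfK// gt_eqF.
Qed.

Variable delta : R.
Hypotheses (delta_gt0 : 0 < delta) (delta_le : delta * (s / (s - 1)) <= d0).

Lemma exp_mean_le x rho (h : X -> R) a : 0 < rho -> 0 < a -> measurable_fun setT h ->
  (forall x, 0 <= h x) ->
  (\int[mu]_(y in B x rho) (h y `^ s)%:E <= (a `^ s * rho `^ Q)%:E)%E ->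
  (\int[mu]_(y in B x rho) (expR (delta * `|b y - m x rho|) * h y)%:E <=
    (a * (J + 1) * rho `^ Q)%:E)%E.
Proof.
move=> rho0 a0 mh h0 hI; have as0 : 0 < a `^ s by rewrite powR_gt0.
have mhs : measurable_fun setT (fun x => h x `^ s).
  exact: (measurableT_comp (measurable_powR s)).
apply: (@le_trans _ _ (\int[mu]_(y in B x rho)
    (a * expR (d0 * `|b y - m x rho|) + a / a `^ s * h y `^ s)%:E)%E).
  apply: le_integral_EFin => y _; first by rewrite mulr_ge0 ?expR_ge0.
  have ha : 0 <= h y / a by rewrite divr_ge0 // ltW.
  have := exp_young ha (normr_ge0 (b y - m x rho)) delta_le.
  have -> : (h y / a) `^ s = h y `^ s / a `^ s.
    by rewrite powR_div// ltW.
  move=> H; rewrite (_ : _ * h y = a * (expR (delta * `|b y - m x rho|) * (h y / a))).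
    apply: le_trans (ler_wpM2l (ltW a0) H) _.
    by rewrite mulrDr lerD2l -mulrA [_^-1 * _]mulrC.
  by rewrite mulrCA [a * (h y / a)]mulrC divfK// gt_eqF.
rewrite ge0_integralD_fun//; first last.
- by move=> y; rewrite mulr_ge0 ?powR_ge0// divr_ge0 ?powR_ge0// ltW.
- by move=> y; rewrite mulr_ge0 ?expR_ge0// ltW.
- exact: measurable_funM.
- by apply: measurable_funM => //; exact: measurable_expR_osc.
rewrite !ge0_integralZ_fun//; first last.
- exact: ltW.
- exact: measurable_expR_osc.
- by rewrite divr_ge0 ?powR_ge0// ltW.
- by move=> y; exact: powR_ge0.
rewrite mulrDr mulr1 mulrDl EFinD; apply: leeD.
  rewrite -mulrA EFinM; apply: lee_wpmul2l; first by rewrite lee_fin ltW.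
  exact: Hjn.
apply: le_trans (lee_wpmul2l _ hI) _; first by rewrite lee_fin divr_ge0 ?powR_ge0// ltW.
by rewrite -EFinM lee_fin mulrA divfK// gt_eqF.
Qed.

Hypothesis hcr : forall x t, 0 < t -> exists n, [/\ B x t `<=` B (c n) (r n),
    B (c n) (r n) `<=` B x (M0 * t) & r n <= M0 * t].

(** At a point whose oscillation costs a factor [2 ^+ j] in the exponential weight, the mean of [h]
    has to be smaller by the same factor. The shift [j - 1] comes from rounding the oscillation up
    to a multiple of [ln 2]. *)
Definition bad_set (h : X -> R) lambda : set X :=
  \bigcup_j level_set h (2^-1 ^+ j * lambda) ((j%:R - 1) * ln 2 / delta).

Lemma measurable_bad_set (h : X -> R) lambda : measurable (bad_set h lambda).
Proof. by apply: bigcup_measurable => j _; exact: measurable_level_set. Qed.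

Lemma good_local (h : X -> R) lambda x t : 0 < lambda -> measurable_fun setT h ->
  (forall x, 0 <= h x) -> ~ bad_set h lambda x -> 0 < t ->
  (\int[mu]_(y in B x t) (expR (delta * `|b x - b y|) * h y)%:E <=
    ((J + 1) * M0 `^ Q * lambda * t `^ Q)%:E)%E.
Proof.
move=> l0 mh h0 nbad t0; have [n [sub _ rn]] := hcr x t0.
have l2 : 0 < ln 2 :> R by rewrite ln_gt0//; lra.
set w := `|b x - mm n|.
have exk : exists k, delta * w <= k%:R * ln 2.
  exists (Num.trunc (delta * w / ln 2)).+1; rewrite -ler_pdivrMr//; apply/ltW.
  exact: truncnS_gt.
case: (ex_minnP exk) => k kw kmin.
(* Minimality of [k] puts the oscillation above the threshold of index [k], which is negative for
   [k = 0]. A point outside the bad set therefore has a small mean of [h] on this ball. *)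
have kl : (k%:R - 1) * ln 2 / delta < w.
  rewrite ltr_pdivrMr// [w * _]mulrC; case: k kmin {kw} => [_|k kmin].
    apply: (@lt_le_trans _ _ 0); first lra.
    exact: mulr_ge0 (ltW delta_gt0) (normr_ge0 _).
  by rewrite -natr1 addrK ltNge; apply/negP => /kmin; rewrite ltnn.
have ak0 : 0 < 2^-1 ^+ k * lambda by rewrite mulr_gt0// exprn_gt0.
have hn : (\int[mu]_(y in B (c n) (r n)) (h y `^ s)%:E <=
    ((2^-1 ^+ k * lambda) `^ s * r n `^ Q)%:E)%E.
  rewrite leNgt; apply/negP => hlt; apply: nbad; exists k => //; exists n => //.
  by split => //; apply: sub; exact: (qball_center HX).
have H := exp_mean_le (r_gt0 n) ak0 mh h0 hn.
apply: (@le_trans _ _ ((2 ^+ k)%:E * \int[mu]_(y in B (c n) (r n))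
   (expR (delta * `|b y - mm n|) * h y)%:E)%E).
  rewrite -ge0_integralZ_fun//; first last.
  - by move=> y; rewrite mulr_ge0 ?expR_ge0.
  - by apply: measurable_funM => //; exact: measurable_expR_osc.
  apply: (@le_trans _ _ (\int[mu]_(y in B (c n) (r n)) (expR (delta * `|b x - b y|) * h y)%:E)%E).
    by apply: le_integral_subset_EFin => // y; rewrite mulr_ge0 ?expR_ge0.
  apply: le_integral_EFin => y _; first by rewrite mulr_ge0 ?expR_ge0.
  rewrite mulrA ler_wpM2r//.
  have -> : 2 ^+ k = expR (k%:R * ln 2) :> R by rewrite expRM_natl lnK// posrE.
  rewrite -expRD ler_expR; apply: le_trans (lerD kw (lexx _)).
  rewrite -mulrDr ler_pM2l// /w (distrC (b y)).
  by apply: le_trans (ler_normD _ _); rewrite addrA subrK.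
apply: le_trans (lee_wpmul2l _ H) _; first by rewrite lee_fin exprn_ge0.
rewrite -EFinM lee_fin exprVn.
have -> : 2 ^+ k * ((2 ^+ k)^-1 * lambda * (J + 1) * r n `^ Q) = (J + 1) * lambda * r n `^ Q.
  by field; rewrite expf_neq0.
rewrite -!mulrA ler_wpM2l//; first by rewrite addr_ge0.
rewrite [leRHS]mulrCA ler_pM2l// -powRM ?(ltW t0)//; last exact: ltW (cover_cst_gt0 HX).
by apply: (powRQ_le HX) => //; exact: ltW.
Qed.

End family.
End exponential_levels.

(** * Young functions *)

Section young_functions.
Context {R : realType}.
Variable Phi : R -> \bar R.
Hypothesis PhiY : youngY Phi.

Definition young_fun (r : R) : R := locked (fun r => fine (Phi r)) r.
Local Notation F := young_fun.

Lemma young_funE r : 0 <= r -> Phi r = (F r)%:E.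
Proof.
rewrite le_eqVlt => /predU1P[<-|r0]; first by rewrite /young_fun -lock (young0 (PhiY.1)).
rewrite /young_fun -lock fineK//; have /andP[h1 h2] := PhiY.2 r r0.
by rewrite ge0_fin_numE// ltW.
Qed.

Lemma young_fun0 : F 0 = 0.
Proof. by rewrite /young_fun -lock (young0 (PhiY.1)). Qed.

Lemma young_fun_gt0 r : 0 < r -> 0 < F r.
Proof. by move=> r0; have /andP[] := PhiY.2 r r0; rewrite young_funE ?ltW// lte_fin. Qed.

Lemma young_fun_ge0 r : 0 <= r -> 0 <= F r.
Proof.
by rewrite le_eqVlt => /predU1P[<-|/young_fun_gt0/ltW//]; rewrite young_fun0.
Qed.

Lemma young_fun_scale t x : 0 <= t <= 1 -> 0 <= x -> F (t * x) <= t * F x.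
Proof.
move=> t01 x0; have /andP[t0 t1] := t01.
have := young_convex PhiY.1 x0 (lexx 0) t01.
rewrite mulr0 addr0 (young0 PhiY.1) mule0 adde0.
by rewrite !young_funE ?mulr_ge0// -EFinM lee_fin.
Qed.

Lemma young_fun_le x y : 0 <= x -> x <= y -> F x <= F y.
Proof.
move=> x0 xy; have [y0|y0] := eqVneq y 0.
  by have -> : x = y by apply/eqP; rewrite eq_le xy y0.
have yp : 0 < y by rewrite lt_def y0 (le_trans x0).
have t01 : 0 <= x / y <= 1 by rewrite divr_ge0 ?(ltW yp)//= ler_pdivrMr// mul1r.
have := young_fun_scale t01 (ltW yp); rewrite divfK// => /le_trans; apply.
by have /andP[_ h] := t01; rewrite ler_piMl// young_fun_ge0// ltW.
Qed.

Lemma measurable_young_fun d (T : measurableType d) (D : set T) (h : T -> R) :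
  measurable_fun D h -> (forall x, 0 <= h x) -> measurable_fun D (fun x => F (h x)).
Proof.
move=> mh h0.
have -> : (fun x => F (h x)) = (fun u => F (Num.max u 0)) \o h.
  by apply/funext => x /=; rewrite max_l.
apply: measurableT_comp => //; apply: nondecreasing_measurable => // u v uv.
apply: young_fun_le; first by rewrite le_max lexx orbT.
by rewrite ge_max !le_max uv lexx !orbT.
Qed.

Lemma young_fun_gt (M : R) : exists2 u, 0 < u & M < F u.
Proof.
have F1 := young_fun_gt0 ltr01.
pose u := (Num.max 1 ((M + 1) / F 1)).
have u1 : 1 <= u by rewrite le_max lexx.
have u0 : 0 < u by lra.
exists u => //; have t01 : 0 <= u^-1 <= 1 by rewrite invr_ge0 ltW//= invf_le1.
have := young_fun_scale t01 (ltW u0); rewrite mulVf ?gt_eqF// mulrC ler_pdivlMr//.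
apply: lt_le_trans; apply: (@lt_le_trans _ _ (M + 1)); first by lra.
by rewrite mulrC -ler_pdivrMr// le_max lexx orbT.
Qed.

Definition young_cinv (s : R) : R := locked (fun s => fine (young_inv Phi s%:E)) s.
Local Notation cinv := young_cinv.

(** Only arguments on either side of [cinv s] are compared with [s]. The value at [cinv s] itself is
    estimated through the doubling condition, in [young_fun_cinv_le] and [young_fun_cinv_ge]. *)
Lemma young_inv_spec s : 0 < s -> [/\ young_inv Phi s%:E = (cinv s)%:E,
  0 < cinv s, forall u, cinv s < u -> s < F u &
  forall u, 0 <= u -> u < cinv s -> F u <= s].
Proof.
move=> s0; pose S := [set r%:E | r in [set r : R | (0 <= r)%R /\ (s%:E < Phi r)%E]].
have [M M0 sM] := young_fun_gt s.
have [e e0 eF] : exists2 e, 0 < e & F e <= s.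
  have F1 := young_fun_gt0 ltr01; pose e := Num.min 1 (s / F 1).
  have e0 : 0 < e by rewrite lt_min ltr01 divr_gt0.
  exists e => //; have t01 : 0 <= e <= 1 by rewrite ltW//= ge_min lexx.
  have := young_fun_scale t01 ler01; rewrite mulr1 => /le_trans; apply.
  by rewrite -ler_pdivlMr// ge_min lexx orbT.
have lb u : 0 <= u -> F u <= s -> (u%:E <= young_inv Phi s%:E)%E.
  move=> u0 uF; apply: le_ereal_inf_tmp => _ [r [r0 rs] <-]; rewrite lee_fin leNgt.
  apply/negP => ru; move: rs; rewrite young_funE// lte_fin ltNge.
  by rewrite (le_trans (young_fun_le r0 (ltW ru)) uF).
have ub u : 0 <= u -> s < F u -> (young_inv Phi s%:E <= u%:E)%E.
  by move=> u0 uF; apply: ereal_inf_lbound; exists u => //; split => //; rewrite young_funE.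
have fin : young_inv Phi s%:E \is a fin_num.
  rewrite ge0_fin_numE; first by apply: le_lt_trans (ub _ (ltW M0) sM) _; rewrite ltry.
  by apply: le_trans (lb _ (ltW e0) eF); rewrite lee_fin ltW.
have E : young_inv Phi s%:E = (cinv s)%:E by rewrite /young_cinv -lock fineK.
have c0 : 0 < cinv s.
  by apply: (lt_le_trans e0); rewrite -lee_fin -E; exact: lb (ltW e0) eF.
split => // u.
  move=> cu; rewrite ltNge; apply/negP => Fu.
  have /lb/(_ Fu) : 0 <= u by rewrite ltW// (lt_trans c0).
  by rewrite E lee_fin leNgt cu.
move=> u0 uc; rewrite leNgt; apply/negP => Fu.
by have := ub u u0 Fu; rewrite E lee_fin leNgt uc.
Qed.

Lemma young_cinv_gt0 s : 0 < s -> 0 < cinv s.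
Proof. by case/young_inv_spec. Qed.

Lemma young_cinv_le_of s u : 0 < s -> 0 <= u -> s < F u -> cinv s <= u.
Proof.
move=> s0 u0 su; have [_ _ _ h] := young_inv_spec s0.
by rewrite leNgt; apply/negP => /(h _ u0); rewrite leNgt su.
Qed.

Lemma young_cinv_ge_of s u : 0 < s -> 0 <= u -> F u <= s -> u <= cinv s.
Proof.
move=> s0 u0 su; have [_ _ h _] := young_inv_spec s0.
by rewrite leNgt; apply/negP => /h; rewrite ltNge su.
Qed.

Lemma young_cinv_le s s' : 0 < s -> s <= s' -> cinv s <= cinv s'.
Proof.
move=> s0 ss'; have s0' := lt_le_trans s0 ss'.
have c0 := young_cinv_gt0 s0; apply/ler_addgt0Pr => e e0.
rewrite -lerBlDr; have [h|h] := ltrP (cinv s - e) 0.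
  by apply: le_trans (ltW h) _; exact: ltW (young_cinv_gt0 s0').
apply: young_cinv_ge_of => //; apply: le_trans ss'.
by have [_ _ _ hh] := young_inv_spec s0; apply: hh => //; rewrite gtrBl.
Qed.

(** Convexity of Phi, with value 0 at 0, gives this concavity-type bound for the inverse. *)
Lemma young_cinv_scale theta s : 0 < theta <= 1 -> 0 < s ->
  theta * cinv s <= cinv (theta * s).
Proof.
move=> /andP[t0 t1] s0; have ts0 : 0 < theta * s by rewrite mulr_gt0.
have c0 := young_cinv_gt0 ts0.
apply/ler_addgt0Pr => e e0; rewrite -ler_pdivlMl//.
apply: young_cinv_le_of => //; first by rewrite mulr_ge0 ?invr_ge0 ?addr_ge0 ?(ltW t0)
  ?(ltW c0) ?(ltW e0).
have [_ _ h _] := young_inv_spec ts0.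
have ce : theta * s < F (cinv (theta * s) + e) by apply: h; rewrite ltrDl.
rewrite -(ltr_pM2l t0); apply: lt_le_trans ce _.
set u := _ + e.
have u0 : 0 <= theta^-1 * u by rewrite mulr_ge0 ?invr_ge0 ?addr_ge0 ?(ltW t0) ?(ltW c0) ?(ltW e0).
have := @young_fun_scale theta _ _ u0; rewrite mulrA divff ?gt_eqF// mul1r; apply.
by rewrite ltW.
Qed.

Section delta2.
Variable k : R.
Hypothesis k_gt0 : 0 < k.
Hypothesis HD : forall u, 0 <= u -> F (2 * u) <= k * F u.

Lemma young_fun_pow2 n u : 0 <= u -> F (2 ^+ n * u) <= k ^+ n * F u.
Proof.
move=> u0; elim: n => [|n IH]; first by rewrite !expr0 !mul1r.
rewrite exprS -mulrA; apply: le_trans (HD _) _; first by rewrite mulr_ge0// exprn_ge0.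
by rewrite exprS -mulrA ler_pM2l.
Qed.

Lemma young_fun_dilate (C : R) : 0 <= C -> exists2 C', 0 < C' & forall u, 0 <= u ->
  F (C * u) <= C' * F u.
Proof.
move=> C0; pose n := (Num.trunc C).+1.
exists (k ^+ n) => [|u u0]; first by rewrite exprn_gt0.
apply: le_trans (young_fun_pow2 n u0); apply: young_fun_le; first exact: mulr_ge0.
apply: ler_wpM2r => //; apply: (@le_trans _ _ n%:R); first by apply/ltW; exact: truncnS_gt.
by rewrite -natrX ler_nat ltnW// ltn_expl.
Qed.

Lemma young_fun_cinv_le s : 0 < s -> F (cinv s) <= k * s.
Proof.
move=> s0; have c0 := young_cinv_gt0 s0.
have -> : cinv s = 2 * (cinv s / 2) by field.
apply: le_trans (HD _) _; first by rewrite divr_ge0// ltW.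
rewrite ler_pM2l//; have [_ _ _ h] := young_inv_spec s0.
by apply: h; [rewrite divr_ge0// ltW|lra].
Qed.

Lemma young_fun_cinv_ge s : 0 < s -> s <= k * F (cinv s).
Proof.
move=> s0; have c0 := young_cinv_gt0 s0.
apply: le_trans (HD (ltW c0)); have [_ _ h _] := young_inv_spec s0.
by apply/ltW/h; lra.
Qed.

Lemma young_cinv_double s : 0 < s -> 2 * cinv s <= cinv (k * s).
Proof.
move=> s0; have ks0 : 0 < k * s by rewrite mulr_gt0.
have c0 := young_cinv_gt0 s0.
apply/ler_addgt0Pr => e e0; rewrite -ler_pdivlMl//.
have [_ cks h _] := young_inv_spec ks0.
have u0 : 0 <= 2^-1 * (cinv (k * s) + e) by rewrite mulr_ge0// addr_ge0// ltW.
apply: young_cinv_le_of => //; rewrite -(ltr_pM2l k_gt0).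
apply: lt_le_trans (HD u0); rewrite mulrA divff// mul1r.
by apply: h; rewrite ltrDl.
Qed.

End delta2.

Lemma expr_unbounded (z M : R) : 1 < z -> exists n, M < z ^+ n.
Proof.
move=> z1; have l0 : 0 < ln z by rewrite ln_gt0.
have z0 : 0 < z by exact: lt_trans z1.
have [M0|M0] := lerP M 0; first by exists 0%N; rewrite expr0 (le_lt_trans M0).
exists (Num.trunc (ln M / ln z)).+1.
rewrite -[ltLHS]lnK ?posrE// -[ltRHS]lnK ?posrE ?exprn_gt0// ltr_expR lnXn//.
by rewrite -mulr_natl -ltr_pdivrMr//; exact: truncnS_gt.
Qed.

(** The condition says that dilating the argument by [z] multiplies Phi by at least [2 * z], which
    is the power [sigma] of [z]. Iteration gives power growth, and the constant [2 * z] pays for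
    rounding [w / v] to a power of [z]. *)
Lemma nabla2_power : nabla2 Phi -> exists2 sigma, 1 < sigma & exists2 C, 1 <= C &
  forall v w, 0 < v -> v <= w -> F v <= C * (v / w) `^ sigma * F w.
Proof.
move=> [z z1 H]; have z0 : 0 < z by exact: lt_trans z1.
have l0 : 0 < ln z by rewrite ln_gt0.
pose sigma := 1 + ln 2 / ln z.
have s1 : 1 < sigma by rewrite ltrDl divr_gt0// ln_gt0//; lra.
exists sigma => //; exists (2 * z) => [|v w v0 vw]; first by lra.
have zs : z `^ sigma = 2 * z.
  rewrite /powR gt_eqF// /sigma mulrDl mul1r divfK ?gt_eqF// expRD !lnK ?posrE//.
  by rewrite mulrC.
have H' u : 0 <= u -> 2 * z * F u <= F (z * u).
  move=> u0; have := H u u0; rewrite !young_funE ?mulr_ge0 ?(ltW z0)// -EFinM lee_fin.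
  by rewrite mulrC ler_pdivlMr ?mulr_gt0// mulrC.
have Hn n : (2 * z) ^+ n * F v <= F (z ^+ n * v).
  elim: n => [|n IH]; first by rewrite !expr0 !mul1r.
  rewrite exprS -mulrA; apply: (@le_trans _ _ (2 * z * F (z ^+ n * v))).
    by rewrite ler_pM2l// mulr_gt0.
  by rewrite exprS -[z * _ * v]mulrA; apply: H'; rewrite mulr_ge0 ?exprn_ge0// ltW.
have w0 : 0 < w by exact: lt_le_trans vw.
have exn : exists n, w < z ^+ n * v.
  by have [n hn] := expr_unbounded (w / v) z1; exists n; rewrite -ltr_pdivrMr.
case: (ex_minnP exn) => -[|n] hn nmin.
  by move: hn; rewrite expr0 mul1r ltNge vw.
have zw : z ^+ n * v <= w by rewrite leNgt; apply/negP => /nmin; rewrite ltnn.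
have zn0 : 0 < z ^+ n by rewrite exprn_gt0.
have key : ((2 * z) ^+ n)^-1 <= 2 * z * (v / w) `^ sigma.
  have -> : (2 * z) ^+ n = (z ^+ n) `^ sigma.
    by rewrite (powR_exprn _ _ (ltW z0)) zs.
  rewrite -ler_pdivrMl ?mulr_gt0// -{1}zs -invfM -powRM ?(ltW z0) ?(ltW zn0)//.
  rewrite -(powR_inv1 (powR_ge0 _ _)) powRAC powR_inv1 ?mulr_ge0 ?(ltW z0) ?(ltW zn0)//.
  apply: ge0_ler_powR; rewrite ?nnegrE ?invr_ge0 ?divr_ge0 ?mulr_ge0 ?(ltW z0) ?(ltW zn0)
    ?(ltW v0) ?(ltW w0)//.
    exact: ltW (lt_trans ltr01 s1).
  rewrite ler_pdivlMr// ler_pdivrMl ?mulr_gt0//.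
  by rewrite -exprS; exact: ltW.
apply: (@le_trans _ _ (((2 * z) ^+ n)^-1 * F w)); last first.
  by apply: ler_wpM2r key; exact: young_fun_ge0 (ltW w0).
rewrite ler_pdivlMl ?exprn_gt0 ?mulr_gt0//; apply: le_trans (Hn n) _.
by apply: young_fun_le zw; rewrite mulr_ge0 ?(ltW zn0) ?(ltW v0).
Qed.

(** A geometric sum is dominated by its last term, which is below 1 by truncation. The induction
    carries a second bound by the next term, valid as long as no term is cut. *)
Lemma truncated_geometric (rho z : R) n : 1 < rho -> 0 <= z ->
  \sum_(i < n) rho ^+ i * z * (rho ^+ i * z < 1)%R%:R <= rho / (rho - 1).
Proof.
move=> r1 z0; have r0 : 0 < rho - 1 by rewrite subr_gt0.
suff [] : \sum_(i < n) rho ^+ i * z * (rho ^+ i * z < 1)%R%:R <= rho / (rho - 1) /\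
  \sum_(i < n) rho ^+ i * z * (rho ^+ i * z < 1)%R%:R <= rho ^+ n * z / (rho - 1) by [].
have rp : 0 < rho by exact: lt_trans r1.
elim: n => [|n [IH1 IH2]].
  by rewrite big_ord0 !divr_ge0 ?mulr_ge0 ?(ltW r0) ?(ltW rp)// exprn_ge0// ltW.
rewrite big_ord_recr/=; have un : 0 <= rho ^+ n * z by rewrite mulr_ge0// exprn_ge0// ltW.
have E : rho ^+ n.+1 * z / (rho - 1) = rho ^+ n * z / (rho - 1) + rho ^+ n * z.
  by rewrite exprS; field; rewrite gt_eqF.
have [h|h] := ltrP (rho ^+ n * z) 1.
  rewrite mulr1 E; split; last exact: lerD.
  apply: le_trans (lerD IH2 (lexx _)) _; rewrite -E ler_pM2r ?invr_gt0//.
  by rewrite exprS -mulrA ler_piMr ?(ltW rp) ?(ltW h).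
rewrite mulr0 addr0; split => //; apply: le_trans IH2 _.
by rewrite E lerDl.
Qed.

Section level_sum.
Variables (k sigma C s kappa : R).
Hypothesis k_gt0 : 0 < k.
Hypothesis HD : forall u, 0 <= u -> F (2 * u) <= k * F u.
Hypothesis C_ge1 : 1 <= C.
Hypothesis HN : forall v w, 0 < v -> v <= w -> F v <= C * (v / w) `^ sigma * F w.
Hypothesis s_bounds : 1 < s < sigma.
Hypothesis kappa_bounds : 0 < kappa <= 1.

(* The series is geometric, with ratio [2^(sigma - s)], up to its last index. *)
Lemma level_sum : exists2 C', 0 < C' & forall c v j n, 0 < c -> 0 <= v ->
  \sum_(i < n) F (2 ^+ i.+1 * c) *
     ((v / (2^-1 ^+ j * 2 ^+ i * c)) `^ s * (kappa * (2^-1 ^+ j * 2 ^+ i * c) < v)%R%:R)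
  <= C' * k ^+ j * F v.
Proof.
have /andP[kap0 kap1] := kappa_bounds; have /andP[s1 ssig] := s_bounds.
have [C2 C20 HC2] := young_fun_dilate k_gt0 HD (divr_ge0 (ler0n R 2) (ltW kap0)).
pose rho := 2 `^ (sigma - s) : R.
have e0 : 0 < sigma - s by rewrite subr_gt0.
have rho1 : 1 < rho.
  rewrite /rho -[ltLHS](_ : 1 `^ (sigma - s) = 1); last by rewrite powR1.
  by apply: gt0_ltr_powR; rewrite // ?nnegrE//; lra.
have rr : 0 < rho / (rho - 1) by rewrite divr_gt0 ?subr_gt0// (lt_trans ltr01).
have C0 : 0 < C by exact: lt_le_trans C_ge1.
exists (C * C2 * (rho / (rho - 1))) => [|c v j n c0].
  by rewrite mulr_gt0// mulr_gt0.
rewrite le_eqVlt => /predU1P[<-|v0].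
  rewrite young_fun0 mulr0 big1// => i _.
  by rewrite ltNge mulr_ge0 ?(ltW kap0) ?mulr0// !mulr_ge0 ?exprn_ge0// ltW.
(* The indicator in the sum amounts to [2 ^+ i * c < w], so power growth is measured against [w].
   Returning from [F (2 * w)] to [F v] takes [j] doublings, the source of [k ^+ j]. *)
pose w := 2 ^+ j * v / kappa.
have w0 : 0 < w by rewrite /w divr_gt0// mulr_gt0// exprn_gt0.
pose z := (c / w) `^ (sigma - s).
have z0 : 0 <= z by exact: powR_ge0.
have Fw : F (2 * w) <= C2 * k ^+ j * F v.
  rewrite (_ : 2 * w = 2 ^+ j * (2 / kappa * v)); last first.
    by rewrite /w; field; rewrite gt_eqF.
  apply: le_trans (young_fun_pow2 k_gt0 HD j _) _;
    first by rewrite mulr_ge0 ?divr_ge0 ?(ltW v0) ?(ltW kap0).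
  by rewrite [C2 * _]mulrC -[leRHS]mulrA ler_pM2l ?exprn_gt0//; apply: HC2; exact: ltW.
apply: (@le_trans _ _ (\sum_(i < n) C * F (2 * w) * (rho ^+ i * z * (rho ^+ i * z < 1)%R%:R))).
  apply: ler_sum => i _.
  have ci0 : 0 < 2 ^+ i * c by rewrite mulr_gt0// exprn_gt0.
  have F2w : 0 <= F (2 * w) by apply: young_fun_ge0; rewrite mulr_ge0// ltW.
  have Ez : rho ^+ i * z = (2 ^+ i * c / w) `^ (sigma - s).
    have cw : 0 <= c / w by rewrite divr_ge0// ltW.
    have i0 : 0 <= 2 ^+ i :> R by exact: exprn_ge0.
    rewrite /rho /z -powR_exprn// -(powRM _ i0 cw).
    by rewrite mulrA.
  have [h|h] := ltrP (kappa * (2^-1 ^+ j * 2 ^+ i * c)) v; last first.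
    by rewrite !mulr0 mulr_ge0// ?mulr_ge0 ?ler0n ?exprn_ge0 ?(ltW C0)// powR_ge0.
  have hw : 2 ^+ i * c < w.
    rewrite /w ltr_pdivlMr// mulrC -(ltr_pM2l (_ : 0 < 2^-1 ^+ j)) ?exprn_gt0//.
    rewrite [X in _ < X]mulrA exprVn mulVf ?expf_neq0// mul1r.
    by apply: le_lt_trans h; rewrite exprVn; lra.
  rewrite mulr1 Ez.
  have -> : (2 ^+ i * c / w) `^ (sigma - s) < 1.
    rewrite -[ltRHS](_ : 1 `^ (sigma - s) = 1); last by rewrite powR1.
    apply: gt0_ltr_powR; rewrite // ?nnegrE; first exact: ltW (divr_gt0 ci0 w0).
      exact: ler01.
    by rewrite ltr_pdivrMr// mul1r.
  rewrite mulr1.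
  have -> : v / (2^-1 ^+ j * 2 ^+ i * c) = kappa * (2 ^+ i * c / w)^-1.
    by rewrite /w exprVn; field; rewrite !gt_eqF// ?exprn_gt0.
  set q := 2 ^+ i * c / w.
  have q0 : 0 < q by rewrite divr_gt0.
  have HF : F (2 ^+ i.+1 * c) <= C * q `^ sigma * F (2 * w).
    have v1 : 0 < 2 ^+ i.+1 * c by rewrite mulr_gt0// exprn_gt0.
    have v2 : 2 ^+ i.+1 * c <= 2 * w by rewrite exprS -mulrA ler_pM2l// ltW.
    have := HN v1 v2; rewrite (_ : 2 ^+ i.+1 * c / (2 * w) = q)//.
    by rewrite exprS /q; field; rewrite gt_eqF.
  have qs0 : 0 <= (kappa * q^-1) `^ s by exact: powR_ge0.
  apply: le_trans (ler_wpM2r qs0 HF) _.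
  rewrite powRM ?invr_ge0 ?(ltW kap0) ?(ltW q0)// powRB ?(gt_eqF q0) ?implybT//.
  have -> : q^-1 `^ s = (q `^ s)^-1.
    by rewrite -(powR_inv1 (ltW q0)) powRAC powR_inv1 ?powR_ge0.
  have ks : kappa `^ s <= 1.
    by apply: (le_trans _ kap1); apply: ge1r_powR; [exact: kappa_bounds|exact: ltW].
  rewrite (_ : C * _ * _ * _ = kappa `^ s * (C * F (2 * w) * (q `^ sigma / q `^ s))); last by ring.
  apply: ler_piMl => //.
  by rewrite mulr_ge0 ?divr_ge0 ?powR_ge0// mulr_ge0// ltW.
rewrite -mulr_sumr.
apply: le_trans (ler_wpM2l _ (truncated_geometric n rho1 z0)) _.
  by rewrite mulr_ge0 ?(ltW C0)// young_fun_ge0// mulr_ge0// ltW.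
rewrite (_ : C * C2 * _ * _ * _ = C * (C2 * k ^+ j * F v) * (rho / (rho - 1))); last by ring.
by rewrite ler_pM2r// ler_pM2l.
Qed.

End level_sum.
End young_functions.

(** * The inverse Young function along radii *)

Section levels.
Context {R : realType}.
Variables (Q k : R) (Phi : R -> \bar R).
Hypothesis PhiY : youngY Phi.
Hypothesis Q_gt0 : 0 < Q.
Hypothesis k_gt1 : 1 < k.
Local Notation F := (young_fun Phi).
Hypothesis HD : forall u, 0 <= u -> F (2 * u) <= k * F u.

Let k_gt0 : 0 < k. Proof. exact: lt_trans k_gt1. Qed.
Let powQ t : 0 < t -> 0 < t `^ (- Q). Proof. by move=> t0; rewrite powR_gt0. Qed.

(** Replaces the inverse of Phi at [1 / mu(B)] for balls of radius [t]; by Q-homogeneity the two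
    agree up to the factor [K3] in either direction. *)
Definition level (t : R) : R := young_cinv Phi (t `^ (- Q)).

Lemma level_gt0 t : 0 < t -> 0 < level t.
Proof. by move=> t0; apply: young_cinv_gt0 => //; exact: powQ. Qed.

Lemma level_le s t : 0 < s -> s <= t -> level t <= level s.
Proof.
move=> s0 st; have t0 := lt_le_trans s0 st.
apply: young_cinv_le => //; first exact: powQ.
rewrite !powRN lef_pV2 ?posrE ?powR_gt0//.
by apply: ge0_ler_powR; rewrite ?nnegrE ?(ltW Q_gt0) ?(ltW s0) ?(ltW t0).
Qed.

Lemma level_dilate (c t : R) : 1 <= c -> 0 < t -> level t <= c `^ Q * level (c * t).
Proof.
move=> c1 t0; have c0 : 0 < c by lra.
have one : 1 <= c `^ Q.
  rewrite -[leLHS](_ : 1 `^ Q = 1); last by rewrite powR1.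
  by apply: ge0_ler_powR; rewrite ?nnegrE// ltW.
have th : 0 < (c `^ Q)^-1 <= 1 by rewrite invr_gt0 powR_gt0//= invf_le1// powR_gt0.
have := young_cinv_scale PhiY th (powQ t0).
rewrite ler_pdivrMl ?powR_gt0// /level.
by rewrite (powRM (- Q) (ltW c0) (ltW t0)) (powRN c).
Qed.

(** Dilating the radius by the power 1/Q of [k] divides the argument of the inverse by [k], and the
    doubling condition makes the inverse at least halve. *)
Lemma level_growth n t : 0 < t -> 2 ^+ n * level ((k `^ Q^-1) ^+ n * t) <= level t.
Proof.
move=> t0; set q := k `^ Q^-1.
have q0 : 0 < q by rewrite powR_gt0.
have step u : 0 < u -> 2 * level (q * u) <= level u.
  move=> u0; have qu0 : 0 < q * u by rewrite mulr_gt0.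
  have := young_cinv_double PhiY k_gt0 HD (powQ qu0).
  rewrite /level (powRM (- Q) (ltW q0) (ltW u0)) -powRrM mulrN mulVf ?gt_eqF//.
  by rewrite [k `^ _]powRN powRr1 ?(ltW k_gt0)// mulrA mulfV ?gt_eqF// mul1r.
elim: n => [|n IH]; first by rewrite !expr0 !mul1r.
apply: le_trans IH; rewrite exprSr -mulrA ler_pM2l ?exprn_gt0//.
rewrite exprS -mulrA; apply: step; rewrite mulr_gt0// exprn_gt0//.
Qed.


End levels.

(** * Pointwise bound of the commutator kernel *)

Lemma powR_antimono (R : realType) (u v p : R) : 0 < u -> u <= v -> p <= 0 ->
  v `^ p <= u `^ p.
Proof.
move=> u0 uv p0; have v0 := lt_le_trans u0 uv.
rewrite -[p]opprK !(powRN _ (- p)) lef_pV2 ?posrE ?powR_gt0//.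
by apply: ge0_ler_powR; rewrite ?nnegrE ?oppr_ge0// ltW.
Qed.

(* Both regimes [expR w <= theta] and [theta <= expR w] come from [a w <= expR (a w)]. *)
Lemma linear_le_exp (R : realType) (a w theta : R) : 0 < a < 1 -> 0 < theta ->
  a * w <= theta `^ a + expR w * theta `^ (a - 1).
Proof.
move=> /andP[a0 a1] t0; apply: (@le_trans _ _ (expR (a * w))).
  by apply: le_trans (expR_ge1Dx _); rewrite lerDr.
have [h|h] := lerP (expR w) theta.
  rewrite -[leLHS]addr0; apply: lerD; last by rewrite mulr_ge0 ?expR_ge0 ?powR_ge0.
  rewrite mulrC expRM; apply: ge0_ler_powR; rewrite ?nnegrE ?expR_ge0//; exact: ltW.
rewrite -[leLHS]add0r; apply: lerD; first exact: powR_ge0.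
rewrite (_ : a * w = w + w * (a - 1)); last by ring.
rewrite expRD ler_pM2l ?expR_gt0// expRM.
by apply: powR_antimono => //; [exact: ltW|rewrite subr_le0 ltW].
Qed.

Section kernel_bound.
Context {R : realType} {disp : measure_display} {X : topMeasurableType disp}.
Variables (d : X -> X -> R) (mu : {measure set X -> \bar R}) (Q K1 K3 : R).
Hypothesis HX : Qspace d mu Q K1 K3.
Local Notation B := (qball d).
Variables (alpha beta K C4 E1 delta : R).
Hypothesis alpha_bounds : 0 < alpha < Q.
Hypothesis beta_bounds : 0 < beta < 1.
Hypothesis K_ge2 : 2 <= K.
Hypothesis C4_gt0 : 0 < C4.
Hypothesis E1_ge0 : 0 <= E1.
Hypothesis delta_gt0 : 0 < delta.

Let mB x r : measurable (B x r). Proof. exact: (measurable_qball HX). Qed.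
Let K_gt0 : 0 < K. Proof. exact: lt_le_trans K_ge2. Qed.
Let K_gt1 : 1 < K. Proof. by apply: lt_le_trans K_ge2; rewrite ltr1n. Qed.
Let sig := alpha / (1 - beta).
(** In the far sum D appears to the power [beta] in all. [linear_le_exp] trades one half for a power
    of [G]; the other half keeps a geometric decay. *)
Let a := beta / 2.
Let al0 : 0 < alpha. Proof. by case/andP: alpha_bounds. Qed.
Let alQ : 0 < Q - alpha. Proof. by rewrite subr_gt0; case/andP: alpha_bounds. Qed.
Let be0 : 0 < beta. Proof. by case/andP: beta_bounds. Qed.
Let be1 : 0 < 1 - beta. Proof. by rewrite subr_gt0; case/andP: beta_bounds. Qed.
Let sig0 : 0 < sig. Proof. by rewrite divr_gt0. Qed.
Let a0 : 0 < a. Proof. by rewrite divr_gt0. Qed.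
Let a1 : a < 1.
Proof. by rewrite /a ltr_pdivrMr// mul1r; have := be1; rewrite subr_gt0; lra. Qed.

(** Bound of the kernel on the shell where the distance lies between [t / K] and [t]. *)
Definition weight (t : R) : R := ((t / K) `^ (Q - alpha))^-1.

Lemma weight_ge0 t : 0 <= weight t.
Proof. by rewrite invr_ge0 powR_ge0. Qed.

Lemma weightE t : 0 < t -> weight t * t `^ Q = K `^ (Q - alpha) * t `^ alpha.
Proof.
move=> t0; rewrite /weight powR_div ?(ltW t0) ?(ltW K_gt0)//.
have -> : t `^ Q = t `^ (Q - alpha) * t `^ alpha.
  by rewrite -powRD ?subrK// (gt_eqF t0) implybT.
by field; rewrite !gt_eqF ?powR_gt0.
Qed.

Definition near_cst := K `^ (Q - alpha) / delta * C4 `^ (1 - beta) / (1 - K `^ (- alpha)).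
Definition far_sum_cst := K `^ (Q - alpha) * ((a * delta)^-1 * (E1 + 1)) * C4 `^ (1 - beta)
   / (1 - (2 : R) `^ (- a)).
Definition kernel_cst := near_cst + far_sum_cst.

Let ratio1 : 0 <= K `^ (- alpha) < 1.
Proof.
rewrite powR_ge0 /= powRN invf_lt1 ?powR_gt0//.
rewrite -[ltLHS](_ : 1 `^ alpha = 1); last by rewrite powR1.
by apply: gt0_ltr_powR; rewrite // nnegrE// ltW.
Qed.

Let ratio2 : 0 <= (2 : R) `^ (- a) < 1.
Proof.
rewrite powR_ge0 /= powRN invf_lt1 ?powR_gt0//.
rewrite -[ltLHS](_ : 1 `^ a = 1); last by rewrite powR1.
by apply: gt0_ltr_powR; rewrite // ?nnegrE// ltr1n.
Qed.

Lemma kernel_cst_gt0 : 0 < kernel_cst.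
Proof.
rewrite /kernel_cst /near_cst /far_sum_cst; apply: ltr_pwDl.
  have /andP[_ h] := ratio1.
  by apply: divr_gt0; [apply: mulr_gt0; [apply: divr_gt0|]|rewrite subr_gt0]; rewrite ?powR_gt0.
have /andP[_ h] := ratio2.
apply: divr_ge0; last by rewrite subr_ge0 ltW.
apply: mulr_ge0; last exact: powR_ge0.
apply: mulr_ge0; first exact: powR_ge0.
by apply: mulr_ge0; [rewrite invr_ge0 mulr_ge0 ?(ltW a0) ?(ltW delta_gt0)|rewrite addr_ge0].
Qed.

(** Near shells use only the exponential means at level [G], and the fractional power of the radius
    makes their sum geometric. Far shells interpolate between [G] and the smaller level [D t], and
    the halving of [D] makes their sum geometric. *)
Lemma kernel_bound (b f : X -> R) (D : R -> R) (N G : R) (x : X) :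
  measurable_fun setT b -> measurable_fun setT f -> 0 < N -> 0 < G ->
  (forall t, 0 < t -> 0 < D t) ->
  (forall t, 0 < t -> D (K * t) <= D t / 2) ->
  (forall t, 0 < t -> D t <= C4 * N * t `^ (- sig)) ->
  (forall t, 0 < t -> (\int[mu]_(y in B x t) `|f y|%:E <= (E1 * D t * t `^ Q)%:E)%E) ->
  (forall t, 0 < t -> (\int[mu]_(y in B x t) (expR (delta * `|b x - b y|) * `|f y|)%:E
     <= (G * t `^ Q)%:E)%E) ->
  (\int[mu]_y (`|b x - b y| / d x y `^ (Q - alpha) * `|f y|)%:E <=
    (kernel_cst * (N `^ (1 - beta) * G `^ beta))%:E)%E.
Proof.
move=> mb mf N0 G0 D0 Dhalf D4 hf hG.
have C4N : 0 < C4 * N by rewrite mulr_gt0.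
pose q := C4 * N / G; have q0 : 0 < q by rewrite divr_gt0.
(* The radius at which the decay bound for [D] equals [G]; both sums are then controlled by their
   shell nearest to [t0]. *)
pose t0 := q `^ sig^-1.
have t00 : 0 < t0 by rewrite powR_gt0.
have t0s : t0 `^ sig = q by rewrite /t0 -powRrM mulVf ?gt_eqF// powRr1// ltW.
have sE : sig * (1 - beta) = alpha by rewrite /sig divfK// gt_eqF.
have t0a : t0 `^ alpha = q `^ (1 - beta) by rewrite -sE powRrM t0s.
have Dt0 : D t0 <= G.
  apply: le_trans (D4 _ t00) _; rewrite powRN t0s /q invf_div.
  by rewrite mulrC divfK// gt_eqF.
have mu_ : measurable_fun setT (fun y => `|b x - b y|).
  by apply: measurableT_comp => //; apply: measurable_funB.
have maf : measurable_fun setT (fun y => `|f y|) by exact: measurableT_comp.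
have muf : measurable_fun setT (fun y => `|b x - b y| * `|f y|) by exact: measurable_funM.
have uf0 y : 0 <= `|b x - b y| * `|f y| by rewrite mulr_ge0.
pose g w t y := w * (`|b x - b y| * `|f y| * \1_(B x t) y).
have g0 w t y : 0 <= w -> 0 <= g w t y by move=> w0; rewrite /g mulr_ge0// mulr_ge0.
have mg w t : measurable_fun setT (g w t).
  by apply: measurable_funM => //; apply: measurable_funM => //; exact: measurable_indic.
have intg w t : 0 <= w -> (\int[mu]_y (g w t y)%:E =
   w%:E * \int[mu]_(y in B x t) (`|b x - b y| * `|f y|)%:E)%E.
  move=> w0; rewrite /g ge0_integralZ_fun//; first by rewrite ge0_integral_restr.
  by apply: measurable_funM => //; exact: measurable_indic.
pose tn n := t0 / K ^+ n.
pose tf n := K ^+ n.+1 * t0.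
have Kn n : 0 < K ^+ n by rewrite exprn_gt0.
have tn0 n : 0 < tn n by rewrite divr_gt0.
have tf0 n : 0 < tf n by rewrite mulr_gt0.
pose near n := g (weight (tn n)) (tn n).
pose far n := g (weight (tf n)) (tf n).
apply: (@le_trans _ _ (\int[mu]_y (\sum_(n <oo) (near n y)%:E + \sum_(n <oo) (far n y)%:E))%E).
  apply: le_lower_integral => y _.
    by rewrite lee_fin mulr_ge0// divr_ge0// powR_ge0.
  have nn n : (0 <= (near n y)%:E)%E by rewrite lee_fin g0// weight_ge0.
  have ff n : (0 <= (far n y)%:E)%E by rewrite lee_fin g0// weight_ge0.
  (* On the diagonal [b x - b y] vanishes, whatever the value of the inverse of the distance. *)
  have [xy|xy] := eqVneq (d x y) 0.
    have -> : x = y by apply/(qdist_eq0 (Qspace_dist HX)).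
    by rewrite subrr normr0 !mul0r adde_ge0// nneseries_ge0.
  have dxy : 0 < d x y by rewrite lt_def xy (Qdist_ge0 HX).
  have key t : 0 < t -> B x t y -> t / K <= d x y ->
      `|b x - b y| / d x y `^ (Q - alpha) * `|f y| <= g (weight t) t y.
    move=> tp yB tK; rewrite /g indicE mem_set// mulr1 mulrAC mulrC ler_wpM2r//.
    rewrite /weight lef_pV2 ?posrE ?powR_gt0 ?divr_gt0//.
    by apply: ge0_ler_powR; rewrite ?nnegrE ?divr_ge0 ?(ltW tp) ?(ltW K_gt0) ?(ltW dxy) ?(ltW alQ).
  have [dt|td] := ltrP (d x y) t0.
    have exn : exists n, tn n.+1 <= d x y.
      have [n hn] := expr_unbounded (t0 / d x y) K_gt1; exists n.
      rewrite /tn ler_pdivrMr// mulrC -ler_pdivrMr//.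
      by apply: le_trans (ltW hn) _; rewrite exprS ler_peMl ?(ltW (Kn n)) ?(ltW K_gt1).
    case: (ex_minnP exn) => n hn nmin.
    have yB : B x (tn n) y.
      rewrite /qball /=; case: n hn nmin => [|n] hn nmin; first by rewrite /tn expr0 divr1.
      by rewrite ltNge; apply/negP => /nmin; rewrite ltnn.
    have E : tn n / K = tn n.+1 by rewrite /tn exprSr invfM mulrA.
    have := key _ (tn0 n) yB; rewrite E => /(_ hn) H.
    apply: (@le_trans _ _ (near n y)%:E); first by rewrite lee_fin.
    apply: le_trans (@nneseries_ge_term _ (fun n => (near n y)%:E) n nn) _.
    by rewrite leeDl// nneseries_ge0.
  have exn : exists n, d x y < tf n.
    have [n hn] := expr_unbounded (d x y / t0) K_gt1; exists n.
    rewrite /tf -ltr_pdivrMr//.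
    by apply: lt_le_trans hn _; rewrite exprS ler_peMl ?(ltW (Kn n)) ?(ltW K_gt1).
  case: (ex_minnP exn) => n hn nmin.
  have tK : tf n / K <= d x y.
    rewrite /tf exprS mulrAC [K * _]mulrC mulfK ?gt_eqF//.
    case: n hn nmin => [|n] hn nmin; first by rewrite expr0 mul1r.
    by rewrite leNgt; apply/negP => /nmin; rewrite ltnn.
  have H := key _ (tf0 n) hn tK.
  apply: (@le_trans _ _ (far n y)%:E); first by rewrite lee_fin.
  apply: le_trans (@nneseries_ge_term _ (fun n => (far n y)%:E) n ff) _.
  by rewrite leeDr// nneseries_ge0.
have nn n y : (0 <= (near n y)%:E)%E by rewrite lee_fin g0// weight_ge0.
have ff n y : (0 <= (far n y)%:E)%E by rewrite lee_fin g0// weight_ge0.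
have mn n : measurable_fun setT (fun y => (near n y)%:E) by (apply/measurable_EFinP; exact: mg).
have mff n : measurable_fun setT (fun y => (far n y)%:E) by (apply/measurable_EFinP; exact: mg).
rewrite ge0_integralD//; first last.
- by apply: ge0_emeasurable_sum.
- by move=> y _; apply: nneseries_ge0.
- by apply: ge0_emeasurable_sum.
- by move=> y _; apply: nneseries_ge0.
rewrite !integral_nneseries//.
rewrite /kernel_cst mulrDl EFinD.
have qE : q `^ (1 - beta) * G = C4 `^ (1 - beta) * (N `^ (1 - beta) * G `^ beta).
  rewrite /q powR_div ?(ltW C4N) ?(ltW G0)// powRM ?(ltW C4_gt0) ?(ltW N0)//.
  have -> : G `^ beta = G / G `^ (1 - beta).
    rewrite -{2}(powRr1 (ltW G0)) -powRB ?(gt_eqF G0) ?implybT//.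
    by congr (_ `^ _); ring.
  by field; rewrite gt_eqF ?powR_gt0.
apply: leeD.
  rewrite (_ : near_cst * _ = K `^ (Q - alpha) / delta * (q `^ (1 - beta) * G)
    / (1 - K `^ (- alpha))); last first.
    by rewrite qE /near_cst; ring.
  apply: nneseries_geometric_le => //.
  - by rewrite mulr_ge0 ?divr_ge0 ?powR_ge0 ?(ltW delta_gt0)// mulr_ge0 ?powR_ge0// ltW.
  - by move=> n; apply: integral_ge0.
  move=> n; rewrite intg ?weight_ge0//.
  apply: (@le_trans _ _ ((weight (tn n))%:E * (delta^-1 * (G * tn n `^ Q))%:E)%E).
    apply: lee_wpmul2l; first by rewrite lee_fin weight_ge0.
    apply: (@le_trans _ _ (\int[mu]_(y in B x (tn n)) (delta^-1 * (expR (delta * `|b x - b y|)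
      * `|f y|))%:E)%E).
      apply: le_integral_EFin => y _ //; rewrite mulrA ler_wpM2r// ler_pdivlMl//.
      by apply: le_trans (expR_ge1Dx _); rewrite lerDr.
    rewrite ge0_integralZ_fun//; first last.
    - by rewrite invr_ge0 ltW.
    - apply: measurable_funM => //; apply: measurableT_comp => //.
      exact: measurable_funM.
    by rewrite EFinM; apply: lee_wpmul2l; [rewrite lee_fin invr_ge0 ltW|exact: hG].
  rewrite -EFinM lee_fin.
  rewrite (_ : weight (tn n) * _ = delta^-1 * G * (weight (tn n) * tn n `^ Q)); last by ring.
  rewrite weightE//.
  have -> : tn n `^ alpha = q `^ (1 - beta) * K `^ (- alpha) ^+ n.
    rewrite /tn powR_div ?(ltW t00) ?(ltW (Kn n))// t0a powRN exprVn; congr (_ / _).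
    by rewrite (powR_exprn _ _ (ltW K_gt0)).
  by rewrite le_eqVlt; apply/orP; left; apply/eqP; ring.
have Dtf n : D (tf n) <= G * 2^-1 ^+ n.+1.
  rewrite /tf; elim: n => [|n IH].
    by rewrite !expr1; apply: le_trans (Dhalf _ t00) _; rewrite ler_pM2r ?invr_gt0.
  rewrite exprS -mulrA; apply: le_trans (Dhalf _ (tf0 n)) _.
  by rewrite exprSr mulrA ler_pM2r ?invr_gt0.
pose Ca := (a * delta)^-1 * (E1 + 1).
have Ca0 : 0 <= Ca.
  by apply: mulr_ge0; [rewrite invr_ge0 mulr_ge0 ?(ltW a0) ?(ltW delta_gt0)|rewrite addr_ge0].
have aE : a + a = beta by rewrite /a; field.
have Gb : G `^ beta = G `^ a * G `^ a by rewrite -powRD ?aE// (gt_eqF G0) implybT.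
have CNb : (C4 * N) `^ (1 - beta) = C4 `^ (1 - beta) * N `^ (1 - beta).
  by rewrite powRM ?(ltW C4_gt0) ?(ltW N0).
rewrite (_ : far_sum_cst * _ = K `^ (Q - alpha) * Ca * (C4 * N) `^ (1 - beta)
  * G `^ beta / (1 - (2 : R) `^ (- a))); last first.
  by rewrite CNb /far_sum_cst /Ca; ring.
apply: nneseries_geometric_le => //.
- apply: mulr_ge0; last exact: powR_ge0.
  apply: mulr_ge0; last exact: powR_ge0.
  by apply: mulr_ge0 => //; exact: powR_ge0.
- by move=> n; apply: integral_ge0.
move=> n; rewrite intg ?weight_ge0//.
set t := tf n; have tp : 0 < t by exact: tf0.
have Dt := D0 _ tp.
have mass : (\int[mu]_(y in B x t) (`|b x - b y| * `|f y|)%:E <=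
    (Ca * (G `^ a * D t `^ (1 - a)) * t `^ Q)%:E)%E.
  (* With this ratio the plain mean, of size [D t], and the exponential mean, of size [G],
     contribute equally to the right side of [linear_le_exp]. *)
  pose th := G / D t; have th0 : 0 < th by rewrite divr_gt0.
  have ad : 0 <= (a * delta)^-1 by rewrite invr_ge0 mulr_ge0 ?(ltW a0) ?(ltW delta_gt0).
  apply: (@le_trans _ _ (\int[mu]_(y in B x t) ((a * delta)^-1 *
     (th `^ a * `|f y| + th `^ (a - 1) * (expR (delta * `|b x - b y|) * `|f y|)))%:E)%E).
    apply: le_integral_EFin => y _ //.
    rewrite ler_pdivlMl ?mulr_gt0//.
    have := linear_le_exp (delta * `|b x - b y|) (introT andP (conj a0 a1)) th0.
    move=> /(ler_wpM2r (normr_ge0 (f y))); rewrite mulrDl.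
    by move=> h; apply: le_trans (le_trans _ h) _; rewrite le_eqVlt; apply/orP; left;
      apply/eqP; ring.
  have me : measurable_fun setT (fun y => expR (delta * `|b x - b y|) * `|f y|).
    by apply: measurable_funM => //; apply: measurableT_comp => //; exact: measurable_funM.
  have e0 y : 0 <= expR (delta * `|b x - b y|) * `|f y| by rewrite mulr_ge0 ?expR_ge0.
  rewrite ge0_integralZ_fun//; first last.
  - by move=> y; rewrite addr_ge0// mulr_ge0 ?powR_ge0.
  - by apply: measurable_funD; exact: measurable_funM.
  rewrite ge0_integralD_fun//; first last.
  - by move=> y; rewrite mulr_ge0 ?powR_ge0.
  - by move=> y; rewrite mulr_ge0 ?powR_ge0.
  - exact: measurable_funM.
  - exact: measurable_funM.
  rewrite !ge0_integralZ_fun ?powR_ge0//.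
  apply: (@le_trans _ _ (((a * delta)^-1)%:E * ((th `^ a)%:E * (E1 * D t * t `^ Q)%:E +
     (th `^ (a - 1))%:E * (G * t `^ Q)%:E))%E).
    apply: lee_wpmul2l; first by rewrite lee_fin.
    by apply: leeD; apply: lee_wpmul2l; rewrite ?lee_fin ?powR_ge0//; [exact: hf|exact: hG].
  rewrite -!EFinM lee_fin.
  have h1 : th `^ a * D t = G `^ a * D t `^ (1 - a).
    rewrite /th powR_div ?(ltW G0) ?(ltW Dt)// powRB ?(gt_eqF Dt) ?implybT// powRr1 ?(ltW Dt)//.
    by field; rewrite gt_eqF ?powR_gt0.
  have h2 : th `^ (a - 1) * G = th `^ a * D t.
    rewrite powRB ?(gt_eqF th0) ?implybT// powRr1 ?(ltW th0)// /th.
    by field; rewrite !gt_eqF.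
  rewrite (_ : _ * (_ + _) = (a * delta)^-1 * (E1 * (th `^ a * D t) + th `^ (a - 1) * G)
    * t `^ Q); last by ring.
  rewrite h2 h1 /Ca le_eqVlt; apply/orP; left; apply/eqP; ring.
apply: le_trans (lee_wpmul2l _ mass) _; first by rewrite lee_fin weight_ge0.
rewrite -EFinM lee_fin.
rewrite (_ : weight t * _ = Ca * (G `^ a * D t `^ (1 - a)) * (weight t * t `^ Q)); last by ring.
rewrite weightE//.
(* The decay of [D] is read backwards, as a bound on the radius in terms of [D t]; the choice of
   [sig] makes the exponent [1 - beta] appear. *)
have ta : t `^ alpha <= (C4 * N) `^ (1 - beta) / D t `^ (1 - beta).
  rewrite -sE powRrM -powR_div ?(ltW C4N) ?(ltW Dt)//.
  apply: ge0_ler_powR; rewrite ?nnegrE ?powR_ge0 ?divr_ge0 ?(ltW C4N) ?(ltW Dt) ?(ltW be1)//.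
  rewrite ler_pdivlMr// mulrC -ler_pdivlMr ?powR_gt0//.
  by have := D4 _ tp; rewrite powRN.
have Da : D t `^ (1 - a) / D t `^ (1 - beta) <= G `^ a * 2 `^ (- a) ^+ n.
  rewrite -powRB ?(gt_eqF Dt) ?implybT// (_ : 1 - a - (1 - beta) = a); last by rewrite -aE; ring.
  apply: (@le_trans _ _ ((G * 2^-1 ^+ n) `^ a)).
    apply: ge0_ler_powR; rewrite ?nnegrE ?(ltW a0) ?(ltW Dt) ?mulr_ge0 ?(ltW G0) ?exprn_ge0//.
    apply: le_trans (Dtf n) _; rewrite ler_pM2l// exprS ler_piMl ?exprn_ge0//.
    by rewrite invf_le1// ler1n.
  rewrite powRM ?(ltW G0) ?exprn_ge0// ler_pM2l ?powR_gt0//.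
  by rewrite powR_exprn// powR_inv// powRN.
apply: (@le_trans _ _ (K `^ (Q - alpha) * Ca * (C4 * N) `^ (1 - beta) * G `^ a *
    (D t `^ (1 - a) / D t `^ (1 - beta)))).
  rewrite (_ : _ * (_ / _) = Ca * (G `^ a * D t `^ (1 - a)) * (K `^ (Q - alpha) *
      ((C4 * N) `^ (1 - beta) / D t `^ (1 - beta)))); last by ring.
  apply: ler_wpM2l; first by rewrite mulr_ge0// mulr_ge0 ?powR_ge0.
  by rewrite ler_pM2l ?powR_gt0.
apply: le_trans (ler_wpM2l _ Da) _.
  apply: mulr_ge0; last exact: powR_ge0.
  apply: mulr_ge0; last exact: powR_ge0.
  by apply: mulr_ge0 => //; exact: powR_ge0.
by rewrite Gb le_eqVlt; apply/orP; left; apply/eqP; ring.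
Qed.

End kernel_bound.

(** * Modular estimate *)

Section core_estimate.
Context {R : realType} {disp : measure_display} {X : topMeasurableType disp}.
Variables (d : X -> X -> R) (mu : {measure set X -> \bar R}) (Q K1 K3 : R).
Hypothesis HX : Qspace d mu Q K1 K3.
Local Notation B := (qball d).
Variables (b : X -> R) (A : R).
Hypothesis Hb : bmo_data d mu Q b A.
Local Notation m x r := (mean mu b (B x r)).
Variables (d0 J : R).
Hypotheses (d0_gt0 : 0 < d0) (J_ge0 : 0 <= J).
Hypothesis Hjn : forall x t, 0 < t ->
  (\int[mu]_(y in B x t) (expR (d0 * `|b y - m x t|))%:E <= (J * t `^ Q)%:E)%E.
Variable Phi : R -> \bar R.
Hypothesis PhiY : youngY Phi.
Local Notation F := (young_fun Phi).
Local Notation cinv := (young_cinv Phi).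
Variables (k sigma C s : R).
Hypothesis k_ge1 : 1 <= k.
Hypothesis HD : forall u, 0 <= u -> F (2 * u) <= k * F u.
Hypothesis C_ge1 : 1 <= C.
Hypothesis HN : forall v w, 0 < v -> v <= w -> F v <= C * (v / w) `^ sigma * F w.
Hypothesis s_bounds : 1 < s < sigma.
Variables (K C0 delta : R).
Hypothesis K_ge2 : 2 <= K.
Hypothesis K_ge : 2 * K1 <= K.
Hypothesis C0_ge1 : 1 <= C0.
Hypothesis delta_gt0 : 0 < delta.
Hypothesis delta_young : delta * (s / (s - 1)) <= d0.
Hypothesis delta_k : ln (2 * k) * (2 * delta) <= d0 * ln 2.
Hypothesis delta_mean : delta * (K3 * (A * K `^ Q)) <= ln 2.

Let K1_gt0 : 0 < K1. Proof. exact: lt_le_trans (K1_ge1 HX). Qed.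
Let K3_gt0 : 0 < K3. Proof. exact: lt_le_trans (K3_ge1 HX). Qed.
Let Q0 : 0 <= Q. Proof. exact: ltW (Q_gt0 HX). Qed.
Let mB x r : measurable (B x r). Proof. exact: (measurable_qball HX). Qed.
Let mb := bmo_measurable Hb.
Let k_gt0 : 0 < k. Proof. exact: lt_le_trans k_ge1. Qed.
Let s_gt1 : 1 < s. Proof. by case/andP: s_bounds. Qed.
Let K_gt0 : 0 < K. Proof. exact: lt_le_trans K_ge2. Qed.
Local Notation M0 := (cover_cst K1).
Local Notation Kd := (dilation K1).

Local Notation level := (level Q Phi).

(** [md_modular] bounds the Luxemburg norm of [f] on balls of radius [t] by [D t / level t], so
    [D t] plays the role of a mean of [f]. *)
Record morrey_data (f : X -> R) (D : R -> R) : Prop := MorreyData {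
  md_measurable : measurable_fun setT f ;
  md_gt0 : forall t, 0 < t -> 0 < D t ;
  md_half : forall t, 0 < t -> D (K * t) <= D t / 2 ;
  md_dec : forall t t', 0 < t -> t <= t' -> D t' <= C0 * D t ;
  md_modular : forall x t, 0 < t ->
    (\int[mu]_(y in B x t) (F (`|f y| * (level t / D t)))%:E <= 1)%E }.

Definition mean_cst : R := K3 + C * k.

Lemma mean_cst_ge1 : 1 <= mean_cst.
Proof.
rewrite /mean_cst; have := K3_ge1 HX.
have : 0 <= C * k by rewrite mulr_ge0 ?(ltW k_gt0)// (le_trans ler01).
by lra.
Qed.

Section data.
Variables (f : X -> R) (D : R -> R).
Hypothesis HfD : morrey_data f D.

Let mf : measurable_fun setT (fun y => `|f y|).
Proof. by apply: measurableT_comp => //; exact: md_measurable HfD. Qed.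

(** Values of [|f|] below [D t] contribute at most the measure of the ball. Above, power growth with
    [sigma > s] bounds the power [s] of [|f| / D t] by a multiple of Phi, whose integral is at most
    1. *)
Lemma mean_power x t : 0 < t ->
  (\int[mu]_(y in B x t) (`|f y| `^ s)%:E <= ((mean_cst * D t) `^ s * t `^ Q)%:E)%E.
Proof.
move=> t0; have Dt := md_gt0 HfD t0; have ct := level_gt0 Q PhiY t0.
have tQ : 0 < t `^ Q by rewrite powR_gt0.
have Ck : 0 <= C * k * t `^ Q.
  by rewrite !mulr_ge0 ?(ltW k_gt0) ?powR_ge0// (le_trans ler01).
pose u y := `|f y| * (level t / D t).
have u0 y : 0 <= u y by rewrite /u mulr_ge0// divr_ge0// ltW.
have mu_u : measurable_fun setT (fun y => F (u y)).
  by apply: measurable_young_fun => //; exact: measurable_funM.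
have Fl : (F (level t))^-1 <= k * t `^ Q.
  have Fc : 0 < F (level t) by exact: young_fun_gt0.
  have := young_fun_cinv_ge PhiY HD (powR_gt0 (- Q) t0); rewrite -/(level t).
  rewrite powRN => h; rewrite -(ler_pM2r Fc) mulVf ?gt_eqF//.
  by rewrite mulrAC -ler_pdivrMr// mul1r.
apply: (@le_trans _ _ (\int[mu]_(y in B x t) (D t `^ s * (1 + C * k * t `^ Q * F (u y)))%:E)%E).
  apply: le_integral_EFin => y _; first exact: powR_ge0.
  have -> : `|f y| = D t * (u y / level t).
    by rewrite /u; field; rewrite !gt_eqF.
  rewrite powRM ?divr_ge0 ?(ltW Dt) ?(ltW ct)// ler_pM2l ?powR_gt0//.
  have Fu : 0 <= C * k * t `^ Q * F (u y).
    by rewrite mulr_ge0//; exact: (young_fun_ge0 PhiY).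
  have [h|h] := lerP (u y) (level t).
    apply: (@le_trans _ _ 1); last by lra.
    rewrite -[leRHS](_ : 1 `^ s = 1); last by rewrite powR1.
    apply: ge0_ler_powR; rewrite ?nnegrE ?divr_ge0 ?(ltW ct)//.
      exact: ltW (lt_trans ltr01 s_gt1).
    by rewrite ler_pdivrMr// mul1r.
  have uy : 0 < u y by exact: lt_trans h.
  apply: (@le_trans _ _ (C * k * t `^ Q * F (u y))); last by lra.
  have H := HN ct (ltW h).
  have le1 : (level t / u y) `^ sigma <= (level t / u y) `^ s.
    apply: ger_powR; first by rewrite divr_gt0//= ler_pdivrMr// mul1r ltW.
    by apply: ltW; case/andP: s_bounds.
  have Fy : 0 < F (u y) by exact: young_fun_gt0.
  have Fc : 0 < F (level t) by exact: young_fun_gt0.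
  have {}H : F (level t) <= C * (level t / u y) `^ s * F (u y).
    apply: le_trans H _; rewrite ler_pM2r// ler_wpM2l//.
    exact: le_trans ler01 C_ge1.
  have q0 : 0 < (u y / level t) `^ s by rewrite powR_gt0// divr_gt0.
  have qE : (level t / u y) `^ s = ((u y / level t) `^ s)^-1.
    by rewrite -[level t / u y]invf_div powR_inv// divr_ge0// ltW.
  rewrite qE in H.
  have {}H : (u y / level t) `^ s <= C * F (u y) / F (level t).
    rewrite ler_pdivlMr// mulrC -ler_pdivlMr//.
    by apply: le_trans H _; rewrite mulrAC.
  apply: le_trans H _.
  rewrite (_ : C * k * t `^ Q * F (u y) = C * F (u y) * (k * t `^ Q)); last by ring.
  apply: ler_wpM2l => //.
  by rewrite mulr_ge0 ?(ltW Fy)// (le_trans ler01).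
rewrite ge0_integralZ_fun//; first last.
- exact: powR_ge0.
- by move=> y; rewrite addr_ge0// mulr_ge0//; exact: (young_fun_ge0 PhiY).
- by apply: measurable_funD => //; exact: measurable_funM.
rewrite ge0_integralD_fun//; first last.
- by move=> y; rewrite mulr_ge0//; exact: (young_fun_ge0 PhiY).
- exact: measurable_funM.
rewrite ge0_integralZ_fun//; last by move=> y; exact: (young_fun_ge0 PhiY).
rewrite integral_cst_EFin// mul1e.
apply: (@le_trans _ _ ((D t `^ s)%:E * (mean_cst * t `^ Q)%:E)%E).
  apply: lee_wpmul2l; first by rewrite lee_fin powR_ge0.
  rewrite /mean_cst mulrDl EFinD; apply: leeD; first exact: (qball_mu_le HX).
  rewrite -[leRHS]mule1; apply: lee_wpmul2l; first by rewrite lee_fin.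
  exact: (md_modular HfD).
rewrite -EFinM lee_fin powRM ?(ltW Dt)//; last exact: le_trans ler01 mean_cst_ge1.
rewrite [mean_cst `^ s * _]mulrC -mulrA ler_pM2l ?powR_gt0// ler_pM2r//.
apply: le1r_powR; [exact: mean_cst_ge1|exact: ltW].
Qed.

Lemma md_half_iter n t : 0 < t -> D (K ^+ n * t) <= D t * 2^-1 ^+ n.
Proof.
move=> t0; elim: n => [|n IH]; first by rewrite !expr0 mul1r mulr1.
rewrite exprS -mulrA; apply: le_trans (md_half HfD _) _; first by rewrite mulr_gt0 ?exprn_gt0.
by rewrite exprSr mulrA ler_pM2r ?invr_gt0.
Qed.

Lemma exp_mean_data x t : 0 < t ->
  (\int[mu]_(y in B x t) (expR (delta * `|b y - m x t|) * `|f y|)%:E <=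
    (mean_cst * D t * (J + 1) * t `^ Q)%:E)%E.
Proof.
move=> t0; apply: (exp_mean_le HX Hb Hjn s_gt1 delta_young t0) => //.
  by rewrite mulr_gt0 ?(md_gt0 HfD)// (lt_le_trans ltr01 mean_cst_ge1).
exact: mean_power.
Qed.

Lemma mean_chain x0 r n : 0 < r ->
  `|m x0 r - m x0 (K ^+ n * r)| <= n%:R * (K3 * (A * K `^ Q)).
Proof.
move=> r0; elim: n => [|n IH]; first by rewrite expr0 mul1r subrr normr0 mul0r.
have Kr : 0 < K ^+ n * r by rewrite mulr_gt0// exprn_gt0.
rewrite -natr1 mulrDl mul1r.
have -> : m x0 r - m x0 (K ^+ n.+1 * r) =
   (m x0 r - m x0 (K ^+ n * r)) + (m x0 (K ^+ n * r) - m x0 (K ^+ n.+1 * r)).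
  by rewrite addrA subrK.
apply: le_trans (ler_normD _ _) (lerD IH _).
rewrite exprS -mulrA; apply: (mean_nested HX Hb) => //; first by rewrite mulr_gt0.
by apply: qball_le; rewrite ler_peMl ?(ltW Kr)//; have := K_ge2; lra.
Qed.

Definition far_cst : R := mean_cst * (J + 1) * (K ^+ 2) `^ Q.

(** Passing from radius [r] to a radius comparable to [t], the mean of [b] may drift, but
    [delta_mean] limits the cost to a factor 2 for each dilation by [K]. The halving of [D] cancels
    it, leaving only the oscillation at [x] against the ball of radius [r]. *)
Lemma far_mean x0 r x t : 0 < r -> B x0 r x -> r <= t ->
  (\int[mu]_(y in B x t) (expR (delta * `|b x - b y|) * `|f y|)%:E <=
   (far_cst * expR (delta * `|b x - m x0 r|) * D r * t `^ Q)%:E)%E.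
Proof.
move=> r0 x0x rt; have t0 : 0 < t by exact: lt_le_trans rt.
have K1g : 1 < K by have := K_ge2; lra.
have exn : exists n, t < K ^+ n * r.
  by have [n hn] := expr_unbounded (t / r) K1g; exists n; rewrite -ltr_pdivrMr.
case: (ex_minnP exn) => -[|n] hn nmin.
  by move: hn; rewrite expr0 mul1r ltNge rt.
have tn : K ^+ n * r <= t by rewrite leNgt; apply/negP => /nmin; rewrite ltnn.
pose rho := K ^+ n.+2 * r.
have rho0 : 0 < rho by rewrite mulr_gt0// exprn_gt0.
have rhot : rho <= K ^+ 2 * t.
  by rewrite /rho -addn2 addnC exprD -mulrA ler_pM2l// exprn_gt0.
have sub : B x t `<=` B x0 rho.
  apply: (@subset_trans _ (B x0 (K1 * (r + t)))); first exact: (qball_shift HX).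
  apply: qball_le; apply: (@le_trans _ _ (K * t)).
    by apply: le_trans (ler_wpM2r (ltW t0) K_ge); rewrite -mulrA mulrCA ler_pM2l//; lra.
  by rewrite /rho exprS -mulrA ler_pM2l// ltW.
have E2 : expR (delta * `|m x0 r - m x0 rho|) <= 2 ^+ n.+2.
  apply: (@le_trans _ _ (expR (n.+2%:R * ln 2))); last by rewrite expRM_natl lnK// posrE.
  rewrite ler_expR; apply: (@le_trans _ _ (n.+2%:R * (delta * (K3 * (A * K `^ Q))))).
    by rewrite mulrCA ler_pM2l//; exact: mean_chain.
  by rewrite ler_pM2l// ltr0n.
have e0 : 0 <= expR (delta * `|b x - m x0 r|) * 2 ^+ n.+2 by rewrite mulr_ge0 ?expR_ge0// exprn_ge0.
apply: (@le_trans _ _ ((expR (delta * `|b x - m x0 r|) * 2 ^+ n.+2)%:E *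
   \int[mu]_(y in B x0 rho) (expR (delta * `|b y - m x0 rho|) * `|f y|)%:E)%E).
  rewrite -ge0_integralZ_fun//; last first.
  - by apply: measurable_funM => //; exact: measurable_expR_osc Hb _ _.
  apply: (@le_trans _ _ (\int[mu]_(y in B x0 rho) (expR (delta * `|b x - b y|) * `|f y|)%:E)%E).
    by apply: le_integral_subset_EFin => // y; rewrite mulr_ge0 ?expR_ge0.
  apply: le_integral_EFin => y _; first by rewrite mulr_ge0 ?expR_ge0.
  rewrite mulrA ler_wpM2r//.
  apply: (@le_trans _ _ (expR (delta * `|b x - m x0 r|) *
     expR (delta * `|m x0 r - m x0 rho|) * expR (delta * `|b y - m x0 rho|))).
    rewrite -!expRD ler_expR -!mulrDr ler_pM2l// (distrC (b y)).
    apply: le_trans (lerD (ler_normD _ _) (lexx _)).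
    apply: le_trans (ler_normD _ _); rewrite le_eqVlt; apply/orP; left.
    by apply/eqP; congr `|_|; ring.
  by rewrite ler_pM2r ?expR_gt0// ler_pM2l ?expR_gt0.
apply: le_trans (lee_wpmul2l _ (exp_mean_data x0 rho0)) _; first by rewrite lee_fin.
rewrite -EFinM lee_fin.
have Dr := md_half_iter n.+2 r0; rewrite -/rho in Dr.
have rQ : rho `^ Q <= (K ^+ 2) `^ Q * t `^ Q.
  rewrite -powRM ?exprn_ge0 ?(ltW t0) ?(ltW K_gt0)//.
  by apply: (powRQ_le HX) => //; exact: ltW.
have m0 : 0 <= mean_cst by exact: le_trans ler01 mean_cst_ge1.
have J1 : 0 <= J + 1 by rewrite addr_ge0.
have D0 := ltW (md_gt0 HfD rho0).
apply: (@le_trans _ _ (expR (delta * `|b x - m x0 r|) * 2 ^+ n.+2 *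
   (mean_cst * (D r * 2^-1 ^+ n.+2) * (J + 1) * ((K ^+ 2) `^ Q * t `^ Q)))).
  apply: ler_wpM2l => //; apply: ler_pM; rewrite ?powR_ge0 ?mulr_ge0//.
  by apply: ler_wpM2r => //; apply: ler_wpM2l.
rewrite /far_cst exprVn le_eqVlt; apply/orP; left; apply/eqP; field.
by rewrite expf_neq0.
Qed.

End data.

(** Rate in [j] of the decay that [level_set_le] gives at the thresholds used in [bad_set]. *)
Let theta := d0 * ln 2 / (2 * delta).

Lemma expR_theta j : expR (- (theta * j%:R)) <= ((2 * k) ^+ j)^-1.
Proof.
have k2 : 0 < 2 * k by rewrite mulr_gt0.
rewrite expRN lef_pV2 ?posrE ?expR_gt0 ?exprn_gt0//.
rewrite -[leLHS]lnK ?posrE ?exprn_gt0// ler_expR lnXn// -[ln _ *+ _]mulr_natr ler_wpM2r//.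
by rewrite /theta ler_pdivlMr// mulr_gt0.
Qed.

(** By [delta_k], an oscillation large enough for [2 ^+ i] makes the John-Nirenberg exponential
    exceed [(2 * k) ^+ i]. Markov then beats the growth [k ^+ i] of Phi with ratio 1/2. *)
Lemma bad_far_sum x0 r : 0 < r ->
  (\sum_(i <oo) (F (2 ^+ i.+1 * level r))%:E *
     mu (B x0 r `&` [set x | (2 ^+ i < expR (delta * `|b x - m x0 r|))%R])
   <= (2 * (k ^+ 2 * J))%:E)%E.
Proof.
move=> r0; have c0 := level_gt0 Q PhiY r0; have rQ : 0 < r `^ Q by rewrite powR_gt0.
have k2 : 0 < 2 * k by rewrite mulr_gt0.
pose g x := expR (d0 * `|b x - m x0 r|) * \1_(B x0 r) x.
have g0 x : 0 <= g x by rewrite /g mulr_ge0 ?expR_ge0.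
have mg : measurable_fun setT g.
  by apply: measurable_funM; [exact: measurable_expR_osc Hb _ _|exact: measurable_indic].
have intg : (\int[mu]_x (g x)%:E <= (J * r `^ Q)%:E)%E.
  by rewrite /g ge0_integral_restr//; exact: Hjn.
have -> : 2 * (k ^+ 2 * J) = k ^+ 2 * J / (1 - 2^-1) by field.
have Fi i : 0 <= F (2 ^+ i.+1 * level r).
  by apply: (young_fun_ge0 PhiY); rewrite mulr_ge0 ?exprn_ge0// ltW.
apply: nneseries_geometric_le.
- by rewrite mulr_ge0 ?exprn_ge0// ltW.
- by rewrite invr_ge0 ler0n/= invf_lt1// ltr1n.
- by move=> i; rewrite mule_ge0// lee_fin.
move=> i; apply: (@le_trans _ _ ((F (2 ^+ i.+1 * level r))%:E * (((2 * k)
  ^+ i)^-1 * (J * r `^ Q))%:E)%E).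
  apply: lee_wpmul2l; first by rewrite lee_fin.
  have ki0 : 0 < (2 * k) ^+ i by rewrite exprn_gt0.
  apply: (@le_trans _ _ (mu [set x | ((2 * k) ^+ i < g x)%R])).
    apply: le_measure; rewrite ?inE; last first.
    - move=> x [xB hx] /=; rewrite /g indicE mem_set// mulr1.
      rewrite -[ltLHS]lnK ?posrE// ltr_expR lnXn//.
      have h : i%:R * ln 2 < delta * `|b x - m x0 r|.
        by rewrite -ltr_expR expRM_natl lnK ?posrE.
      have l0 : 0 <= ln (2 * k) by rewrite ln_ge0//; have := k_ge1; lra.
      have w0 := normr_ge0 (b x - m x0 r).
      rewrite -(ltr_pM2l delta_gt0) mulrCA; apply: (@le_lt_trans _ _ (i%:R * (d0 * ln 2))).
        rewrite mulrnAr -mulr_natl ler_wpM2l//; apply: le_trans delta_k.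
        by rewrite mulrC; have := mulr_ge0 l0 (ltW delta_gt0); lra.
      by rewrite [ltLHS]mulrCA (ltr_pM2l d0_gt0).
    - exact: measurable_gt.
    - apply: measurableI => //; apply: measurable_gt; exact: measurable_expR_osc Hb _ _.
  apply: le_trans (markov_measure_le mu ki0 mg g0) _; rewrite EFinM.
  by apply: lee_wpmul2l intg; rewrite lee_fin invr_ge0 ltW.
rewrite -EFinM lee_fin.
have H1 : F (2 ^+ i.+1 * level r) <= k ^+ i.+1 * (k * r `^ (- Q)).
  apply: le_trans (young_fun_pow2 k_gt0 HD _ (ltW c0)) _.
  rewrite ler_pM2l ?exprn_gt0//; apply: (young_fun_cinv_le PhiY k_gt0 HD).
  by rewrite powR_gt0.
apply: le_trans (ler_wpM2r _ H1) _.
  rewrite mulr_ge0 ?invr_ge0 ?exprn_ge0 ?(ltW k2)//.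
  by rewrite mulr_ge0// ltW.
rewrite powRN exprMn exprS exprVn le_eqVlt; apply/orP; left; apply/eqP; field.
by rewrite !gt_eqF// exprn_gt0.
Qed.

Section bad_local.
Variables (c : nat -> X) (r : nat -> R).
Hypothesis r_gt0 : forall n, 0 < r n.
Let C2 := 2 * sup_osc_cst Q K1 K3 J * Kd `^ Q.

(** A Marcinkiewicz interpolation carried out for each [j]: summing the weak type bounds over the
    levels [i] returns the modular of [h] with a loss [k ^+ j], and the decay in [j] is at least
    [(2 * k) ^+ j]. *)
Lemma bad_local_sum : exists2 CL, 0 < CL & forall (h : X -> R) c0 D0 M, 0 < c0 -> 0 < D0 ->
  measurable_fun setT h -> (forall x, 0 <= h x) -> 0 <= M ->
  (\int[mu]_x (F (h x * (c0 / D0)))%:E <= M%:E)%E ->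
  (\sum_(i <oo) (F (2 ^+ i.+1 * c0))%:E * mu (bad_set d mu Q b c r s delta h (2 ^+ i * D0))
    <= (CL * M)%:E)%E.
Proof.
have K31 := K3_ge1 HX.
have kap : 0 < (2 * K3)^-1 <= 1 by rewrite invr_gt0 mulr_gt0//= invf_le1 ?mulr_gt0//; lra.
have [CL CL0 HL] := level_sum PhiY k_gt0 HD C_ge1 HN s_bounds kap.
have C20 : 0 <= C2.
  rewrite /C2; apply: mulr_ge0; last exact: powR_ge0.
  by apply: mulr_ge0 => //; exact: (sup_osc_cst_ge0 HX J_ge0).
have e0 : 0 < expR theta by exact: expR_gt0.
have P0 : 0 <= C2 * expR theta * CL.
  by apply: mulr_ge0; [apply: mulr_ge0 => //; exact: ltW|exact: ltW].
exists (2 * (C2 * expR theta * CL) + 1) => [|h c0 D0 M c00 D00 mh h0 M0' hM].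
  by apply: ltr_wpDl => //; exact: mulr_ge0.
pose v x := h x * (c0 / D0).
have v0 x : 0 <= v x by rewrite /v mulr_ge0// divr_ge0// ltW.
have Fi i : 0 <= F (2 ^+ i.+1 * c0).
  by apply: (young_fun_ge0 PhiY); rewrite mulr_ge0 ?exprn_ge0// ltW.
pose a i j := 2^-1 ^+ j * (2 ^+ i * D0) : R.
have a0 i j : 0 < a i j by rewrite /a !mulr_gt0// exprn_gt0.
pose g i j x := (h x / a i j) `^ s * \1_[set x | ((2 * K3)^-1 * a i j < h x)%R] x.
have g0 i j x : 0 <= g i j x by rewrite /g mulr_ge0 ?powR_ge0.
have mg i j : measurable_fun setT (g i j).
  apply: measurable_funM; last by apply: measurable_indic; exact: measurable_gt.
  by apply: (measurableT_comp (measurable_powR s)); exact: measurable_funM.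
have gE i j x : g i j x = (v x / (2^-1 ^+ j * 2 ^+ i * c0)) `^ s *
    ((2 * K3)^-1 * (2^-1 ^+ j * 2 ^+ i * c0) < v x)%R%:R.
  have q0 : 0 < c0 / D0 by rewrite divr_gt0.
  have aE : 2^-1 ^+ j * 2 ^+ i * c0 = a i j * (c0 / D0).
    by rewrite /a; field; rewrite gt_eqF.
  rewrite /g aE /v; congr (_ * _).
    by congr (_ `^ s); field; rewrite !gt_eqF// a0.
  rewrite indicE [X in (X < _)%R%:R]mulrA (ltr_pM2r q0).
  have [xa|xa] := ltrP ((2 * K3)^-1 * a i j) (h x); first by rewrite mem_set.
  by rewrite memNset//= => /lt_le_trans/(_ xa); rewrite ltxx.
pose I i j := (\int[mu]_x (g i j x)%:E)%E.
have I0 i j : (0 <= I i j)%E by exact: integral_EFin_ge0.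
pose E j := C2 * expR (- (d0 * ((j%:R - 1) * ln 2 / delta) / 2)).
have E0 j : 0 <= E j by apply: mulr_ge0 => //; exact: expR_ge0.
have EE j : E j <= C2 * expR theta * ((2 * k) ^+ j)^-1.
  rewrite /E -[leRHS]mulrA; apply: ler_wpM2l => //.
  have -> : - (d0 * ((j%:R - 1) * ln 2 / delta) / 2) = theta + - (theta * j%:R).
    by rewrite /theta; field; rewrite gt_eqF.
  by rewrite expRD ler_pM2l//; exact: expR_theta.
have Fe i : (0 <= (F (2 ^+ i.+1 * c0))%:E)%E by rewrite lee_fin.
apply: (@le_trans _ _ (\sum_(i <oo) \sum_(j <oo)
    ((F (2 ^+ i.+1 * c0))%:E * ((E j)%:E * I i j)))%E).
  apply: lee_nneseries => [i _|i _]; first by rewrite mule_ge0.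
  rewrite nneseriesZl//; last by move=> j _; rewrite mule_ge0// lee_fin.
  apply: lee_wpmul2l => //.
  apply: (@le_trans _ _ (\sum_(j <oo) mu (level_set d mu Q b c r s h (a i j)
      ((j%:R - 1) * ln 2 / delta)))%E).
    apply: measure_sigma_subadditive => //.
    - by move=> j; exact: (measurable_level_set HX Hb).
    - exact: (measurable_bad_set HX Hb).
  apply: lee_nneseries => // j _.
  have H := level_set_le HX Hb d0_gt0 J_ge0 Hjn c r_gt0 s_gt1 ((j%:R - 1) * ln 2 / delta)
    (a0 i j) mh h0.
  exact: H.
rewrite nneseries_interchange; last by move=> i j; rewrite mule_ge0// mule_ge0// lee_fin.
have Fv : (0 <= \int[mu]_x (F (v x))%:E)%E.
  by apply: integral_EFin_ge0 => x; exact: (young_fun_ge0 PhiY).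
have HI j n : (\sum_(0 <= i < n) (F (2 ^+ i.+1 * c0))%:E * I i j <= (CL * k ^+ j * M)%:E)%E.
  have Ck0 : 0 <= CL * k ^+ j.
    by rewrite mulr_ge0 ?(ltW CL0)// exprn_ge0// ltW.
  apply: (@le_trans _ _ ((CL * k ^+ j)%:E * \int[mu]_x (F (v x))%:E)%E); last first.
    by rewrite [in leRHS]EFinM; apply: lee_wpmul2l; rewrite ?lee_fin.
  rewrite big_mkord.
  have mv : measurable_fun setT (fun x => F (v x)).
    by apply: measurable_young_fun => //; exact: measurable_funM.
  under eq_bigr do rewrite -ge0_integralZ_fun//.
  rewrite -ge0_integralZ_fun//; last by move=> x; exact: (young_fun_ge0 PhiY).
  rewrite -ge0_integral_sum//; first last.
  - by move=> i x _; rewrite lee_fin mulr_ge0.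
  - by move=> i; apply/measurable_EFinP; exact: measurable_funM.
  apply: le_lower_integral => x _.
    by apply: sume_ge0 => i _; rewrite lee_fin mulr_ge0.
  rewrite sumEFin lee_fin; under eq_bigr do rewrite gE.
  exact: HL.
have bound : 0 <= C2 * expR theta * CL * M by exact: mulr_ge0.
apply: (@le_trans _ _ (C2 * expR theta * CL * M / (1 - 2^-1))%:E); last first.
  rewrite lee_fin (_ : _ / (1 - 2^-1) = 2 * (C2 * expR theta * CL) * M); last by field.
  by rewrite mulrDl mul1r; lra.
apply: nneseries_geometric_le => //.
- by rewrite invr_ge0 ler0n/= invf_lt1// ltr1n.
- by move=> j; apply: nneseries_ge0 => i _ _; rewrite mule_ge0// mule_ge0// lee_fin.
move=> j; apply: nneseries_le => [i|n].
  by rewrite mule_ge0// mule_ge0// lee_fin.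
under eq_bigr do rewrite muleCA.
rewrite -ge0_sume_distrr; last by move=> i _; rewrite mule_ge0.
apply: le_trans (lee_wpmul2l _ (HI j n)) _; first by rewrite lee_fin.
rewrite -EFinM lee_fin.
have k2 : 0 < 2 * k by rewrite mulr_gt0.
apply: le_trans (ler_wpM2r _ (EE j)) _.
  rewrite mulr_ge0// mulr_ge0 ?(ltW CL0)// exprn_ge0//.
  exact: ltW.
rewrite exprMn exprVn le_eqVlt; apply/orP; left; apply/eqP; field.
by rewrite !gt_eqF// exprn_gt0.
Qed.

End bad_local.

(** Radii below [r] see only the restriction of [f] to a dilated ball and are governed by [bad_set].
    Larger radii are governed by [far_mean], whose only loss is the oscillation at [x]. Each [Bad i]
    is the union of the two exceptional sets. *)
Lemma good_levels (x1 : X) : exists2 CG, 0 < CG & forall f D, morrey_data f D ->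
  forall x0 r, 0 < r -> exists Bad : nat -> set X,
  [/\ forall i, measurable (Bad i),
      forall i x t, B x0 r x -> ~ Bad i x -> 0 < t ->
        (\int[mu]_(y in B x t) (expR (delta * `|b x - b y|) * `|f y|)%:E <=
          (CG * 2 ^+ i * D r * t `^ Q)%:E)%E &
      (\sum_(i <oo) (F (2 ^+ i.+1 * level r))%:E * mu (Bad i) <= CG%:E)%E].
Proof.
have K1g := K1_ge1 HX; have k1 : 1 <= 2 * K1 by lra.
have [c [rr [rr0 hcr]]] := qball_family HX x1.
have [CL CL0 HCL] := bad_local_sum c rr0.
have KQ0 : 0 <= (2 * K1) `^ Q * C0.
  by apply: mulr_ge0; [exact: powR_ge0|exact: le_trans ler01 C0_ge1].
have [CD CD0 HCD] := young_fun_dilate PhiY k_gt0 HD KQ0.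
have J1 : 0 <= J + 1 by rewrite addr_ge0.
have fc0 : 0 <= far_cst.
  rewrite /far_cst; apply: mulr_ge0; last exact: powR_ge0.
  by apply: mulr_ge0 => //; exact: le_trans ler01 mean_cst_ge1.
have JM : 0 <= (J + 1) * M0 `^ Q by apply: mulr_ge0 => //; exact: powR_ge0.
have kJ : 0 <= 2 * (k ^+ 2 * J).
  by rewrite mulr_ge0// mulr_ge0// exprn_ge0// ltW.
have LD : 0 < CL * CD by exact: mulr_gt0.
pose CG := far_cst + (J + 1) * M0 `^ Q + 2 * (k ^+ 2 * J) + CL * CD.
have CG0 : 0 < CG by rewrite /CG; lra.
exists CG => // f D HfD x0 r r0.
have c0 := level_gt0 Q PhiY r0; have Dr := md_gt0 HfD r0.
pose B' := B x0 (2 * K1 * r).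
pose h y := `|f y| * \1_B' y.
have mf : measurable_fun setT (fun y => `|f y|).
  by apply: measurableT_comp => //; exact: md_measurable HfD.
have mh : measurable_fun setT h.
  by apply: measurable_funM => //; apply: measurable_indic; exact: mB.
have h0 y : 0 <= h y by rewrite /h mulr_ge0.
pose BL i := bad_set d mu Q b c rr s delta h (2 ^+ i * D r).
pose BF i := B x0 r `&` [set x | 2 ^+ i < expR (delta * `|b x - m x0 r|)].
have mBL i : measurable (BL i) by exact: (measurable_bad_set HX Hb).
have mBF i : measurable (BF i).
  by apply: measurableI => //; apply: measurable_gt; exact: measurable_expR_osc Hb _ _.
exists (fun i => BL i `|` BF i); split.
- by move=> i; exact: measurableU.
- move=> i x t xB nbad t0.
  have nL : ~ BL i x by move=> ?; apply: nbad; left.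
  have nF : expR (delta * `|b x - m x0 r|) <= 2 ^+ i.
    by rewrite leNgt; apply/negP => ?; apply: nbad; right.
  have step a e : 0 <= a -> a <= CG -> 0 <= e -> e <= 2 ^+ i ->
      a * e * D r * t `^ Q <= CG * 2 ^+ i * D r * t `^ Q.
    move=> a0 aC e0 e2; apply: ler_wpM2r; first exact: powR_ge0.
    by apply: ler_wpM2r; [exact: ltW|exact: ler_pM].
  have [rt|tr] := lerP r t.
    apply: le_trans (far_mean HfD r0 xB rt) _; rewrite lee_fin.
    by apply: step => //; rewrite /CG; lra.
  have sub : B x t `<=` B'.
    apply: (@subset_trans _ (B x0 (K1 * (r + t)))); first exact: (qball_shift HX).
    by apply: qball_le; have := ler_wpM2l (ltW K1_gt0) (ltW tr); lra.
  rewrite (_ : \int[mu]_(y in B x t) _ = \int[mu]_(y in B x t)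
      (expR (delta * `|b x - b y|) * h y)%:E)%E; last first.
    apply: eq_integral => y /set_mem/sub yB'.
    by rewrite /h indicE mem_set// mulr1.
  have lD : 0 < 2 ^+ i * D r by rewrite mulr_gt0// exprn_gt0.
  apply: le_trans (good_local HX Hb J_ge0 Hjn rr0 s_gt1 delta_gt0 delta_young hcr lD mh h0 nL t0) _.
  by rewrite lee_fin mulrA; apply: step => //; rewrite /CG; lra.
have Fi i : 0 <= F (2 ^+ i.+1 * level r).
  by apply: (young_fun_ge0 PhiY); rewrite mulr_ge0 ?exprn_ge0// ltW.
apply: (@le_trans _ _ (\sum_(i <oo) ((F (2 ^+ i.+1 * level r))%:E * mu (BL i) +
     (F (2 ^+ i.+1 * level r))%:E * mu (BF i)))%E).
  apply: lee_nneseries => [i _|i _]; first by rewrite mule_ge0// lee_fin.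
  by rewrite -ge0_muleDr//; apply: lee_wpmul2l; rewrite ?lee_fin//; exact: measureU2.
rewrite nneseriesD; last 2 first.
- by move=> i _ _; rewrite mule_ge0// lee_fin.
- by move=> i _ _; rewrite mule_ge0// lee_fin.
apply: (@le_trans _ _ ((CL * CD)%:E + (2 * (k ^+ 2 * J))%:E)%E); last first.
  by rewrite -EFinD lee_fin /CG; lra.
apply: leeD; last exact: bad_far_sum.
apply: HCL => //; first exact: ltW.
have r2 : 0 < 2 * K1 * r by rewrite !mulr_gt0.
rewrite (_ : \int[mu]_x _ = \int[mu]_(x in B') (F (`|f x| * (level r / D r)))%:E)%E; last first.
  rewrite [RHS]integral_mkcond; apply: eq_integral => x _.
  rewrite patchE /h indicE; case: ifPn => xB; first by rewrite mulr1.
  by rewrite mulr0 mul0r young_fun0.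
have mF (q : R) : 0 <= q -> measurable_fun setT (fun y => F (`|f y| * q)).
  move=> q0; apply: (measurable_young_fun PhiY); first exact: measurable_funM.
  by move=> x; rewrite mulr_ge0.
have D2 := md_gt0 HfD r2.
have c2 := level_gt0 Q PhiY r2.
(* The modular is known with the normalisation of radius [2 * K1 * r]; changing to that of radius
   [r] costs a bounded dilation of the argument, which doubling turns into the factor [CD]. *)
apply: (@le_trans _ _ (\int[mu]_(x in B') (CD * F (`|f x| * (level (2 * K1 * r)
  / D (2 * K1 * r))))%:E)%E).
  apply: le_integral_EFin => x _.
    by apply: (young_fun_ge0 PhiY); rewrite mulr_ge0// divr_ge0// ltW.
  apply: le_trans (HCD _ _); last by rewrite mulr_ge0// divr_ge0// ltW.
  apply: (young_fun_le PhiY); first by rewrite mulr_ge0// divr_ge0// ltW.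
  rewrite [leRHS]mulrCA; apply: ler_wpM2l => //.
  rewrite ler_pdivrMr//.
  have h1 := level_dilate PhiY (Q_gt0 HX) k1 r0.
  have h2 : D (2 * K1 * r) <= C0 * D r by apply: (md_dec HfD) => //; rewrite ler_peMl// ltW.
  apply: le_trans h1 _.
  rewrite [leRHS](_ : _ = (2 * K1) `^ Q * level (2 * K1 * r) * (C0 * D r / D (2 * K1 * r))).
    rewrite ler_peMr// ?ler_pdivlMr ?mul1r//.
    by rewrite mulr_ge0 ?powR_ge0// ltW.
  by field; rewrite gt_eqF.
rewrite ge0_integralZ_fun//; first last.
- exact: ltW.
- by move=> x; apply: (young_fun_ge0 PhiY); rewrite mulr_ge0// divr_ge0// ltW.
- by apply: mF; rewrite divr_ge0// ltW.
- exact: mB.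
rewrite -[leRHS]mule1; apply: lee_wpmul2l; first by rewrite lee_fin ltW.
exact: (md_modular HfD).
Qed.

Variables (alpha beta : R).
Hypothesis alpha_bounds : 0 < alpha < Q.
Hypothesis beta_bounds : 0 < beta < 1.

Let sig := alpha / (1 - beta).
Local Notation T f x :=
  (\int[mu]_y (`|b x - b y| / d x y `^ (Q - alpha) * `|f y|)%:E)%E.

Lemma data_integral_le f D x t : morrey_data f D -> 0 < t ->
  (\int[mu]_(y in B x t) `|f y|%:E <=
    ((mean_cst * (J + 1)) * D t * t `^ Q)%:E)%E.
Proof.
move=> HfD t0; have := exp_mean_data HfD x t0.
rewrite (_ : mean_cst * D t * (J + 1) = mean_cst * (J + 1) * D t); last by ring.
apply: le_trans; apply: le_integral_EFin => y _ //.
rewrite ler_peMl//; apply: le_trans (expR_ge1Dx _); rewrite lerDl.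
by rewrite mulr_ge0// ltW.
Qed.

(** The power [beta^-1] undoes the exponent [beta] on the level, so a bound for the operator becomes
    a dyadic level in the argument of Phi. *)
Lemma level_transform (kc CG eps c N D0 v : R) i : 0 < kc -> 0 < CG -> 0 < eps -> 0 < c ->
  0 < N -> 0 < D0 -> 0 <= v ->
  v <= kc * (N `^ (1 - beta) * (CG * 2 ^+ i * D0) `^ beta) ->
  (v / (kc * (CG / eps) `^ beta * N `^ (1 - beta) * (D0 / c) `^ beta)) `^ beta^-1
    <= eps * (2 ^+ i * c).
Proof.
move=> kc0 CG0 e0 c0 N0 D00 v0 vle; have /andP[b0 b1] := beta_bounds.
have rhs0 : 0 < eps * (2 ^+ i * c) by rewrite !mulr_gt0// exprn_gt0.
rewrite [leRHS](_ : _ = ((eps * (2 ^+ i * c)) `^ beta) `^ beta^-1); last first.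
  by rewrite -powRrM mulfV ?gt_eqF// powRr1// ltW.
have l0 : 0 < kc * (CG / eps) `^ beta * N `^ (1 - beta) * (D0 / c) `^ beta.
  by rewrite !mulr_gt0 ?powR_gt0 ?divr_gt0.
apply: ge0_ler_powR; rewrite ?nnegrE ?powR_ge0 ?invr_ge0 ?(ltW b0)//.
  by rewrite divr_ge0// ltW.
rewrite ler_pdivrMr//; apply: le_trans vle _.
rewrite le_eqVlt; apply/orP; left; apply/eqP.
have -> : CG * 2 ^+ i * D0 = eps * (2 ^+ i * c) * (CG / eps) * (D0 / c).
  by field; rewrite !gt_eqF.
rewrite (@powRM _ (eps * (2 ^+ i * c) * (CG / eps)))
  ?divr_ge0 ?mulr_ge0 ?exprn_ge0 ?invr_ge0 ?(ltW e0) ?(ltW c0) ?(ltW CG0) ?(ltW D00)//.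
rewrite (@powRM _ (eps * (2 ^+ i * c))) ?divr_ge0 ?(ltW rhs0) ?(ltW e0) ?(ltW CG0)//.
by ring.
Qed.

Lemma core_estimate (x1 : X) : exists2 CT, 0 < CT & forall N f D, 0 < N -> morrey_data f D ->
  (forall t, 0 < t -> D t <= C0 * N * t `^ (- sig)) ->
  mu.-negligible [set x | T f x = +oo%E] /\
  forall x0 r (S : X -> R), 0 < r ->
    (forall x, B x0 r x -> (`|S x|%:E <= T f x)%E) ->
    (\int[mu]_(x in B x0 r) (F ((`|S x| / (CT * N `^ (1 - beta) *
        (D r / level r) `^ beta)) `^ beta^-1))%:E <= 1)%E.
Proof.
have /andP[b0 b1] := beta_bounds.
have [CG CG0 HG] := good_levels x1.
have C00 : 0 < C0 by exact: lt_le_trans C0_ge1.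
pose E1 := mean_cst * (J + 1).
have E10 : 0 <= E1.
  apply: mulr_ge0; last by rewrite addr_ge0.
  exact: le_trans ler01 mean_cst_ge1.
pose kc := kernel_cst Q alpha beta K C0 E1 delta.
have kc0 : 0 < kc by exact: (kernel_cst_gt0 alpha_bounds beta_bounds K_ge2 C00 E10 delta_gt0).
(* The ball contributes at most [k * K3] and the exceptional sets at most [CG]; convexity lets [eps]
   out of Phi, which brings the total below 1. *)
pose eps := (k * K3 + CG + 1)^-1.
have kK : 0 < k * K3 by exact: mulr_gt0.
have e0 : 0 < eps by rewrite invr_gt0 addr_gt0// addr_gt0.
have e1 : eps <= 1 by rewrite invf_le1; lra.
exists (kc * (CG / eps) `^ beta) => [|N f D N0 HfD D4].
  by rewrite mulr_gt0// powR_gt0// divr_gt0.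
have mf := md_measurable HfD.
have good x0 r Bad i x : 0 < r ->
   (forall i x t, B x0 r x -> ~ Bad i x -> 0 < t ->
        (\int[mu]_(y in B x t) (expR (delta * `|b x - b y|) * `|f y|)%:E <=
          (CG * 2 ^+ i * D r * t `^ Q)%:E)%E) -> B x0 r x -> ~ Bad i x ->
   (T f x <= (kc * (N `^ (1 - beta) * (CG * 2 ^+ i * D r) `^ beta))%:E)%E.
  move=> r0 HB xB nb.
  apply: (kernel_bound HX alpha_bounds beta_bounds K_ge2 C00 E10 delta_gt0 mb mf N0 _ (md_gt0
    HfD) (md_half HfD) D4).
  - by rewrite mulr_gt0 ?(md_gt0 HfD)// mulr_gt0// exprn_gt0.
  - by move=> t t0; exact: (data_integral_le x HfD t0).
  - by move=> t t0; exact: HB.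
have Fgrow i c : 0 < c -> 2 ^+ i * F c <= F (2 ^+ i * c).
  move=> c0; have i0 : 0 < 2 ^+ i :> R by rewrite exprn_gt0.
  have t01 : 0 <= (2 ^+ i : R)^-1 <= 1 by rewrite invr_ge0 ltW//= invf_le1// exprn_ege1// ler1n.
  have := young_fun_scale PhiY t01 (mulr_ge0 (ltW i0) (ltW c0)).
  by rewrite mulrA mulVf ?gt_eqF// mul1r ler_pdivlMl.
split.
  apply: (@negligibleS _ _ _ _ (\bigcup_n [set x | B x1 n.+1%:R x /\ T f x = +oo%E])).
    move=> x Tx; have : (\bigcup_n B x1 n.+1%:R) x by rewrite (qball_bigcup d).
    by move=> [n _ xn]; exists n.
  apply: negligible_bigcup => n; have r0 : 0 < n.+1%:R :> R by [].
  have [Bad [mBad HB HS]] := HG f D HfD x1 n.+1%:R r0.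
  have c0 := level_gt0 Q PhiY r0.
  have Fc := young_fun_gt0 PhiY c0.
  apply: negligible_small => e ep.
  have q1 : 1 < 2 :> R by rewrite ltr1n.
  have [i hi] := expr_unbounded (CG / (e * F (level n.+1%:R))) q1.
  (* The operator can be infinite only at points of every [Bad i], and the measure of these sets
     tends to 0 because Phi grows along the levels. *)
  exists (Bad i); split => //.
    move=> x [xB Tx]; apply: contrapT => nb.
    by have := good _ _ _ _ _ r0 HB xB nb; rewrite Tx leye_eq.
  have ge0 j : (0 <= (F (2 ^+ j.+1 * level n.+1%:R))%:E * mu (Bad j))%E.
    rewrite mule_ge0// lee_fin; apply: (young_fun_ge0 PhiY).
    by rewrite mulr_ge0 ?exprn_ge0// ltW.
  have := le_trans (nneseries_ge_term i ge0) HS.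
  have G0 : 0 < F (2 ^+ i.+1 * level n.+1%:R).
    by apply: young_fun_gt0 => //; rewrite mulr_gt0// exprn_gt0.
  rewrite -lee_pdivlMl// -EFinM => /le_trans; apply; rewrite lee_fin ler_pdivrMl//.
  move: hi; rewrite ltr_pdivrMr ?mulr_gt0// => /ltW h; apply: le_trans h _.
  rewrite mulrCA mulrC ler_pM2r//; apply: le_trans (Fgrow i.+1 _ c0).
  rewrite ler_pM2r// exprS ler_peMl ?exprn_ge0//; exact: ltW.
move=> x0 r S r0 HST.
have [Bad [mBad HB HS]] := HG f D HfD x0 r r0.
have c0 := level_gt0 Q PhiY r0.
have Fc := young_fun_gt0 PhiY c0.
have Dr := md_gt0 HfD r0.
set l := _ * _ * _ `^ beta.
pose Fi (i : nat) := eps * F (2 ^+ i.+1 * level r).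
have Fi0 i : 0 < Fi i.
  by rewrite /Fi mulr_gt0//; apply: young_fun_gt0 => //; rewrite mulr_gt0// exprn_gt0.
have u0 i x : (0 <= (Fi i * \1_(Bad i) x)%:E)%E by rewrite lee_fin mulr_ge0// ltW.
apply: (@le_trans _ _ (\int[mu]_(x in B x0 r) ((eps * F (level r))%:E +
    \sum_(i <oo) (Fi i * \1_(Bad i) x)%:E))%E).
  apply: le_lower_integral => x xB.
    by rewrite lee_fin; apply: (young_fun_ge0 PhiY); exact: powR_ge0.
  have [[i nb]|allB] := pselect (exists i, ~ Bad i x).
    have exi : exists i, `[< ~ Bad i x >] by exists i; apply/asboolP.
    (* At the first index [i] outside the exceptional sets the bound has level [2 ^+ i]. For
       positive [i] the point lies in the preceding set, hence the exponent [i.+1] in [Fi]. *)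
    case: (ex_minnP exi) => {nb}i /asboolP nb imin.
    have := le_trans (HST x xB) (good _ _ _ _ _ r0 HB xB nb); rewrite lee_fin => vle.
    have H := level_transform kc0 CG0 e0 c0 N0 Dr (normr_ge0 (S x)) vle.
    apply: (@le_trans _ _ (eps * F (2 ^+ i * level r))%:E).
      rewrite lee_fin; apply: le_trans (young_fun_le PhiY (powR_ge0 _ _) H) _.
      apply: (young_fun_scale PhiY); first by rewrite ltW.
      by rewrite mulr_ge0 ?exprn_ge0// ltW.
    case: i imin {nb vle H} => [|i] imin.
      by rewrite expr0 mul1r leeDl// nneseries_ge0.
    have xi : Bad i x.
      apply: contrapT => nb; have := imin i; rewrite ltnn => h.
      by have : false by apply: h; apply/asboolP.
    apply: (@le_trans _ _ (\sum_(i <oo) (Fi i * \1_(Bad i) x)%:E)%E); last first.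
      by rewrite leeDr// lee_fin mulr_ge0 ?(ltW e0) ?(ltW Fc).
    apply: le_trans (@nneseries_ge_term _ (fun i => (Fi i * \1_(Bad i) x)%:E) i (u0^~ x)).
    by rewrite indicE mem_set// mulr1.
  (* At a point lying in all the exceptional sets the terms of the series are bounded below, so
     finitely many of them already exceed [v]. *)
  set v := F _; have v0 : 0 <= v by apply: (young_fun_ge0 PhiY); exact: powR_ge0.
  have eF : 0 < eps * F (level r) by rewrite mulr_gt0.
  pose n := (Num.trunc (v / (eps * F (level r)))).+1.
  have hn : v <= n%:R * (eps * F (level r)).
    by rewrite -ler_pdivrMr//; apply/ltW; exact: truncnS_gt.
  apply: (@le_trans _ _ (\sum_(0 <= i < n) (Fi i * \1_(Bad i) x)%:E)%E); last first.
    apply: le_trans (nneseries_lim_ge n _) _ => //.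
    by rewrite leeDr// lee_fin ltW.
  rewrite sumEFin lee_fin; apply: le_trans hn _.
  rewrite mulr_natl -[n in leLHS]subn0 -sumr_const_nat; apply: ler_sum => i _.
  rewrite indicE mem_set ?mulr1; last by apply: contrapT => nb; apply: allB; exists i.
  rewrite /Fi ler_pM2l//; apply: le_trans (Fgrow i.+1 _ c0).
  by rewrite ler_peMl ?(ltW Fc)// exprn_ege1// ler1n.
have mu_u i : measurable_fun (B x0 r) (fun x => (Fi i * \1_(Bad i) x)%:E).
  by apply/measurable_EFinP; apply: measurable_funM => //; exact: measurable_indic.
rewrite ge0_integralD//; first last.
- by apply: ge0_emeasurable_sum.
- by move=> x _; apply: nneseries_ge0.
- by move=> x _; rewrite lee_fin mulr_ge0 ?(ltW e0) ?(ltW Fc).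
rewrite integral_cst_EFin// integral_nneseries//.
apply: (@le_trans _ _ ((eps * (k * K3))%:E + (eps * CG)%:E)%E); last first.
  rewrite -EFinD lee_fin -mulrDr /eps mulrC ler_pdivrMr ?mul1r; first by lra.
  by rewrite addr_gt0// addr_gt0.
apply: leeD.
  apply: le_trans (lee_wpmul2l _ (qball_mu_le HX x0 r0)) _;
    first by rewrite lee_fin mulr_ge0 ?(ltW e0) ?(ltW Fc).
  rewrite -EFinM lee_fin -mulrA ler_pM2l//.
  have rQ : 0 < r `^ Q by rewrite powR_gt0.
  have := young_fun_cinv_le PhiY k_gt0 HD (powR_gt0 (- Q) r0); rewrite -/(level r) powRN.
  rewrite ler_pdivlMr// => h.
  by rewrite mulrCA [leRHS]mulrC ler_pM2l.
rewrite EFinM; apply: le_trans (lee_wpmul2l _ HS); last by rewrite lee_fin ltW.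
rewrite -nneseriesZl//; last first.
  by move=> i _; rewrite mule_ge0// lee_fin; have := Fi0 i; rewrite /Fi pmulr_rgt0// => /ltW.
apply: lee_nneseries => [i _ _|i _]; first by apply: integral_ge0 => x _.
rewrite ge0_integralZ_fun ?(ltW (Fi0 i))//.
rewrite muleA -EFinM; apply: lee_wpmul2l; first by rewrite lee_fin ltW.
rewrite integral_indic//; apply: le_measure; rewrite ?inE//; first exact: measurableI.
Qed.

End core_estimate.

(** * Morrey spaces *)

Section essential_infimum.
Context {R : realType}.
Implicit Types (g : R -> \bar R).

Lemma negligible_above (t : R) (S : set R) :
  (mrestr (@lebesgue_measure R) (measurable_itv `]t, +oo[)).-negligible S <->
  lebesgue_measure.-negligible (S `&` `]t, +oo[%classic).
Proof.
split=> -[A [mA A0 SA]].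
  exists (A `&` `]t, +oo[%classic); split => //; first exact: measurableI.
  by move=> x [Sx xt]; split => //; exact: SA.
exists (A `|` ~` `]t, +oo[%classic); split.
- by apply: measurableU => //; exact: measurableC.
- rewrite /mrestr setIUl setICl setU0; apply/eqP; rewrite eq_le measure_ge0 andbT -A0.
  by apply: le_measure; rewrite ?inE//; exact: measurableI.
- by move=> x Sx; have [xt|xt] := pselect (`]t, +oo[%classic x); [left; apply: SA|right].
Qed.

Lemma ess_inf_aboveP (t : R) g y : (y <= ess_inf_above t g)%E <->
  lebesgue_measure.-negligible ([set s | ~ (y <= g s)%E] `&` `]t, +oo[%classic).
Proof.
rewrite /ess_inf_above; split.
  by move=> /ess_infP/negligible_above.
by move=> H; apply/ess_infP/negligible_above.
Qed.

Lemma ess_inf_above_ge (t u : R) g y : t <= u ->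
  (forall s, t < s < u -> (y <= g s)%E) -> (y <= ess_inf_above u g)%E ->
  (y <= ess_inf_above t g)%E.
Proof.
move=> tu hs /ess_inf_aboveP hu; apply/ess_inf_aboveP.
have u0 : lebesgue_measure.-negligible [set u : R].
  by apply/negligibleP => //; exact: lebesgue_measure_set1.
apply: negligibleS (negligibleU hu u0) => s /= [gs]; rewrite !in_itv/= !andbT => ts.
have [su|us|->] := ltgtP s u; [|by left|by right].
by exfalso; apply: gs; apply: hs; rewrite ts.
Qed.

Lemma ess_inf_above_le (t u : R) g : t <= u -> (ess_inf_above t g <= ess_inf_above u g)%E.
Proof.
move=> tu; apply/ess_inf_aboveP.
have /ess_inf_aboveP := lexx (ess_inf_above t g).
apply: negligibleS => s [gs]; rewrite /= !in_itv/= !andbT => us; split => //.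
exact: le_lt_trans us.
Qed.

Lemma ess_inf_above_ex (t u : R) g : t < u ->
  exists2 s, t < s < u & (ess_inf_above t g <= g s)%E.
Proof.
move=> tu; apply: contrapT => nex; have /ess_inf_aboveP H := lexx (ess_inf_above t g).
have /negligibleP H0 : lebesgue_measure.-negligible (`]t, u[%classic : set R).
  apply: negligibleS H => s; rewrite /= !in_itv/= andbT => stu; split.
    by move=> gs; apply: nex; exists s.
  by case/andP: stu.
have : lebesgue_measure (`]t, u[%classic : set R) = 0%E by exact: H0.
by rewrite lebesgue_measure_itv/= lte_fin tu -EFinD => -[] /eqP; rewrite subr_eq0 gt_eqF.
Qed.

Lemma ess_inf_above_ge0 (t : R) g : (forall s, t < s -> (0 <= g s)%E) ->
  (0 <= ess_inf_above t g)%E.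
Proof.
move=> g0; apply/ess_inf_aboveP; rewrite (_ : _ `&` _ = set0); first exact: negligible_set0.
apply/seteqP; split => // s [gs]; rewrite /= in_itv/= andbT => /g0; exact: gs.
Qed.

End essential_infimum.


(** * Consequences of the supremum condition *)

Section minorant.
Context {R : realType}.
Variables (Phi : R -> \bar R) (Q k : R) (phi : R -> R).
Hypothesis PhiY : youngY Phi.
Hypothesis Q_gt0 : 0 < Q.
Hypothesis k_gt1 : 1 < k.
Local Notation F := (young_fun Phi).
Hypothesis HD : forall u, 0 <= u -> F (2 * u) <= k * F u.
Hypothesis phi_gt0 : forall t, 0 < t -> 0 < phi t.
Local Notation level := (level Q Phi).
Local Notation ratio := (young_ratio Phi Q phi).

Let k_gt0 : 0 < k. Proof. exact: lt_trans k_gt1. Qed.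

Lemma young_ratioE s : 0 < s -> ratio s = (phi s / level s)%:E.
Proof.
move=> s0; have [E c0 _ _] := young_inv_spec PhiY (powR_gt0 (- Q) s0).
by rewrite /young_ratio E inver gt_eqF.
Qed.

Definition lower_ratio (t : R) : R := locked (fun t => fine (ess_inf_above t ratio)) t.
Local Notation E := lower_ratio.

Lemma lower_ratioE t : 0 < t -> ess_inf_above t ratio = (E t)%:E.
Proof.
move=> t0; rewrite /lower_ratio -lock fineK// ge0_fin_numE; last first.
  apply: ess_inf_above_ge0 => s ts; have s0 := lt_trans t0 ts.
  by rewrite young_ratioE// lee_fin divr_ge0 ?ltW ?phi_gt0 ?level_gt0.
have [|s /andP[ts _] /le_lt_trans] := @ess_inf_above_ex _ t (t + 1) ratio; last apply.
  by rewrite ltrDl.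
by rewrite young_ratioE ?ltry// (lt_trans t0).
Qed.

Lemma lower_ratio_ge0 t : 0 < t -> 0 <= E t.
Proof.
move=> t0; rewrite -lee_fin -lower_ratioE//; apply: ess_inf_above_ge0 => s ts.
have s0 := lt_trans t0 ts.
by rewrite young_ratioE// lee_fin divr_ge0 ?ltW ?phi_gt0 ?level_gt0.
Qed.

Lemma lower_ratio_le s t : 0 < s -> s <= t -> E s <= E t.
Proof.
move=> s0 st; rewrite -lee_fin -!lower_ratioE//; first exact: ess_inf_above_le.
exact: lt_le_trans st.
Qed.

Lemma lower_ratio_ge t u c : 0 < t -> t <= u ->
  (forall s, t < s < u -> c <= phi s / level s) -> c <= E u -> c <= E t.
Proof.
move=> t0 tu hs hu; rewrite -lee_fin -lower_ratioE//; apply: (ess_inf_above_ge tu).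
  move=> s /andP[ts su]; rewrite young_ratioE ?(lt_trans t0)// lee_fin.
  by apply: hs; rewrite ts.
by rewrite lower_ratioE ?lee_fin// (lt_le_trans t0).
Qed.


Definition minorant (t : R) : R := level t * E t.
Local Notation w := minorant.

Lemma minorant_ge0 t : 0 < t -> 0 <= w t.
Proof. by move=> t0; rewrite mulr_ge0 ?lower_ratio_ge0// ltW// level_gt0. Qed.

Variable C1 : R.
Hypothesis C1_ge1 : 1 <= C1.
Hypothesis H1 : forall r t, 0 < r -> r < t -> (1 + ln (t / r)) * w t <= C1 * phi r.

Let C1_gt0 : 0 < C1. Proof. exact: lt_le_trans C1_ge1. Qed.

Lemma minorant_le_phi r t : 0 < r -> r < t -> w t <= C1 * phi r.
Proof.
move=> r0 rt; apply: le_trans (H1 r0 rt); rewrite ler_peMl//.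
  by apply: minorant_ge0; exact: lt_trans rt.
by rewrite lerDl ln_ge0// ler_pdivlMr// mul1r ltW.
Qed.

Lemma minorant_le_phi_diag t : 0 < t -> w t <= 2 `^ Q * C1 * phi t.
Proof.
move=> t0; have t2 : t < 2 * t by lra.
apply: (@le_trans _ _ (2 `^ Q * w (2 * t))); last first.
  by rewrite -mulrA ler_pM2l ?powR_gt0//; exact: minorant_le_phi.
rewrite /minorant mulrA; apply: ler_pM.
- exact: ltW (level_gt0 Q PhiY t0).
- exact: lower_ratio_ge0.
- by apply: (level_dilate PhiY Q_gt0) => //; rewrite ler1n.
- by apply: lower_ratio_le => //; exact: ltW.
Qed.

Lemma minorant_almost_decreasing t t' : 0 < t -> t <= t' -> w t' <= C1 * w t.
Proof.
move=> t0 tt; have t0' := lt_le_trans t0 tt.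
have lt0 := level_gt0 Q PhiY t0; have lt0' := level_gt0 Q PhiY t0'.
suff : w t' / (C1 * level t) <= E t.
  by rewrite ler_pdivrMr ?mulr_gt0// /minorant => h; apply: le_trans h _; rewrite le_eqVlt;
    apply/orP; left; apply/eqP; ring.
apply: (lower_ratio_ge t0 tt) => [s /andP[ts st]|].
  have s0 := lt_trans t0 ts; have ls0 := level_gt0 Q PhiY s0.
  rewrite ler_pdivrMr ?mulr_gt0//; apply: le_trans (minorant_le_phi s0 st) _.
  rewrite mulrCA ler_pM2l// -mulrA ler_peMr ?(ltW (phi_gt0 s0))//.
  by rewrite mulrC ler_pdivlMr// mul1r (level_le PhiY Q_gt0)// ltW.
rewrite ler_pdivrMr ?mulr_gt0// /minorant mulrC ler_wpM2l ?lower_ratio_ge0//.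
apply: le_trans (level_le PhiY Q_gt0 t0 tt) _; rewrite ler_peMl//; exact: ltW.
Qed.

Lemma level_decay (M : R) : exists L, [/\ 2 <= L, M <= L, 2 * C1 <= ln L &
  forall u, 0 < u -> 2 * C1 * level (L * u) <= level u].
Proof.
have [q [q0 q1 qE]] : exists q, [/\ 0 < q, 1 < q & q = k `^ Q^-1].
  exists (k `^ Q^-1); split => //; first by rewrite powR_gt0.
  rewrite -[ltLHS](_ : 1 `^ Q^-1 = 1); last by rewrite powR1.
  by apply: gt0_ltr_powR; rewrite ?invr_gt0 ?nnegrE// ltW.
have lq : 0 < ln q by rewrite ln_gt0.
have q2 : 1 < 2 :> R by rewrite ltr1n.
have [n1 h1] := expr_unbounded (2 * C1) q2.
have [n2 h2] := expr_unbounded (Num.max M 2) q1.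
have [n3 h3] : exists n3, 2 * C1 / ln q < n3%:R.
  by exists (Num.trunc (2 * C1 / ln q)).+1; exact: truncnS_gt.
have [n [le1 le2 le3]] : exists n, [/\ (n1 <= n)%N, (n2 <= n)%N & (n3 <= n)%N].
  exists (n1 + n2 + n3)%N; split; last exact: leq_addl.
    by rewrite -addnA leq_addr.
  by rewrite addnAC leq_addl.
have pw (z : R) i : 1 < z -> (i <= n)%N -> z ^+ i <= z ^+ n.
  by move=> z1 ni; rewrite ler_weXn2l// ltW.
have P2 := le_trans (ltW h1) (pw _ _ q2 le1).
have := le_trans (ltW h2) (pw _ _ q1 le2); rewrite ge_max => /andP[M2 M1].
exists (q ^+ n); split => //.
  rewrite lnXn// -[ln q *+ n]mulr_natl -ler_pdivrMr//.
  by apply: (le_trans (ltW h3)); rewrite ler_nat.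
move=> u u0; apply: le_trans (level_growth PhiY Q_gt0 k_gt1 HD n u0); rewrite -qE.
by apply: ler_wpM2r P2; apply/ltW/(level_gt0 Q PhiY); rewrite mulr_gt0// exprn_gt0.
Qed.

(** With [K = L * L], the essential infimum beyond [t] is bounded below on three ranges. Up to
    [L * t] the logarithm in the hypothesis gains the factor; from there to [L * (L * t)] the decay
    of [level] does; beyond, the infimum defining [w] at the dilated radius applies. *)
Lemma minorant_half (M : R) : exists K, [/\ 2 <= K, M <= K &
  forall t, 0 < t -> w (K * t) <= w t / 2].
Proof.
have [L [LM2 LM1 lnL grow]] := level_decay M.
have L1 : 1 < L by apply: lt_le_trans LM2; rewrite ltr1n.
have L0 : 0 < L by exact: lt_trans L1.
have LL : L <= L * L by rewrite ler_peMl// ltW.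
exists (L * L); split; [exact: (le_trans LM2)|exact: (le_trans LM1)|].
move=> t t0; rewrite -mulrA.
have Lt0 : 0 < L * t by rewrite mulr_gt0.
have LLt0 : 0 < L * (L * t) by rewrite mulr_gt0.
have lt0 := level_gt0 Q PhiY t0; have lLt0 := level_gt0 Q PhiY Lt0.
have tLt : t <= L * t by rewrite ler_peMl// ltW.
have LtLL : L * t <= L * (L * t) by rewrite ler_pM2l.
have w0 := minorant_ge0 LLt0.
suff : 2 * w (L * (L * t)) / level t <= E t.
  by rewrite ler_pdivrMr// [_ * level t]mulrC => h; rewrite ler_pdivlMr// mulrC.
apply: (lower_ratio_ge t0 tLt) => [s /andP[ts st]|].
  have s0 := lt_trans t0 ts; have ls0 := level_gt0 Q PhiY s0.
  have sLL : s < L * (L * t) by exact: lt_le_trans LtLL.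
  have H := H1 s0 sLL.
  have lnge : ln L <= ln (L * (L * t) / s).
    rewrite ler_ln ?posrE ?divr_gt0// ler_pdivlMr// ler_pM2l//.
    exact: ltW.
  have {}H : 2 * w (L * (L * t)) <= phi s.
    rewrite -(ler_pM2l C1_gt0); apply: le_trans H.
    have h : 2 * C1 <= 1 + ln (L * (L * t) / s) by lra.
    by apply: le_trans (ler_wpM2r w0 h); rewrite mulrCA mulrA.
  rewrite ler_pdivrMr//; apply: le_trans H _.
  rewrite -mulrA ler_peMr ?(ltW (phi_gt0 s0))//.
  by rewrite mulrC ler_pdivlMr// mul1r (level_le PhiY Q_gt0)// ltW.
apply: (lower_ratio_ge Lt0 LtLL) => [s /andP[ts st]|].
  have s0 := lt_trans Lt0 ts; have ls0 := level_gt0 Q PhiY s0.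
  have H := minorant_le_phi s0 st.
  rewrite ler_pdivrMr// mulrAC ler_pdivlMr//.
  apply: (@le_trans _ _ (2 * (C1 * phi s) * level (L * t))).
    apply: ler_pM.
    - by apply: mulr_ge0; rewrite ?minorant_ge0.
    - exact: ltW.
    - by rewrite ler_pM2l.
    - by apply: (level_le PhiY Q_gt0) => //; exact: ltW.
  rewrite (_ : 2 * (C1 * _) * _ = phi s * (2 * C1 * level (L * t))); last by ring.
  by rewrite ler_pM2l ?phi_gt0//; exact: grow.
rewrite ler_pdivrMr// {1}/minorant (_ : 2 * _ = E (L * (L * t)) * (2 * level (L * (L * t))));
  last by ring.
apply: ler_wpM2l; first exact: lower_ratio_ge0.
apply: le_trans (le_trans (grow _ Lt0) (level_le PhiY Q_gt0 t0 tLt)).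
by apply: ler_wpM2r; [exact: ltW (level_gt0 Q PhiY LLt0)|rewrite ler_peMr].
Qed.

End minorant.

(** * Luxemburg norms and measures of balls *)

Section luxemburg_norm.
Context {R : realType} {disp : measure_display} {X : topMeasurableType disp}.
Variable mu : {measure set X -> \bar R}.
Variable Phi : R -> \bar R.
Hypothesis Phi_ge0 : forall u, 0 <= u -> (0 <= Phi u)%E.
Hypothesis Phi_le : forall u v, 0 <= u -> u <= v -> (Phi u <= Phi v)%E.

Lemma luxemburg_ge0 (g : X -> R) : (0 <= luxemburg mu Phi g)%E.
Proof. by apply: le_ereal_inf_tmp => _ [l [l0 _] <-]; rewrite lee_fin ltW. Qed.

Lemma luxemburg_le (g : X -> R) l : 0 < l ->
  (\int[mu]_x Phi (`|g x| / l)%R <= 1)%E -> (luxemburg mu Phi g <= l%:E)%E.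
Proof. by move=> l0 H; apply: ereal_inf_lbound; exists l. Qed.

Lemma luxemburg_modular (g : X -> R) l : (luxemburg mu Phi g < l%:E)%E ->
  (\int[mu]_x Phi (`|g x| / l)%R <= 1)%E.
Proof.
move=> /ereal_inf_lt[_ [l' [l0 H] <-]]; rewrite lte_fin => ll.
have lp : 0 < l by exact: lt_trans ll.
apply: le_trans H; apply: le_lower_integral => x _.
  by apply: Phi_ge0; rewrite divr_ge0// ltW.
apply: Phi_le; first by rewrite divr_ge0// ltW.
by rewrite ler_wpM2l// lef_pV2 ?posrE// ltW.
Qed.

Lemma luxemburg_mono (g h : X -> R) : (forall x, `|g x| <= `|h x|) ->
  (luxemburg mu Phi g <= luxemburg mu Phi h)%E.
Proof.
move=> gh; apply: le_ereal_inf => _ [l [l0 H] <-]; exists l => //; split => //.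
apply: le_trans H; apply: le_lower_integral => x _.
  by apply: Phi_ge0; rewrite divr_ge0// ltW.
by apply: Phi_le; [rewrite divr_ge0// ltW|rewrite ler_pM2r ?invr_gt0].
Qed.

Lemma integral_cut (f : X -> R) (B : set X) (G : R -> \bar R) (l : R) : G 0 = 0%E ->
  (\int[mu]_x G (`|Defs.cut f B x| / l)%R = \int[mu]_(x in B) G (`|f x| / l)%R)%E.
Proof.
move=> G0; rewrite [RHS]integral_mkcond; apply: eq_integral => x _.
rewrite patchE /Defs.cut indicE; case: ifPn => xB; first by rewrite mulr1.
by rewrite mulr0 normr0 mul0r.
Qed.

End luxemburg_norm.

Section ball_measures.
Context {R : realType} {disp : measure_display} {X : topMeasurableType disp}.
Variables (d : X -> X -> R) (mu : {measure set X -> \bar R}) (Q : R).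

Lemma Qspace_homogeneous : homogeneous_type d mu -> 0 < Q -> Q_homogeneous d mu Q ->
  exists K1 K3, Qspace d mu Q K1 K3.
Proof. by move=> [[K1 K11 qd] nb mB _] Q0 [K3 K31 H]; exists K1, K3. Qed.

Variables (K1 K3 : R).
Hypothesis HX : Qspace d mu Q K1 K3.
Local Notation B := (qball d).

Lemma fine_ball_gt0 x r : 0 < r -> 0 < fine (mu (B x r)).
Proof.
move=> r0; have K3_gt0 : 0 < K3 by exact: lt_le_trans (K3_ge1 HX).
have fm := qball_mu_fin HX x r0.
rewrite -lte_fin fineK//; apply: lt_le_trans (qball_mu_ge HX x r0).
by rewrite lte_fin mulr_gt0 ?invr_gt0 ?powR_gt0.
Qed.

Lemma ball_inve x r : 0 < r -> (mu (B x r))^-1%E = (fine (mu (B x r)))^-1%:E.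
Proof.
move=> r0; rewrite -[in LHS](fineK (qball_mu_fin HX x r0)) inver.
by rewrite gt_eqF// fine_ball_gt0.
Qed.

Lemma bmo_data_BMO b : X -> BMO d mu b -> exists A, bmo_data d mu Q b A.
Proof.
move=> x1 [[mb ib] hb].
have K3_gt0 : 0 < K3 by exact: lt_le_trans (K3_ge1 HX).
have I0 x r : (0 <= \int[mu]_(y in B x r) `|b y - mean mu b (B x r)|%:E)%E.
  by apply: integral_ge0 => y _; rewrite lee_fin.
have up x r : 0 < r -> ((fine (mu (B x r)))^-1%:E *
    \int[mu]_(y in B x r) `|b y - mean mu b (B x r)|%:E <= bmo_norm d mu b)%E.
  by move=> r0; apply: ereal_sup_ubound; exists (x, r) => //=; rewrite ball_inve.
have n0 : (0 <= bmo_norm d mu b)%E.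
  apply: le_trans (up x1 1 ltr01); apply: mule_ge0; last exact: I0.
  rewrite lee_fin invr_ge0; exact: ltW (fine_ball_gt0 _ ltr01).
have nf : bmo_norm d mu b = (fine (bmo_norm d mu b))%:E by rewrite fineK// ge0_fin_numE.
set n := fine _ in nf.
have n0' : 0 <= n by rewrite /n fine_ge0.
exists (n * K3 + 1); split => //; first by rewrite ltr_wpDl// mulr_ge0// ltW.
move=> x r r0; have := up x r r0; rewrite nf => h.
have m0 := fine_ball_gt0 x r0.
apply: (@le_trans _ _ (fine (mu (B x r)) * n)%:E).
  by rewrite EFinM -lee_pdivrMl.
rewrite lee_fin mulrDl mul1r; apply: ler_wpDr; first exact: powR_ge0.
rewrite mulrC -mulrA ler_wpM2l//.
by have := qball_mu_le HX x r0; rewrite -[X in (X <= _)%E](fineK (qball_mu_fin HX x r0)) lee_fin.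
Qed.

End ball_measures.

Lemma Delta2_young_fun (R : realType) (Phi : R -> \bar R) : youngY Phi -> Delta2 Phi ->
  exists2 k, 1 < k & forall u, 0 <= u -> young_fun Phi (2 * u) <= k * young_fun Phi u.
Proof.
move=> PhiY [k k1 H]; exists k => // u; rewrite le_eqVlt => /predU1P[<-|u0].
  by rewrite mulr0 young_fun0// mulr0.
have u2 : 0 <= 2 * u by rewrite mulr_ge0// ltW.
have := H u u0; rewrite (young_funE PhiY u2) (young_funE PhiY (ltW u0)).
by rewrite -EFinM lee_fin.
Qed.

Lemma youngY_ge0 (R : realType) (Phi : R -> \bar R) : youngY Phi ->
  forall u, 0 <= u -> (0 <= Phi u)%E.
Proof. by move=> PhiY u; exact: young_ge0 PhiY.1 _. Qed.

Lemma youngY_le (R : realType) (Phi : R -> \bar R) : youngY Phi ->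
  forall u v, 0 <= u -> u <= v -> (Phi u <= Phi v)%E.
Proof.
move=> PhiY u v u0 uv; have v0 := le_trans u0 uv.
by rewrite (young_funE PhiY u0) (young_funE PhiY v0) lee_fin young_fun_le.
Qed.

Section ball_levels.
Context {R : realType} {disp : measure_display} {X : topMeasurableType disp}.
Variables (d : X -> X -> R) (mu : {measure set X -> \bar R}) (Q K1 K3 : R).
Hypothesis HX : Qspace d mu Q K1 K3.
Local Notation B := (qball d).
Variable Phi : R -> \bar R.
Hypothesis PhiY : youngY Phi.
Local Notation cinv := (young_cinv Phi).
Local Notation level := (level Q Phi).

Let K3_gt0 : 0 < K3. Proof. exact: lt_le_trans (K3_ge1 HX). Qed.
Let K3_inv : 0 < K3^-1 <= 1.
Proof. by rewrite invr_gt0 K3_gt0 invf_le1// (K3_ge1 HX). Qed.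

Lemma cinv_ball_ge x r : 0 < r -> K3^-1 * level r <= cinv (fine (mu (B x r)))^-1.
Proof.
move=> r0; have m0 := fine_ball_gt0 HX x r0.
have rQ : 0 < r `^ (- Q) by rewrite powR_gt0.
apply: le_trans (young_cinv_scale PhiY K3_inv rQ) _.
apply: young_cinv_le => //; first by rewrite mulr_gt0// invr_gt0.
rewrite powRN -invfM lef_pV2 ?posrE ?mulr_gt0 ?powR_gt0//.
by have := qball_mu_le HX x r0; rewrite -[X in (X <= _)%E](fineK (qball_mu_fin HX x r0)) lee_fin.
Qed.

Lemma cinv_ball_le x r : 0 < r -> cinv (fine (mu (B x r)))^-1 <= K3 * level r.
Proof.
move=> r0; have m0 := fine_ball_gt0 HX x r0.
have rQ : 0 < r `^ (- Q) by rewrite powR_gt0.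
have KQ : 0 < K3 * r `^ (- Q) by rewrite mulr_gt0.
apply: (@le_trans _ _ (cinv (K3 * r `^ (- Q)))).
  apply: young_cinv_le; rewrite ?invr_gt0//.
  rewrite powRN -[K3]invrK -invfM lef_pV2 ?posrE ?mulr_gt0 ?powR_gt0 ?invr_gt0//.
  by have := qball_mu_ge HX x r0; rewrite -[X in (_ <= X)%E](fineK (qball_mu_fin HX x r0)) lee_fin.
have := young_cinv_scale PhiY K3_inv KQ.
by rewrite mulrA mulVf ?gt_eqF// mul1r ler_pdivrMl.
Qed.

Lemma young_inv_ball x r : 0 < r ->
  young_inv Phi (mu (B x r))^-1%E = (cinv (fine (mu (B x r)))^-1)%:E.
Proof.
move=> r0; rewrite (ball_inve HX)//.
have m0 : 0 < (fine (mu (B x r)))^-1 by rewrite invr_gt0 (fine_ball_gt0 HX).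
by have [] := young_inv_spec PhiY m0.
Qed.

End ball_levels.

(** * From a Morrey norm to the data of the modular estimate *)

Section sufficiency.
Context {R : realType} {disp : measure_display} {X : topMeasurableType disp}.
Variables (d : X -> X -> R) (mu : {measure set X -> \bar R}) (Q K1 K3 : R).
Hypothesis HX : Qspace d mu Q K1 K3.
Hypothesis Cc_dense : Cc_dense_L1 mu.
Local Notation B := (qball d).
Local Notation cut := Defs.cut.
Variable Phi : R -> \bar R.
Hypothesis PhiY : youngY Phi.
Local Notation F := (young_fun Phi).
Local Notation cinv := (young_cinv Phi).
Local Notation level := (level Q Phi).
Variable phi : R -> R.
Hypothesis phi_gt0 : forall t, 0 < t -> 0 < phi t.
Local Notation ratio := (young_ratio Phi Q phi).
Local Notation E := (lower_ratio Phi Q phi).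
Local Notation w := (minorant Phi Q phi).

Let K3_gt0 : 0 < K3. Proof. exact: lt_le_trans (K3_ge1 HX). Qed.
Let mB x r : measurable (B x r). Proof. exact: (measurable_qball HX). Qed.

Lemma orlicz_loc_measurable (x0 : X) f : orlicz_loc d mu Phi f -> measurable_fun setT f.
Proof.
move=> H; rewrite -(qball_bigcup d x0); apply/measurable_fun_bigcup => // i.
have i0 : (0 : R) < i.+1%:R by rewrite ltr0n.
have [[mc _] _] := H x0 i.+1%:R i0.
apply: (@eq_measurable_fun _ _ _ _ _ (cut f (B x0 i.+1%:R))); last exact: measurable_funTS.
by move=> x xB; rewrite /Defs.cut indicE xB mulr1.
Qed.

Lemma morrey_luxemburg f N x s : (morrey_norm d mu Phi phi f < N%:E)%E -> 0 < s ->
  (luxemburg mu Phi (cut f (B x s)) <= (K3 * N * (phi s / level s))%:E)%E.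
Proof.
move=> nN s0.
have cb0 : 0 < cinv (fine (mu (B x s)))^-1.
  by apply: young_cinv_gt0 => //; rewrite invr_gt0 (fine_ball_gt0 HX).
have cge := cinv_ball_ge HX PhiY x s0.
have l0 : 0 < level s by exact: level_gt0.
have h : ((phi s)^-1%:E * (cinv (fine (mu (B x s)))^-1)%:E * luxemburg mu Phi (cut f (B x s))
  <= N%:E)%E.
  apply: le_trans (ltW nN); apply: ereal_sup_ubound; exists (x, s) => //=.
  by rewrite (young_inv_ball HX PhiY x s0).
have N0 : 0 <= N.
  rewrite -lee_fin; apply: le_trans h; apply: mule_ge0; last exact: luxemburg_ge0.
  by rewrite -EFinM lee_fin mulr_ge0// ?invr_ge0; apply: ltW; rewrite ?phi_gt0.
move: h; rewrite -EFinM -lee_pdivlMl; last by rewrite mulr_gt0// invr_gt0 phi_gt0.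
move=> h; apply: (le_trans h); rewrite -EFinM lee_fin.
rewrite (_ : K3 * N * _ = (K3 * (phi s / level s)) * N); last by ring.
apply: ler_wpM2r => //; rewrite invfM invrK [leRHS]mulrCA.
rewrite ler_pM2l ?phi_gt0// -[K3]invrK -invfM lef_pV2 ?posrE//.
by rewrite mulr_gt0// invr_gt0.
Qed.

Lemma lower_ratio_ge_all t c : 0 < t -> (forall s, t < s -> c <= phi s / level s) -> c <= E t.
Proof.
move=> t0 H; rewrite -lee_fin -(lower_ratioE Q PhiY phi_gt0 t0); apply/ess_inf_aboveP.
rewrite (_ : _ `&` _ = set0); first exact: negligible_set0.
apply/seteqP; split => // s [gs]; rewrite /= in_itv/= andbT => ts; apply: gs.
by rewrite (young_ratioE Q phi PhiY (lt_trans t0 ts)) lee_fin H.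
Qed.

(** The norm on the ball of radius [t] is at most the norm on each larger concentric ball, so the
    Morrey bound may be minimised over all [s > t]; this is how the essential infimum enters.
    Strictness in [l] is needed because the Luxemburg norm is an infimum. *)
Lemma morrey_modular f N x t l : (morrey_norm d mu Phi phi f < N%:E)%E -> 0 < N -> 0 < t ->
  K3 * N * E t < l -> (\int[mu]_(y in B x t) Phi (`|f y| / l)%R <= 1)%E.
Proof.
move=> nN N0 t0 El; have Phi0 := young0 PhiY.1.
rewrite -(integral_cut mu f (B x t) l Phi0).
apply: (luxemburg_modular (youngY_ge0 PhiY) (youngY_le PhiY)).
have KN : 0 < K3 * N by rewrite mulr_gt0.
have up s : t < s -> (luxemburg mu Phi (cut f (B x t)) <= (K3 * N * (phi s / level s))%:E)%E.
  move=> ts; apply: le_trans (morrey_luxemburg x nN (lt_trans t0 ts)).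
  apply: (luxemburg_mono mu (youngY_ge0 PhiY) (youngY_le PhiY)) => y.
  rewrite /Defs.cut !normrM ler_wpM2l// !ger0_norm ?indicE//.
  have [yt|yt] := boolP (y \in B x t); last by [].
  by rewrite (_ : y \in B x s)// inE; apply: lt_trans ts; move/set_mem: yt.
have L0 := luxemburg_ge0 mu Phi (cut f (B x t)).
have t2 : t < t + 1 by rewrite ltrDl.
have Lfin : luxemburg mu Phi (cut f (B x t)) \is a fin_num.
  by rewrite ge0_fin_numE//; apply: le_lt_trans (up _ t2) _; rewrite ltry.
rewrite -(fineK Lfin) in up *; rewrite lte_fin; apply: le_lt_trans El.
rewrite -ler_pdivrMl//; apply: lower_ratio_ge_all => // s ts.
by rewrite ler_pdivrMl// -lee_fin; exact: up.
Qed.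

Variables (alpha beta : R).
Hypothesis alpha_bounds : 0 < alpha < Q.
Hypothesis beta_bounds : 0 < beta < 1.
Let sig := alpha / (1 - beta).
Let sig_gt0 : 0 < sig.
Proof. by case/andP: alpha_bounds beta_bounds => a0 _ /andP[b0 b1];
  rewrite divr_gt0// subr_gt0. Qed.

Lemma star_decay Cs : 0 < Cs -> (forall t, 0 < t -> t `^ alpha * phi t <= Cs * phi t `^ beta) ->
  forall t, 0 < t -> phi t <= Cs `^ (1 - beta)^-1 * t `^ (- sig).
Proof.
move=> Cs0 H t t0; have /andP[b0 b1] := beta_bounds; have p0 := phi_gt0 t0.
have b1' : 0 < 1 - beta by rewrite subr_gt0.
have h : phi t `^ (1 - beta) <= Cs * t `^ (- alpha).
  have pb : 0 < phi t `^ beta by rewrite powR_gt0.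
  have ta : 0 < t `^ alpha by rewrite powR_gt0.
  rewrite powRN ler_pdivlMr// -(ler_pM2l pb) mulrA -powRD; last first.
    by apply/implyP => _; rewrite gt_eqF.
  by rewrite addrC subrK powRr1 ?(ltW p0)// mulrC [leRHS]mulrC; exact: H.
have bn0 : 1 - beta != 0 by rewrite gt_eqF.
rewrite -[leLHS](_ : (phi t `^ (1 - beta)) `^ (1 - beta)^-1 = _); last first.
  by rewrite -powRrM mulfV// powRr1// ltW.
rewrite (_ : - sig = (- alpha) * (1 - beta)^-1); last by rewrite mulNr.
rewrite powRrM -powRM ?powR_ge0 ?(ltW Cs0)//.
by apply: ge0_ler_powR; rewrite ?nnegrE ?powR_ge0 ?mulr_ge0 ?invr_ge0 ?powR_ge0 ?(ltW Cs0)
  ?(ltW b1').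
Qed.

Lemma core_uniform b A (x1 : X) K C0 : bmo_data d mu Q b A -> Delta2 Phi -> nabla2 Phi ->
  2 <= K -> 2 * K1 <= K -> 1 <= C0 ->
  exists2 CT, 0 < CT & forall N f D, 0 < N -> morrey_data d mu Q Phi K C0 f D ->
    (forall t, 0 < t -> D t <= C0 * N * t `^ (- sig)) ->
    mu.-negligible [set x | (\int[mu]_y (`|b x - b y| / d x y `^ (Q - alpha)
      * `|f y|)%:E)%E = +oo%E] /\
    forall x0 r (S : X -> R), 0 < r ->
      (forall x, B x0 r x -> (`|S x|%:E <= \int[mu]_y (`|b x - b y| / d x y `^ (Q - alpha)
        * `|f y|)%:E)%E) ->
      (\int[mu]_(x in B x0 r) (F ((`|S x| / (CT * N `^ (1 - beta) *
        (D r / level r) `^ beta)) `^ beta^-1))%:E <= 1)%E.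
Proof.
move=> Hb D2 N2 K2 KK C01.
have [k k1 HD] := Delta2_young_fun PhiY D2.
have [sigma sigma1 [C C1 HN]] := nabla2_power PhiY N2.
have [d0 d00 Hjn] := john_nirenberg HX Cc_dense Hb.
have A0 := bmo_gt0 Hb.
pose s := (1 + sigma) / 2.
have s1 : 1 < s < sigma by apply/andP; split; rewrite /s; lra.
have /andP[s10 s11] := s1.
have K0 : 0 < K by apply: lt_le_trans K2.
have ln2 : 0 < ln 2 :> R by rewrite ln_gt0// ltr1n.
have lnk : 0 < ln (2 * k) by rewrite ln_gt0//; lra.
pose e1 := d0 / (s / (s - 1)).
pose e2 := d0 * ln 2 / (ln (2 * k) * 2).
pose e3 := ln 2 / (K3 * (A * K `^ Q)).
have ss : 0 < s / (s - 1) by rewrite divr_gt0; lra.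
have e10 : 0 < e1 by rewrite divr_gt0.
have e20 : 0 < e2 by rewrite divr_gt0// mulr_gt0.
have KA : 0 < K3 * (A * K `^ Q) by rewrite !mulr_gt0// powR_gt0.
have e30 : 0 < e3 by rewrite divr_gt0.
(* The three bounds serve Young's inequality against the John-Nirenberg exponent, the victory of
   exponential decay over the doubling of Phi, and the drift of the means of [b] under dilation by
   [K]. *)
pose delta := Num.min e1 (Num.min e2 e3).
have del0 : 0 < delta by rewrite !lt_min e10 e20.
have h1 : delta * (s / (s - 1)) <= d0 by rewrite -ler_pdivlMr// /delta ge_min lexx.
have h2 : ln (2 * k) * (2 * delta) <= d0 * ln 2.
  by rewrite mulrA mulrC -ler_pdivlMr ?mulr_gt0// /delta !ge_min lexx orbT.
have h3 : delta * (K3 * (A * K `^ Q)) <= ln 2.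
  by rewrite -ler_pdivlMr// /delta !ge_min lexx !orbT.
have J0 : 0 <= 7 * K3 by rewrite mulr_ge0// ltW.
exact: (core_estimate HX Hb d00 J0 Hjn PhiY (ltW k1) HD C1 HN s1 K2 KK C01 del0 h1 h2 h3
  alpha_bounds beta_bounds x1).
Qed.

End sufficiency.

Section operator.
Context {R : realType} {disp : measure_display} {X : topMeasurableType disp}.
Variables (d : X -> X -> R) (mu : {measure set X -> \bar R}) (Q K1 K3 : R).
Hypothesis HX : Qspace d mu Q K1 K3.
Hypothesis Cc_dense : Cc_dense_L1 mu.
Local Notation B := (qball d).
Local Notation cut := Defs.cut.
Variable Phi : R -> \bar R.
Hypothesis PhiY : youngY Phi.
Hypotheses (D2 : Delta2 Phi) (N2 : nabla2 Phi).
Local Notation F := (young_fun Phi).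
Local Notation cinv := (young_cinv Phi).
Local Notation level := (level Q Phi).
Variable phi : R -> R.
Hypothesis phi_gt0 : forall t, 0 < t -> 0 < phi t.
Local Notation w := (minorant Phi Q phi).
Local Notation E := (lower_ratio Phi Q phi).
Variables (alpha beta : R).
Hypothesis alpha_bounds : 0 < alpha < Q.
Hypothesis beta_bounds : 0 < beta < 1.
Variables (b : X -> R) (A : R).
Hypothesis Hb : bmo_data d mu Q b A.
Variable C1 : R.
Hypothesis C1_ge1 : 1 <= C1.
Hypothesis H1 : forall r t, 0 < r -> r < t -> (1 + ln (t / r)) * w t <= C1 * phi r.
Variable Cs : R.
Hypothesis Cs_gt0 : 0 < Cs.
Hypothesis star : forall t, 0 < t -> t `^ alpha * phi t <= Cs * phi t `^ beta.
Variable x1 : X.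

Let K3_gt0 : 0 < K3. Proof. exact: lt_le_trans (K3_ge1 HX). Qed.
Let C1_gt0 : 0 < C1. Proof. exact: lt_le_trans C1_ge1. Qed.
Let b0 : 0 < beta. Proof. by case/andP: beta_bounds. Qed.
Let mB x r : measurable (B x r). Proof. exact: (measurable_qball HX). Qed.
Local Notation sig := (alpha / (1 - beta)).
Let sig_gt0 : 0 < sig.
Proof. by case/andP: alpha_bounds beta_bounds => a0 _ /andP[? b1]; rewrite divr_gt0// subr_gt0. Qed.
Local Notation T f x :=
  (\int[mu]_y (`|b x - b y| / d x y `^ (Q - alpha) * `|f y|)%:E)%E.

(* The summand with [eps] keeps the majorant positive where [w] vanishes. *)
Let majorant (N eps t : R) : R := N * (K3 * w t + eps * t `^ (- sig)).
Let C7 := Cs `^ (1 - beta)^-1.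
Let C6 := 2 `^ Q * C1.
Let C0 := C1 + K3 * (C6 * C7) + 1.
Let C8 := K3 * C6 + 1.

Let C6_gt0 : 0 < C6. Proof. by apply: mulr_gt0 => //; rewrite powR_gt0. Qed.
Let C7_gt0 : 0 < C7. Proof. by rewrite powR_gt0. Qed.
Let C8_gt0 : 0 < C8. Proof. by apply: ltr_wpDl; rewrite ?ltr01// ltW// mulr_gt0. Qed.

(** The lower bound on [K] makes the added power halve along with [w]. The constant [C0] is uniform
    for [eps <= 1], so [eps] may later depend on the ball. *)
Lemma majorant_data K f N eps : 2 `^ sig^-1 <= K -> 0 < K ->
  (forall t, 0 < t -> w (K * t) <= w t / 2) ->
  measurable_fun setT f -> (morrey_norm d mu Phi phi f < N%:E)%E -> 0 < N -> 0 < eps <= 1 ->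
  morrey_data d mu Q Phi K C0 f (majorant N eps) /\
  forall t, 0 < t -> majorant N eps t <= C0 * N * t `^ (- sig).
Proof.
move=> K2 K0 wK mf nN N0 /andP[e0 e1].
have KC : 0 <= K3 * (C6 * C7) by apply: ltW; rewrite !mulr_gt0.
have w0 t : 0 < t -> 0 <= w t by move=> t0; exact: minorant_ge0.
have p0 (t : R) : 0 < t -> 0 < t `^ (- sig) by move=> t0; rewrite powR_gt0.
split; last first.
  move=> t t0; rewrite /majorant mulrC mulrAC ler_pM2r//.
  have wt : w t <= C6 * C7 * t `^ (- sig).
    have h := minorant_le_phi_diag PhiY (Q_gt0 HX) phi_gt0 H1 t0; rewrite -/C6 in h.
    apply: (le_trans h); rewrite -mulrA ler_pM2l//.
    exact: (star_decay phi_gt0 beta_bounds Cs_gt0 star t0).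
  apply: (@le_trans _ _ (K3 * (C6 * C7) * t `^ (- sig) + 1 * t `^ (- sig))).
    by apply: lerD; [rewrite -mulrA ler_pM2l|rewrite ler_pM2r ?p0].
  rewrite -mulrDl ler_pM2r ?p0// /C0 -addrA lerDr; exact: ltW.
split => //.
- move=> t t0; apply: mulr_gt0 => //; apply: ltr_wpDl; last by rewrite mulr_gt0 ?p0.
  by rewrite mulr_ge0 ?w0// ltW.
- move=> t t0; rewrite /majorant -mulrA ler_pM2l// mulrDl; apply: lerD.
    by rewrite -mulrA ler_pM2l//; exact: wK.
  rewrite -mulrA ler_pM2l// powRM ?(ltW K0) ?(ltW t0)// mulrC ler_pM2l ?p0//.
  rewrite powRN lef_pV2 ?posrE ?powR_gt0//.
  rewrite -[leLHS](_ : (2 `^ sig^-1) `^ sig = 2); last first.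
    by rewrite -powRrM mulVf ?gt_eqF// powRr1.
  by apply: ge0_ler_powR; rewrite ?nnegrE ?powR_ge0 ?(ltW K0) ?(ltW sig_gt0).
- move=> t t' t0 tt; have t0' := lt_le_trans t0 tt.
  rewrite /majorant [leRHS]mulrCA ler_pM2l// mulrDr; apply: lerD.
    rewrite [leRHS]mulrCA ler_pM2l//.
    apply: le_trans (minorant_almost_decreasing PhiY (Q_gt0 HX) phi_gt0 C1_ge1 H1 t0 tt) _.
    by apply: ler_wpM2r; [exact: w0|rewrite /C0 -addrA lerDl addr_ge0].
  rewrite [leRHS]mulrCA ler_pM2l//; apply: (@le_trans _ _ (t `^ (- sig))).
    rewrite !powRN lef_pV2 ?posrE ?powR_gt0//.
    by apply: ge0_ler_powR; rewrite ?nnegrE ?(ltW t0) ?(ltW t0') ?(ltW sig_gt0).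
  by rewrite ler_peMl ?(ltW (p0 _ t0))// /C0 lerDr addr_ge0// ltW.
- move=> x t t0; have l0 : 0 < level t by exact: level_gt0.
  have M0 : 0 < majorant N eps t.
    apply: mulr_gt0 => //; apply: ltr_wpDl; last by rewrite mulr_gt0 ?p0.
    by rewrite mulr_ge0 ?w0// ltW.
  have El : K3 * N * E t < majorant N eps t / level t.
    rewrite ltr_pdivlMr// /majorant /minorant.
    rewrite (_ : K3 * N * E t * level t = N * (K3 * (level t * E t))); last by ring.
    by rewrite ltr_pM2l// ltrDl mulr_gt0 ?p0.
  have := morrey_modular HX PhiY phi_gt0 x nN N0 t0 El.
  rewrite (eq_integral (fun y => (F (`|f y| * (level t / majorant N eps t)))%:E))// => y _.
  rewrite young_funE//; first by rewrite invf_div.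
  by apply: divr_ge0 => //; apply: divr_ge0; exact: ltW.
Qed.

(** The exponents [1 - beta] and [beta] of [N] add up to one, so the normalising level is linear in
    [N], as a norm inequality requires. *)
Lemma operator_modular : exists2 CC, 0 < CC & forall f N, measurable_fun setT f ->
  (morrey_norm d mu Phi phi f < N%:E)%E -> 0 < N ->
  mu.-negligible [set x | T f x = +oo%E] /\
  forall x0 r (S : X -> R), 0 < r -> (forall x, B x0 r x -> (`|S x|%:E <= T f x)%E) ->
    (\int[mu]_(x in B x0 r) (F ((`|S x| / (CC * N * (phi r / level r) `^ beta))
      `^ beta^-1))%:E <= 1)%E.
Proof.
have [k k1 HD] := Delta2_young_fun PhiY D2.
have [K [K2 KM wK]] := minorant_half PhiY (Q_gt0 HX) k1 HD phi_gt0 C1_ge1 H1 (Num.max (2 * K1)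
  (2 `^ sig^-1)).
move: KM; rewrite ge_max => /andP[KK Ks].
have K0 : 0 < K by apply: lt_le_trans K2.
have C01 : 1 <= C0 by rewrite /C0 lerDr addr_ge0 ?(ltW C1_gt0)// ltW// !mulr_gt0.
have [CT CT0 HT] := core_uniform HX Cc_dense PhiY alpha_bounds beta_bounds x1 Hb D2 N2 K2 KK C01.
exists (CT * C8 `^ beta); first by rewrite mulr_gt0// powR_gt0.
move=> f N mf nN N0; split.
  have e1 : (0 : R) < (1 : R) <= (1 : R) by rewrite ltr01 lexx.
  have [h1 h2] := majorant_data Ks K0 wK mf nN N0 e1.
  by have [] := HT N f _ N0 h1 h2.
move=> x0 r S r0 ST.
(* Chosen for this particular radius, so that the added power is at most [phi r] there. *)
pose eps := Num.min 1 (phi r * r `^ sig).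
have e1 : 0 < eps <= 1.
  by rewrite /eps lt_min ge_min ltr01 lexx /= mulr_gt0 ?phi_gt0 ?powR_gt0.
have [h1 h2] := majorant_data Ks K0 wK mf nN N0 e1.
have [_ /(_ x0 r S r0 ST)] := HT N f _ N0 h1 h2.
have l0 : 0 < level r by exact: level_gt0.
have D0 := md_gt0 h1 r0.
have DN : majorant N eps r <= N * (C8 * phi r).
  rewrite /majorant ler_pM2l// /C8 mulrDl mul1r; apply: lerD.
    rewrite -mulrA ler_pM2l//.
    exact: (minorant_le_phi_diag PhiY (Q_gt0 HX) phi_gt0 H1 r0).
  by rewrite powRN ler_pdivrMr ?powR_gt0// /eps ge_min lexx orbT.
apply: le_trans; apply: le_integral_EFin => x _.
  by apply: young_fun_ge0 => //; exact: powR_ge0.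
have p0 := phi_gt0 r0.
have rhs : 0 < CT * N `^ (1 - beta) * (majorant N eps r / level r) `^ beta.
  by rewrite !mulr_gt0 ?powR_gt0 ?divr_gt0.
have lhs : 0 < CT * C8 `^ beta * N * (phi r / level r) `^ beta.
  by rewrite !mulr_gt0 ?powR_gt0 ?divr_gt0.
apply: (young_fun_le PhiY); first exact: powR_ge0.
apply: ge0_ler_powR; rewrite ?nnegrE ?invr_ge0 ?(ltW b0)//.
- by apply: divr_ge0 => //; exact: ltW.
- by apply: divr_ge0 => //; exact: ltW.
apply: ler_wpM2l => //; rewrite lef_pV2 ?posrE//.
rewrite -!mulrA ler_pM2l//.
apply: (@le_trans _ _ (N `^ (1 - beta) * (N * (C8 * (phi r / level r))) `^ beta)).
  rewrite ler_pM2l ?powR_gt0// (mulrA N) -/(majorant N eps r); apply: ge0_ler_powR.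
  - exact: ltW.
  - by rewrite nnegrE; apply: divr_ge0; exact: ltW.
  - by rewrite nnegrE; apply: ltW; rewrite !mulr_gt0 ?invr_gt0.
  by rewrite (mulrA C8) (mulrA N (C8 * _)) ler_pM2r ?invr_gt0.
have q0 : 0 <= phi r / level r by apply: divr_ge0; exact: ltW.
have Cq0 : 0 <= C8 * (phi r / level r) by apply: mulr_ge0 => //; exact: ltW.
rewrite (powRM beta (ltW N0) Cq0) (powRM beta (ltW C8_gt0) q0).
rewrite mulrA -powRD; last by apply/implyP => _; rewrite gt_eqF.
by rewrite subrK powRr1 ?(ltW N0)// mulrCA.
Qed.

End operator.

(** * From the modular estimate to boundedness of an operator *)

Section boundedness.
Context {R : realType} {disp : measure_display} {X : topMeasurableType disp}.
Variables (d : X -> X -> R) (mu : {measure set X -> \bar R}) (Q K1 K3 : R).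
Hypothesis HX : Qspace d mu Q K1 K3.
Local Notation B := (qball d).
Local Notation cut := Defs.cut.
Variable Phi : R -> \bar R.
Hypothesis PhiY : youngY Phi.
Local Notation F := (young_fun Phi).
Local Notation cinv := (young_cinv Phi).
Local Notation level := (level Q Phi).
Variable phi : R -> R.
Hypothesis phi_gt0 : forall t, 0 < t -> 0 < phi t.
Variable beta : R.
Hypothesis beta_bounds : 0 < beta < 1.
Local Notation Psi := (fun t : R => Phi (t `^ beta^-1)).
Local Notation eta := (fun t : R => phi t `^ beta).

Let K3_gt0 : 0 < K3. Proof. exact: lt_le_trans (K3_ge1 HX). Qed.
Let b0 : 0 < beta. Proof. by case/andP: beta_bounds. Qed.
Let mB x r : measurable (B x r). Proof. exact: (measurable_qball HX). Qed.

Lemma young_power_ge0 u : 0 <= u -> (0 <= Psi u)%E.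
Proof. by move=> u0; apply: young_ge0 PhiY.1 _ _; exact: powR_ge0. Qed.

(** The factor 2 provides an argument strictly above the inverse of Phi, where Phi exceeds the given
    value. *)
Lemma young_inv_power x r : 0 < r ->
  (young_inv Psi (mu (B x r))^-1 <= ((2 * K3 * level r) `^ beta)%:E)%E.
Proof.
move=> r0; have l0 : 0 < level r by exact: level_gt0.
have m0 : 0 < (fine (mu (B x r)))^-1 by rewrite invr_gt0 (fine_ball_gt0 HX).
have [_ c0 h _] := young_inv_spec PhiY m0.
rewrite (ball_inve HX)//; apply: ereal_inf_lbound.
exists ((2 * K3 * level r) `^ beta) => //; split; first exact: powR_ge0.
have u0 : 0 <= 2 * K3 * level r by rewrite mulr_ge0 ?mulr_ge0// ltW.
rewrite -powRrM mulfV ?gt_eqF// powRr1// (young_funE PhiY u0) lte_fin; apply: h.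
apply: (@le_lt_trans _ _ (K3 * level r)); first by apply: (cinv_ball_le HX PhiY).
by rewrite -mulrA ltr_pMl ?mulr_gt0// ltr1n.
Qed.

Variables (b : X -> R) (Qa : R).
Hypothesis mb : measurable_fun setT b.
Local Notation T f x := (\int[mu]_y (`|b x - b y| / d x y `^ Qa * `|f y|)%:E)%E.
Variable CC : R.
Hypothesis CC_gt0 : 0 < CC.
Hypothesis HM : forall f N, measurable_fun setT f ->
  (morrey_norm d mu Phi phi f < N%:E)%E -> 0 < N ->
  mu.-negligible [set x | T f x = +oo%E] /\
  forall x0 r (S : X -> R), 0 < r -> (forall x, B x0 r x -> (`|S x|%:E <= T f x)%E) ->
    (\int[mu]_(x in B x0 r) (F ((`|S x| / (CC * N * (phi r / level r) `^ beta))
      `^ beta^-1))%:E <= 1)%E.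
Variable kk : X -> X -> R.
Hypothesis kkE : forall x y, `|kk x y| = `|b x - b y| / d x y `^ Qa.
Hypothesis mkk : forall x, measurable_fun setT (kk x).
Variable x1 : X.

Lemma kernel_norm f x : (\int[mu]_y `|(kk x y * f y)%:E| = T f x)%E.
Proof. by apply: eq_integral => y _; rewrite /= normrM kkE. Qed.

Lemma measurable_kernel f x : measurable_fun setT f ->
  measurable_fun setT (fun y => (kk x y * f y)%:E).
Proof. by move=> mf; apply/measurable_EFinP; exact: measurable_funM. Qed.

Lemma operator_le f x : measurable_fun setT f ->
  (`|integral_operator mu kk f x|%:E <= T f x)%E.
Proof.
move=> mf; apply: (@le_trans _ _ (`|\int[mu]_y (kk x y * f y)%:E|%E)).
  (* An infinite integral is sent to 0 by [fine], which keeps the inequality true. *)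
  rewrite /integral_operator /Rintegral.
  by case: (integral _ _ _) => [u| |]//=; rewrite ?normr0 ?leey.
by rewrite -kernel_norm; apply: le_abse_integral => //; exact: measurable_kernel.
Qed.

Lemma operator_integrable f N : measurable_fun setT f ->
  (morrey_norm d mu Phi phi f < N%:E)%E -> 0 < N ->
  {ae mu, forall x, mu.-integrable setT (fun y => (kk x y * f y)%:E)}.
Proof.
move=> mf nN N0; have [h _] := HM mf nN N0.
apply: negligibleS h => x /= nI; apply/eqP; rewrite -leye_eq leNgt; apply/negP => Tfin.
apply: nI; apply/integrableP; split; first exact: measurable_kernel.
by rewrite kernel_norm.
Qed.

Definition operator_level N r := CC * N * (phi r / level r) `^ beta.

Lemma operator_level_gt0 N r : 0 < N -> 0 < r -> 0 < operator_level N r.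
Proof.
move=> N0 r0; rewrite /operator_level; apply: mulr_gt0; first exact: mulr_gt0.
by rewrite powR_gt0// divr_gt0 ?phi_gt0 ?level_gt0.
Qed.

Lemma operator_cut_modular f N x0 r : measurable_fun setT f ->
  (morrey_norm d mu Phi phi f < N%:E)%E -> 0 < N -> 0 < r ->
  (\int[mu]_x Psi (`|cut (integral_operator mu kk f) (B x0 r) x| / operator_level N r)%R <= 1)%E.
Proof.
move=> mf nN N0 r0; have [_ h] := HM mf nN N0.
have Psi0 : Psi 0 = 0%E by rewrite powR0 ?invr_neq0 ?gt_eqF// (young0 PhiY.1).
apply: (@le_trans _ _ (\int[mu]_(x in B x0 r)
    Psi (`|integral_operator mu kk f x| / operator_level N r)%R)%E).
  by rewrite le_eqVlt; apply/orP; left; apply/eqP; exact: (@integral_cut _ _ _ mu _ _ Psi).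
apply: le_trans (h x0 r (integral_operator mu kk f) r0 _); last first.
  by move=> x _; exact: operator_le.
apply: le_lower_integral => x _; first by apply: young_power_ge0;
  rewrite divr_ge0// ltW// operator_level_gt0.
by rewrite young_funE// powR_ge0.
Qed.

Lemma operator_norm_lt f N : measurable_fun setT f ->
  (morrey_norm d mu Phi phi f < N%:E)%E -> 0 < N ->
  (morrey_norm d mu Psi eta (integral_operator mu kk f) <=
    ((2 * K3) `^ beta * CC * N)%:E)%E.
Proof.
move=> mf nN N0; apply: ge_ereal_sup => _ [[x0 r] /= r0 <-].
have l0 : 0 < level r by exact: level_gt0.
have p0 := phi_gt0 r0.
have pb : 0 < phi r `^ beta by rewrite powR_gt0.
have lux := luxemburg_le (operator_level_gt0 N0 r0) (operator_cut_modular x0 mf nN N0 r0).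
have ps0 : (0 <= young_inv Psi (mu (B x0 r))^-1)%E.
  by apply: le_ereal_inf_tmp => _ [u [u0 _] <-]; rewrite lee_fin.
apply: (@le_trans _ _ ((phi r `^ beta)^-1%:E * ((2 * K3 * level r)
  `^ beta)%:E * (operator_level N r)%:E)%E).
  apply: lee_pmul => //.
  - by apply: mule_ge0 => //; rewrite lee_fin invr_ge0 ltW.
  - exact: luxemburg_ge0.
  by apply: lee_wpmul2l; [rewrite lee_fin invr_ge0 ltW|exact: young_inv_power].
rewrite -!EFinM lee_fin /operator_level le_eqVlt; apply/orP; left; apply/eqP.
have K30 : 0 <= 2 * K3 by rewrite mulr_ge0// ltW.
rewrite (powRM beta K30 (ltW l0)) (powRM beta (ltW p0)) ?invr_ge0 ?(ltW l0)// powR_inv ?(ltW l0)//.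
by field; rewrite !gt_eqF ?powR_gt0.
Qed.

(** Gives local integrability from a finite modular: for [v > 1] the power is at least [v], and
    convexity makes Phi grow at least linearly from 1 on. *)
Lemma young_power_linear v : 0 <= v -> v <= 1 + F (v `^ beta^-1) / F 1.
Proof.
move=> v0; have F1 : 0 < F 1 by apply: young_fun_gt0.
have [v1|v1] := lerP v 1.
  by rewrite ler_wpDr// divr_ge0 ?(ltW F1)// young_fun_ge0// powR_ge0.
have vv : v <= v `^ beta^-1.
  rewrite -[leLHS](powRr1 v0); apply: ler_powR; first exact: ltW.
  by case/andP: beta_bounds => _ /ltW; rewrite -invf_ge1.
have v00 : 0 < v by exact: lt_trans v1.
have iv : 0 <= v^-1 <= 1 by rewrite invr_ge0 v0 invf_le1 ?(ltW v1).
have h1 := young_fun_scale PhiY iv v0; rewrite mulVf ?gt_eqF// in h1.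
have h2 := young_fun_le PhiY v0 vv.
apply: (@le_trans _ _ (F (v `^ beta^-1) / F 1)); last by rewrite lerDr.
rewrite ler_pdivlMr//; apply: le_trans h2.
by rewrite -ler_pdivlMl.
Qed.

Lemma operator_orlicz f N : measurable_fun setT f ->
  (morrey_norm d mu Phi phi f < N%:E)%E -> 0 < N ->
  measurable_fun setT (integral_operator mu kk f) ->
  orlicz_loc d mu Psi (integral_operator mu kk f).
Proof.
move=> mf nN N0; set S := integral_operator mu kk f => mS x0 r r0.
have l0 := operator_level_gt0 N0 r0.
have mcut : measurable_fun setT (cut S (B x0 r)).
  by apply: measurable_funM => //; exact: measurable_indic.
have mod := operator_cut_modular x0 mf nN N0 r0; rewrite -/S in mod.
split; last first.
  exists (operator_level N r)^-1; first by rewrite invr_gt0.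
  apply: (@le_lt_trans _ _ 1%E); last by rewrite ltry.
  by under eq_integral do rewrite mulrC.
split => // x t t0; apply/integrableP; split.
  by apply/measurable_EFinP; exact: measurable_funTS.
have F1 : 0 < F 1 by apply: young_fun_gt0.
pose g y := `|cut S (B x0 r) y| / operator_level N r.
have g0 y : 0 <= g y by rewrite divr_ge0// ltW.
have mg : measurable_fun setT g.
  by apply: measurable_funM => //; exact: measurableT_comp.
have mFg : measurable_fun setT (fun y => F (g y `^ beta^-1)).
  apply: measurable_young_fun => // [|y]; last exact: powR_ge0.
  exact: (measurableT_comp (measurable_powR _) mg).
have FG0 y : 0 <= F (g y `^ beta^-1) / F 1.
  by rewrite divr_ge0 ?(ltW F1)// young_fun_ge0// powR_ge0.
apply: (@le_lt_trans _ _ (\int[mu]_(y in B x t) (operator_level N r * (1 + F (g y `^ beta^-1)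
  / F 1))%:E)%E).
  apply: le_lower_integral => y _ //; rewrite lee_fin -ler_pdivrMl// [leLHS]mulrC.
  by apply: (young_power_linear (g0 y)).
have mq : measurable_fun setT (fun y => F (g y `^ beta^-1) / F 1).
  exact: measurable_funM.
rewrite ge0_integralZ_fun//; last 3 first.
- by apply: measurable_funD.
- by move=> y; rewrite addr_ge0.
- exact: ltW.
rewrite lte_mul_pinfty ?lee_fin ?(ltW l0)// ge0_integralD_fun// integral_cst_EFin// mul1e.
apply: lte_add_pinfty; first by rewrite -ge0_fin_numE// (qball_mu_fin HX).
apply: (@le_lt_trans _ _ (\int[mu]_y (F (g y `^ beta^-1) / F 1)%:E)%E).
  exact: le_integral_subset_EFin.
under eq_integral do rewrite mulrC.
rewrite ge0_integralZ_fun//; last 2 first.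
- by move=> y; rewrite young_fun_ge0// powR_ge0.
- by rewrite invr_ge0 ltW.
rewrite lte_mul_pinfty ?lee_fin ?invr_ge0 ?(ltW F1)//.
apply: (@le_lt_trans _ _ 1%E); last by rewrite ltry.
by apply: le_trans mod; apply: le_lower_integral => y _;
  rewrite ?(young_funE PhiY) ?lee_fin ?young_fun_ge0 ?powR_ge0.
Qed.

Lemma kernel_morrey_bounded : morrey_bounded d mu kk Phi phi Psi eta.
Proof.
pose C9 := (2 * K3) `^ beta * CC.
have C90 : 0 < C9 by rewrite mulr_gt0 ?powR_gt0 ?mulr_gt0.
exists C9; first exact: C90.
move=> f [of_ nf].
have mf := orlicz_loc_measurable HX x1 of_.
have n0 : (0 <= morrey_norm d mu Phi phi f)%E.
  apply: (@le_trans _ _ (((phi 1)^-1)%:E * young_inv Phi (mu (B x1 1))^-1 *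
      luxemburg mu Phi (cut f (B x1 1)))%E); last first.
    by apply: ereal_sup_ubound; exists (x1, 1) => //=.
  apply: mule_ge0; last exact: luxemburg_ge0.
  apply: mule_ge0; first by rewrite lee_fin invr_ge0 ltW// phi_gt0.
  by apply: le_ereal_inf_tmp => _ [u [u0 _] <-]; rewrite lee_fin.
have nfE : morrey_norm d mu Phi phi f = (fine (morrey_norm d mu Phi phi f))%:E.
  by rewrite fineK// ge0_fin_numE.
set n := fine _ in nfE.
have n0' : 0 <= n by rewrite /n fine_ge0.
(* The modular estimate asks for a strict, positive bound of the norm; letting [e] tend to 0
   recovers the norm itself, including the value 0. *)
have lt e : 0 < e -> (morrey_norm d mu Phi phi f < (n + e)%:E)%E.
  by move=> e0; rewrite nfE lte_fin ltrDl.
have ne e : 0 < e -> 0 < n + e by move=> e0; rewrite ltr_wpDl.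
have key : (morrey_norm d mu Psi eta (integral_operator mu kk f) <= (C9 * n)%:E)%E.
  apply/lee_addgt0Pr => e e0; have e0' : 0 < e / C9 by rewrite divr_gt0.
  apply: le_trans (operator_norm_lt mf (lt _ e0') (ne _ e0')) _.
  by rewrite -EFinD lee_fin -/C9 mulrDr mulrCA mulfV ?gt_eqF// mulr1.
split.
- exact: operator_integrable mf (lt _ ltr01) (ne _ ltr01).
- move=> mS; split; first exact: operator_orlicz mf (lt _ ltr01) (ne _ ltr01) mS.
  by apply: le_lt_trans key _; rewrite ltry.
- by rewrite nfE -EFinM.
Qed.

End boundedness.

(** * The two commutator kernels and the conditions on phi *)

Section kernels.
Context {R : realType} {disp : measure_display} {X : topMeasurableType disp}.
Variables (d : X -> X -> R) (mu : {measure set X -> \bar R}) (Q K1 K3 : R).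
Hypothesis HX : Qspace d mu Q K1 K3.
Hypothesis Cc_dense : Cc_dense_L1 mu.
Variable Phi : R -> \bar R.
Hypothesis PhiY : youngY Phi.
Local Notation level := (level Q Phi).
Local Notation ratio := (young_ratio Phi Q).
Local Notation E := (lower_ratio Phi Q).
Local Notation w := (minorant Phi Q).
Variable phi : R -> R.
Hypothesis phi_gt0 : forall t, 0 < t -> 0 < phi t.
Variables (alpha beta : R).
Hypothesis alpha_bounds : 0 < alpha < Q.
Hypothesis beta_bounds : 0 < beta < 1.
Local Notation Psi := (fun t : R => Phi (t `^ beta^-1)).
Local Notation eta := (fun t : R => phi t `^ beta).

Lemma measurable_div_dist (g : X -> R) x p : measurable_fun setT g ->
  measurable_fun setT (fun y => g y / d x y `^ p).
Proof.
move=> mg; under eq_fun do rewrite -powRN.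
apply: measurable_funM => //.
exact: (measurableT_comp (measurable_powR _) (measurable_dist HX x)).
Qed.

Lemma commutator_kernelE b x y : `|commutator_kernel d Q alpha b x y| =
  `|b x - b y| / d x y `^ (Q - alpha).
Proof. by rewrite /commutator_kernel normrM (@ger0_norm _ (_^-1))// invr_ge0 powR_ge0. Qed.

Lemma abs_commutator_kernelE b x y : `|abs_commutator_kernel d Q alpha b x y| =
  `|b x - b y| / d x y `^ (Q - alpha).
Proof. by rewrite ger0_norm// divr_ge0// powR_ge0. Qed.

Lemma measurable_commutator_kernel b x : measurable_fun setT b ->
  measurable_fun setT (commutator_kernel d Q alpha b x).
Proof.
move=> mb; apply: measurable_div_dist.
by apply: measurable_funB => //; exact: measurable_cst.
Qed.

Lemma measurable_abs_commutator_kernel b x : measurable_fun setT b ->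
  measurable_fun setT (abs_commutator_kernel d Q alpha b x).
Proof.
move=> mb; apply: measurable_div_dist; apply: measurableT_comp => //.
by apply: measurable_funB => //; exact: measurable_cst.
Qed.

Lemma commutators_bounded b C1 Cs : Delta2 Phi -> nabla2 Phi -> X -> BMO d mu b ->
  1 <= C1 -> (forall r t, 0 < r -> r < t -> (1 + ln (t / r)) * w phi t <= C1 * phi r) ->
  0 < Cs -> (forall t, 0 < t -> t `^ alpha * phi t <= Cs * phi t `^ beta) ->
  morrey_bounded d mu (commutator_kernel d Q alpha b) Phi phi Psi eta /\
  morrey_bounded d mu (abs_commutator_kernel d Q alpha b) Phi phi Psi eta.
Proof.
move=> D2 N2 x1 Hb C11 H1 Cs0 star; have mb := Hb.1.1.
have [A HA] := bmo_data_BMO HX x1 Hb.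
have [CC CC0 H] := operator_modular HX Cc_dense PhiY D2 N2 phi_gt0 alpha_bounds beta_bounds
  HA C11 H1 Cs0 star x1.
split.
  apply: (kernel_morrey_bounded HX PhiY phi_gt0 beta_bounds CC0 H) => //.
    exact: commutator_kernelE.
  by move=> x; exact: measurable_commutator_kernel.
apply: (kernel_morrey_bounded HX PhiY phi_gt0 beta_bounds CC0 H) => //.
  exact: abs_commutator_kernelE.
by move=> x; exact: measurable_abs_commutator_kernel.
Qed.

Lemma log_minorant_of_essinf (C : R) :
  (forall r : R, 0 < r ->
    (ereal_sup [set (1 + ln (t / r))%:E * young_inv Phi (t `^ (- Q))%:E
                     * ess_inf_above t (ratio phi) | t in [set t : R | (r < t)%R]]
     <= (C * phi r)%:E)%E) ->
  forall r t, 0 < r -> r < t -> (1 + ln (t / r)) * w phi t <= Num.max 1 C * phi r.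
Proof.
move=> H r t r0 rt; have t0 := lt_trans r0 rt.
apply: (@le_trans _ _ (C * phi r)); last by rewrite ler_pM2r ?phi_gt0// le_max lexx orbT.
rewrite -lee_fin; apply: le_trans (H r r0).
apply: ereal_sup_ubound; exists t => //.
have [h _ _ _] := young_inv_spec PhiY (powR_gt0 (- Q) t0).
by rewrite h (lower_ratioE Q PhiY phi_gt0 t0) -!EFinM mulrA.
Qed.

(** Some point of the interval from [t] to [2 * t] has a ratio at least the essential infimum. There
    [level] is comparable to its value at [t], and almost monotonicity bounds [phi], so [w] is at
    most a multiple of [phi]. *)
Lemma log_minorant_of_classG (C : R) : classG Phi Q phi ->
  (forall r : R, 0 < r ->
    (ereal_sup [set ((1 + ln (t / r)) * phi t)%:E | t in [set t : R | (r < t)%R]]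
     <= (C * phi r)%:E)%E) ->
  exists2 C1, 1 <= C1 &
  forall r t, 0 < r -> r < t -> (1 + ln (t / r)) * w phi t <= C1 * phi r.
Proof.
move=> [[Cd Cd0 dec] _] H.
have H' r t : 0 < r -> r < t -> (1 + ln (t / r)) * phi t <= C * phi r.
  move=> r0 rt; rewrite -lee_fin; apply: le_trans (H r r0).
  by apply: ereal_sup_ubound; exists t.
have c0 : 0 <= 2 `^ Q / Cd by rewrite divr_ge0 ?powR_ge0// ltW.
have wle t : 0 < t -> w phi t <= 2 `^ Q / Cd * phi t.
  move=> t0; have t2 : t < 2 * t by lra.
  have [s /andP[ts s2]] := ess_inf_above_ex (ratio phi) t2.
  have s0 := lt_trans t0 ts.
  rewrite (lower_ratioE Q PhiY phi_gt0 t0) (young_ratioE Q phi PhiY s0) lee_fin => Es.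
  have ls0 : 0 < level s by exact: level_gt0.
  have lt0 : 0 < level t by exact: level_gt0.
  rewrite /minorant.
  apply: (@le_trans _ _ (2 `^ Q * level s * (phi s / level s))).
    apply: ler_pM; rewrite ?(ltW lt0) ?(lower_ratio_ge0 Q PhiY phi_gt0 t0)//.
    have c1 : (1 : R) <= 2 by rewrite ler1n.
    apply: le_trans (level_dilate PhiY (Q_gt0 HX) c1 t0) _.
    rewrite ler_pM2l ?powR_gt0//; apply: (level_le PhiY (Q_gt0 HX) s0).
    exact: ltW.
  rewrite [leLHS](_ : _ = 2 `^ Q * phi s); last by field; rewrite gt_eqF.
  rewrite [leRHS]mulrAC -mulrA ler_pM2l ?powR_gt0//.
  by rewrite ler_pdivlMr// mulrC -lee_fin; apply: dec => //; exact: ltW.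
exists (Num.max 1 (2 `^ Q / Cd * C)); first by rewrite le_max lexx.
move=> r t r0 rt; have t0 := lt_trans r0 rt.
apply: (@le_trans _ _ (2 `^ Q / Cd * C * phi r)); last first.
  by rewrite ler_pM2r ?phi_gt0// le_max lexx orbT.
have l0 : 0 <= 1 + ln (t / r).
  by rewrite addr_ge0// ln_ge0// ler_pdivlMr// mul1r ltW.
apply: (le_trans (ler_wpM2l l0 (wle t t0))).
by rewrite mulrCA -[leRHS]mulrA ler_wpM2l//; exact: H'.
Qed.

Lemma star_of_integral (C : R) : 
  (forall r : R, 0 < r ->
     ((r `^ alpha * phi r)%:E
        + \int[lebesgue_measure]_(t in `]r, +oo[)
            ((1 + ln (t / r)) * phi t * t `^ alpha / t)%:E
      <= (C * phi r `^ beta)%:E)%E) ->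
  forall t, 0 < t -> t `^ alpha * phi t <= C * phi t `^ beta.
Proof.
move=> H r r0; rewrite -lee_fin; apply: le_trans (H r r0).
rewrite leeDl//; apply: integral_ge0 => t; rewrite /= in_itv/= andbT => rt.
have t0 := lt_trans r0 rt.
rewrite lee_fin; apply: divr_ge0; last exact: ltW.
rewrite !mulr_ge0 ?powR_ge0 ?(ltW (phi_gt0 t0))// addr_ge0// ln_ge0//.
by rewrite ler_pdivlMr// mul1r ltW.
Qed.

End kernels.

(** * Necessity *)

Section annuli.
Context {R : realType} {disp : measure_display} {X : topMeasurableType disp}.
Variables (d : X -> X -> R) (mu : {measure set X -> \bar R}) (Q K1 K3 : R).
Hypothesis HX : Qspace d mu Q K1 K3.
Local Notation B := (qball d).
Variables (x0 : X) (M : R).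
Hypothesis M_gt1 : 1 < M.
Hypothesis MQ : 2 * K3 * K3 <= M `^ Q.

Let K1_gt0 : 0 < K1. Proof. exact: lt_le_trans (K1_ge1 HX). Qed.
Let K3_gt0 : 0 < K3. Proof. exact: lt_le_trans (K3_ge1 HX). Qed.
Let M_gt0 : 0 < M. Proof. exact: lt_trans M_gt1. Qed.
Let mB x r : measurable (B x r). Proof. exact: (measurable_qball HX). Qed.

(** Exponents of both signs are used, since the pointwise condition concerns arbitrarily small and
    arbitrarily large radii. *)
Definition annulus_radius (n : int) : R := M `^ n%:~R.

Lemma annulus_radius_gt0 n : 0 < annulus_radius n. Proof. by rewrite powR_gt0. Qed.

Lemma annulus_radius_le n m : n <= m -> annulus_radius n <= annulus_radius m.
Proof. by move=> nm; apply: ler_powR; [exact: ltW|rewrite ler_int]. Qed.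

Lemma annulus_radius_succ n : annulus_radius (n + 1) = M * annulus_radius n.
Proof. by rewrite /annulus_radius intrD powRD ?powRr1 ?(ltW M_gt0) ?(gt_eqF M_gt0)
  ?implybT// mulrC. Qed.

Lemma annulus_radius_pred n : annulus_radius (n - 1) = M^-1 * annulus_radius n.
Proof. by rewrite -[in RHS](subrK 1 n) annulus_radius_succ mulrA mulVf ?gt_eqF// mul1r. Qed.

Definition annulus (n : int) : set X := B x0 (annulus_radius n) `\` B x0 (annulus_radius (n - 1)).

Lemma measurable_annulus n : measurable (annulus n).
Proof. exact: measurableD. Qed.

Lemma annulus_inj n m y : annulus n y -> annulus m y -> n = m.
Proof.
have key i j : i < j -> annulus i y -> annulus j y -> False.
  move=> ij [yi _] [_ yj]; apply: yj; apply: lt_le_trans yi _.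
  by apply: annulus_radius_le; lia.
move=> hn hm; have [nm|nm|//] := ltgtP n m; [by case: (key _ _ nm)|by case: (key _ _ nm)].
Qed.

(** The hypothesis [MQ] makes the inner ball take at most half of the lower bound for the outer
    one. *)
Lemma annulus_measure n : (((2 * K3)^-1 * annulus_radius n `^ Q)%:E <= mu (annulus n))%E.
Proof.
set z := annulus_radius n `^ Q; have r0 := annulus_radius_gt0 n;
  have r1 := annulus_radius_gt0 (n - 1).
have z0 : 0 < z by rewrite powR_gt0.
have sub : (mu (B x0 (annulus_radius n)) <= mu (B x0 (annulus_radius (n - 1))) + mu (annulus n))%E.
  apply: le_trans (measureU2 _ _ _) => //; last exact: measurable_annulus.
  apply: le_measure; rewrite ?inE//; first by apply: measurableU => //; exact: measurable_annulus.
  by move=> y yn; have [|yn1] := pselect (B x0 (annulus_radius (n - 1)) y); [left|right].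
have lo := qball_mu_ge HX x0 r0; have up := qball_mu_le HX x0 r1.
have fin : mu (annulus n) \is a fin_num.
  rewrite ge0_fin_numE//; apply: le_lt_trans (_ : (mu (B x0 (annulus_radius n)) < +oo)%E).
    by apply: le_measure; rewrite ?inE//; [exact: measurable_annulus|move=> y []].
  by rewrite -ge0_fin_numE// (qball_mu_fin HX).
have := le_trans lo (le_trans sub (leeD2r _ up)).
rewrite -(fineK fin) -EFinD !lee_fin -/z.
rewrite annulus_radius_pred (powRM Q (_ : 0 <= M^-1) (ltW r0)) ?invr_ge0 ?(ltW M_gt0)// -/z.
rewrite powR_inv ?(ltW M_gt0)//.
have h : K3 * (M `^ Q)^-1 <= (2 * K3)^-1.
  by rewrite ler_pdivrMr ?powR_gt0// ler_pdivlMl ?mulr_gt0// mulrA mulrAC.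
have h2 : K3 * ((M `^ Q)^-1 * z) <= (2 * K3)^-1 * z by rewrite mulrA ler_pM2r.
have e : K3^-1 * z = (2 * K3)^-1 * z + (2 * K3)^-1 * z.
  by rewrite -mulrDl; congr (_ * _); field; rewrite gt_eqF.
by move=> h3; lra.
Qed.

Definition even_annuli : set X :=
  \bigcup_n (annulus (2 * n%:Z) `|` annulus (- (2 * n%:Z))).

Lemma even_annuliP y : even_annuli y <-> exists j, annulus (2 * j) y.
Proof.
split=> [[n _ [h|h]]|[[n|n] h]].
- by exists n%:Z.
- by exists (- n%:Z); rewrite mulrN.
- by exists n => //; left.
- by exists n.+1 => //; right; rewrite -mulrN -NegzE.
Qed.

Lemma measurable_even_annuli : measurable even_annuli.
Proof.
by apply: bigcup_measurable => n _; apply: measurableU; exact: measurable_annulus.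
Qed.

Local Notation b := (\1_even_annuli : X -> R).

(** Of two consecutive annuli, one has even and one has odd index, so [b] takes on one of them the
    value it does not take at [x]. The case [x = x0], which lies in no annulus, is covered as a
    point of value 0. *)
Lemma opposite_annulus x i : exists n, i - 1 <= n <= i /\
  forall y, annulus n y -> `|b x - b y| = 1.
Proof.
have [e [j [ej ei]]] : exists e j, e = 2 * j /\ i - 1 <= e <= i.
  exists (2 * (i %/ 2)%Z), (i %/ 2)%Z; split => //; lia.
have [q [k [qk qi]]] : exists q k, q = 2 * k + 1 /\ i - 1 <= q <= i.
  exists (2 * ((i - 1) %/ 2)%Z + 1), ((i - 1) %/ 2)%Z; split => //; lia.
have [xE|xE] := boolP (x \in even_annuli).
  exists q; split => // y yq; rewrite !indicE xE memNset ?subr0 ?normr1//.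
  by move=> /even_annuliP[l yl]; have := annulus_inj yq yl; lia.
exists e; split => // y ye; rewrite !indicE (negbTE xE) mem_set ?sub0r ?normrN1//.
by apply/even_annuliP; exists j; rewrite -ej.
Qed.

Lemma BMO_indic (S : set X) : measurable S -> BMO d mu (\1_S : X -> R).
Proof.
move=> mS.
pose I : X -> R := \1_S; rewrite -/I.
have mI : measurable_fun setT I by exact: measurable_indic.
have b01 y : 0 <= I y <= 1 by rewrite /I indicE ler0n lern1 leq_b1.
have ballfin x r : 0 < r -> mu (B x r) \is a fin_num by exact: (qball_mu_fin HX).
have ib x r : 0 < r -> (0 <= \int[mu]_(y in B x r) (I y)%:E <= mu (B x r))%E.
  move=> r0; rewrite integral_EFin_ge0 /=; last by move=> y; have /andP[] := b01 y.
  rewrite -[leRHS]mul1e -(@integral_cst_EFin _ _ _ mu)//.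
  by apply: le_integral_EFin => y _; have /andP[] := b01 y.
split.
  split => // x r r0; apply/integrableP; split.
    by apply/measurable_EFinP; exact: measurable_funTS.
  have /andP[_] := ib x r r0.
  under [X in (X <= _)%E -> _]eq_integral => y _.
    rewrite -[(_)%:E]gee0_abs; last by rewrite lee_fin; have /andP[] := b01 y.
    over.
  by move=> h; apply: (le_lt_trans h); rewrite -ge0_fin_numE ?ballfin.
apply: (@le_lt_trans _ _ 1%E); last by rewrite ltry.
apply: ge_ereal_sup => _ [[x r] /= r0 <-].
have m0 := fine_ball_gt0 HX x r0.
have /andP[i0 i1] := ib x r r0.
have mean01 : 0 <= mean mu I (B x r) <= 1.
  rewrite /mean mulr_ge0 ?invr_ge0 ?(ltW m0) ?fine_ge0//=.
  rewrite ler_pdivrMl// mulr1; apply: fine_le => //; last exact: ballfin.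
  by rewrite ge0_fin_numE//; apply: le_lt_trans i1 _; rewrite -ge0_fin_numE ?ballfin.
rewrite (ball_inve HX)// lee_pdivrMl// mule1 fineK ?ballfin//.
rewrite -[leRHS]mul1e -(@integral_cst_EFin _ _ _ mu)//.
apply: le_integral_EFin => y _ //; have := b01 y; move: mean01.
by move=> /andP[? ?] /andP[? ?]; rewrite ler_norml; apply/andP; split; lra.
Qed.

Variable alpha : R.
Hypothesis alpha_bounds : 0 < alpha < Q.

Definition annuli_cst : R := (2 * K1) `^ (alpha - Q) * ((2 * K3)^-1 * (M `^ Q)^-1).

Lemma annuli_cst_gt0 : 0 < annuli_cst.
Proof. by rewrite !mulr_gt0 ?powR_gt0 ?mulr_gt0 ?invr_gt0 ?mulr_gt0 ?powR_gt0. Qed.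

Lemma annuli_kernel_ge i x : B x0 (annulus_radius i) x ->
  ((annuli_cst * annulus_radius i `^ alpha)%:E <=
   \int[mu]_y (abs_commutator_kernel d Q alpha b x y * \1_(B x0 (annulus_radius i)) y)%:E)%E.
Proof.
move=> xB; have [n [/andP[n1 ni] H]] := opposite_annulus x i.
have r0 := annulus_radius_gt0 i.
have Kr : 0 < 2 * K1 * annulus_radius i by rewrite !mulr_gt0.
apply: (@le_trans _ _ (\int[mu]_(y in annulus n) ((2 * K1 * annulus_radius i)
  `^ (alpha - Q))%:E)%E).
  rewrite integral_cst_EFin; last exact: measurable_annulus.
  apply: (@le_trans _ _ ((2 * K1 * annulus_radius i) `^ (alpha - Q) *
     ((2 * K3)^-1 * annulus_radius (i - 1) `^ Q))%:E).
    rewrite lee_fin /annuli_cst annulus_radius_pred (powRM Q (_ : 0 <= M^-1) (ltW r0))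
      ?invr_ge0 ?(ltW M_gt0)//.
    rewrite (@powRM _ (2 * K1) (annulus_radius i)) ?mulr_ge0 ?(ltW r0)
      ?(ltW K1_gt0)// powR_inv ?(ltW M_gt0)//.
    rewrite le_eqVlt; apply/orP; left; apply/eqP.
    have -> : annulus_radius i `^ alpha = annulus_radius i `^ (alpha - Q) * annulus_radius i `^ Q.
      by rewrite -powRD ?subrK//; apply/implyP => _; rewrite gt_eqF.
    by ring.
  rewrite EFinM; apply: lee_wpmul2l; first by rewrite lee_fin powR_ge0.
  apply: le_trans (annulus_measure n); rewrite lee_fin; apply: ler_wpM2l.
    by rewrite invr_ge0 mulr_ge0// ltW.
  by apply: (powRQ_le HX); [exact: ltW (annulus_radius_gt0 _)|exact: annulus_radius_le].
rewrite [leLHS](eq_integral (fun y => ((2 * K1 * annulus_radius i) `^ (alpha - Q))%:E))//.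
apply: (@le_trans _ _ (\int[mu]_(y in annulus n)
    (abs_commutator_kernel d Q alpha b x y * \1_(B x0 (annulus_radius i)) y)%:E)%E); last first.
  apply: le_integral_subset_EFin => // y.
  by rewrite mulr_ge0// divr_ge0// powR_ge0.
apply: le_integral_EFin => [y _|y yn]; first exact: powR_ge0.
have yi : B x0 (annulus_radius i) y.
  by case: yn => yn _; apply: lt_le_trans yn _; exact: annulus_radius_le.
rewrite indicE mem_set// mulr1 /abs_commutator_kernel H// mul1r -opprB powRN.
(* The kernel would be 0 at distance 0; the difference of the values of [b] excludes this. *)
have d0 : 0 < d x y.
  rewrite lt_def (Qdist_ge0 HX) andbT; apply/eqP => /(qdist_eq0 (Qspace_dist HX)) xy.
  by move: (H y yn); rewrite xy subrr normr0 => /eqP; rewrite eq_sym oner_eq0.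
rewrite lef_pV2 ?posrE ?powR_gt0//; case/andP: alpha_bounds => _ aQ.
apply: ge0_ler_powR; rewrite ?nnegrE ?(ltW d0) ?(ltW Kr) ?subr_ge0 ?(ltW aQ)//.
apply: le_trans (qdist_triangle (Qspace_dist HX) x y x0) _.
rewrite (Qdist_sym HX x) (_ : 2 * K1 * annulus_radius i = K1 * (2 * annulus_radius i));
  last by ring.
rewrite ler_pM2l//.
move: xB yi; rewrite /qball /= => xB yi; lra.
Qed.

End annuli.

Section necessity.
Context {R : realType} {disp : measure_display} {X : topMeasurableType disp}.
Variables (d : X -> X -> R) (mu : {measure set X -> \bar R}) (Q K1 K3 : R).
Hypothesis HX : Qspace d mu Q K1 K3.
Local Notation B := (qball d).
Local Notation cut := Defs.cut.
Variable Phi : R -> \bar R.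
Hypothesis PhiY : youngY Phi.
Local Notation F := (young_fun Phi).
Local Notation cinv := (young_cinv Phi).
Local Notation level := (level Q Phi).
Variable phi : R -> R.
Hypothesis phi_gt0 : forall t, 0 < t -> 0 < phi t.
Variable beta : R.
Hypothesis beta_bounds : 0 < beta < 1.
Local Notation Psi := (fun t : R => Phi (t `^ beta^-1)).
Local Notation eta := (fun t : R => phi t `^ beta).
Local Notation ind x r := (\1_(B x r) : X -> R).
Local Notation ball_inv x r := (cinv (fine (mu (B x r)))^-1).

Let K3_gt0 : 0 < K3. Proof. exact: lt_le_trans (K3_ge1 HX). Qed.
Let b0 : 0 < beta. Proof. by case/andP: beta_bounds. Qed.
Let mB x r : measurable (B x r). Proof. exact: (measurable_qball HX). Qed.
Let s_gt0 x r : 0 < r -> 0 < (fine (mu (B x r)))^-1.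
Proof. by move=> r0; rewrite invr_gt0 (fine_ball_gt0 HX). Qed.

Lemma ball_inv_gt0 x r : 0 < r -> 0 < ball_inv x r.
Proof. by move=> r0; apply: young_cinv_gt0 => //; exact: s_gt0. Qed.

(** Half of the inverse is used because Phi is known to be at most the given value only strictly
    below it. *)
Lemma luxemburg_ball x r : 0 < r ->
  (luxemburg mu Phi (cut (cst 1%R) (B x r)) <= (2 / ball_inv x r)%:E)%E.
Proof.
move=> r0; have c0 := ball_inv_gt0 x r0.
have l0 : 0 < 2 / ball_inv x r by rewrite divr_gt0.
have [_ _ _ h] := young_inv_spec PhiY (s_gt0 x r0).
apply: luxemburg_le => //; rewrite (integral_cut mu _ (B x r) _ (young0 PhiY.1)).
have m0 := fine_ball_gt0 HX x r0.
rewrite (eq_integral (fun _ => (F (ball_inv x r / 2))%:E)); last first.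
  move=> y _; rewrite /= normr1 mul1r invf_div (young_funE PhiY)//.
  by rewrite divr_ge0// ltW.
rewrite integral_cst_EFin// -(fineK (qball_mu_fin HX x r0)) -EFinM lee_fin.
rewrite -ler_pdivlMr// mul1r; apply: h; first by rewrite divr_ge0// ltW.
by rewrite ltr_pdivrMr// ltr_pMr// ltr1n.
Qed.

Lemma luxemburg_indic x0 r x t : (luxemburg mu Phi (cut (ind x0 r) (B x t)) <=
   luxemburg mu Phi (cut (cst 1%R) (B x0 r)))%E /\
  (luxemburg mu Phi (cut (ind x0 r) (B x t)) <= luxemburg mu Phi (cut (cst 1%R) (B x t)))%E.
Proof.
have b1 (S : set X) y : 0 <= (\1_S y : R) <= 1 by rewrite indicE ler0n lern1 leq_b1.
have b0' (S : set X) y : 0 <= (\1_S y : R) by have /andP[] := b1 S y.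
split; apply: (luxemburg_mono mu (youngY_ge0 PhiY) (youngY_le PhiY)) => y;
  rewrite /Defs.cut mul1r !ger0_norm ?mulr_ge0//.
- by rewrite ler_piMr//; have /andP[] := b1 (B x t) y.
- by rewrite ler_piMl//; have /andP[] := b1 (B x0 r) y.
Qed.

Lemma measurable_cut_indic x0 r x t : measurable_fun setT (cut (ind x0 r) (B x t)).
Proof.
have m1 S : measurable S -> measurable_fun setT (\1_S : X -> R).
  by move=> mS; exact: measurable_indic.
exact: (measurable_funM (m1 _ (mB x0 r)) (m1 _ (mB x t))).
Qed.

Lemma integrable_indic_ball x0 r x t x' s : 0 < s ->
  mu.-integrable (B x' s) (EFin \o cut (ind x0 r) (B x t)).
Proof.
move=> s0; have mI := measurable_cut_indic x0 r x t.
apply/integrableP; split; first by apply/measurable_EFinP; exact: measurable_funTS.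
apply: (@le_lt_trans _ _ (\int[mu]_(y in B x' s) 1%:E)%E); last first.
  by rewrite integral_cst_EFin// mul1e -ge0_fin_numE// (qball_mu_fin HX).
apply: le_lower_integral => y _ //=; rewrite lee_fin /Defs.cut !indicE normrM !normr_nat.
by rewrite mulr_ile1// ?ler0n ?lern1 ?leq_b1.
Qed.

Lemma indic_orlicz_loc x0 r : orlicz_loc d mu Phi (ind x0 r).
Proof.
move=> x t t0; split.
  split=> [|x' s s0]; first exact: measurable_cut_indic.
  exact: integrable_indic_ball.
exists 1 => //; apply: (@le_lt_trans _ _ (\int[mu]_(y in B x t) (F 1)%:E)%E); last first.
  rewrite integral_cst_EFin// lte_mul_pinfty ?lee_fin ?young_fun_ge0//.
  by rewrite -ge0_fin_numE// (qball_mu_fin HX).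
rewrite [leRHS]integral_mkcond; apply: le_lower_integral => y _.
  by apply: youngY_ge0 => //; rewrite mul1r.
rewrite mul1r patchE /Defs.cut normrM !indicE !normr_nat.
case: (y \in B x t); last by rewrite mulr0 (young0 PhiY.1).
rewrite mulr1 young_funE ?ler0n// lee_fin; apply: young_fun_le; rewrite ?ler0n//.
by rewrite lern1 leq_b1.
Qed.

(** Each half of the class handles one range of radii. For [t <= r] the norm on the test ball is
    used and [phi] is almost decreasing; for [t > r] the norm on the fixed ball is used and the
    ratio is almost increasing. *)
Lemma indic_morrey : classG Phi Q phi -> exists2 Cf, 0 < Cf & forall x0 r, 0 < r ->
  morrey d mu Phi phi (ind x0 r) /\
  (morrey_norm d mu Phi phi (ind x0 r) <= (Cf / phi r)%:E)%E.
Proof.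
move=> [[Cd Cd0 dec] [Ci Ci0 inc]].
pose Cf := 2 / Cd + 2 * K3 * K3 * Ci.
have Cf0 : 0 < Cf by rewrite addr_gt0// ?divr_gt0// !mulr_gt0.
exists Cf => // x0 r r0; suff H : (morrey_norm d mu Phi phi (ind x0 r) <= (Cf / phi r)%:E)%E.
  split => //; split; first exact: indic_orlicz_loc.
  by apply: le_lt_trans H _; rewrite ltry.
have p0 := phi_gt0 r0; have lr0 : 0 < level r by exact: level_gt0.
apply: ge_ereal_sup => _ [[x t] /= t0 <-].
have pt0 := phi_gt0 t0; have lt0 : 0 < level t by exact: level_gt0.
rewrite (young_inv_ball HX PhiY x t0) -EFinM.
have [h1 h2] := luxemburg_indic x0 r x t.
have c0 := ball_inv_gt0 x t0; have cr0 := ball_inv_gt0 x0 r0.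
have P0 : 0 <= (phi t)^-1 * ball_inv x t by rewrite mulr_ge0// ?invr_ge0 ltW.
have [tr|rt] := lerP t r.
  apply: (@le_trans _ _ (((phi t)^-1 * ball_inv x t)%:E * (2 / ball_inv x t)%:E)%E).
    apply: lee_wpmul2l; first by rewrite lee_fin.
    exact: le_trans h2 (luxemburg_ball x t0).
  have cancel (a c : R) : c != 0 -> a * c * (2 / c) = 2 * a by move=> ?; field.
  rewrite -EFinM lee_fin cancel ?gt_eqF//.
  apply: (@le_trans _ _ (2 / Cd / phi r)); last first.
    by rewrite ler_pM2r ?invr_gt0// lerDl !mulr_ge0// ltW.
  rewrite -mulrA ler_pM2l// -invfM lef_pV2 ?posrE ?mulr_gt0//.
  by rewrite -lee_fin; exact: dec.
apply: (@le_trans _ _ (((phi t)^-1 * ball_inv x t)%:E * (2 / ball_inv x0 r)%:E)%E).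
  apply: lee_wpmul2l; first by rewrite lee_fin.
  exact: le_trans h1 (luxemburg_ball x0 r0).
rewrite -EFinM lee_fin.
have up := cinv_ball_le HX PhiY x t0; have lo := cinv_ball_ge HX PhiY x0 r0.
have rat : phi r / level r <= Ci * (phi t / level t).
  have := inc r t r0 (ltW rt).
  by rewrite !(young_ratioE Q phi PhiY)// -EFinM lee_fin.
apply: (@le_trans _ _ ((phi t)^-1 * (K3 * level t) * (2 / (K3^-1 * level r)))).
  apply: ler_pM => //; first by rewrite divr_ge0// ltW.
    by rewrite ler_pM2l ?invr_gt0.
  by rewrite ler_pM2l// lef_pV2 ?posrE ?mulr_gt0 ?invr_gt0.
apply: (@le_trans _ _ (2 * K3 * K3 * Ci / phi r)); last first.
  by rewrite ler_pM2r ?invr_gt0// lerDr divr_ge0// ltW.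
rewrite ler_pdivlMr// (_ : _ * _ * phi r = 2 * K3 * K3 * (level t / phi t * (phi r / level
  r))); last first.
  by field; rewrite !gt_eqF.
rewrite ler_pM2l ?mulr_gt0// -ler_pdivlMl ?divr_gt0// invf_div [leRHS]mulrC.
exact: rat.
Qed.

(** The lower bound is assumed only almost everywhere, because the operator takes a default value
    where its integral diverges. The ball minus a null set still has full measure. *)
Lemma luxemburg_power_ge (S : X -> R) x0 r v : 0 < r -> 0 < v ->
  {ae mu, forall x, B x0 r x -> v <= `|S x|} ->
  ((v / ball_inv x0 r `^ beta)%:E <= luxemburg mu Psi (cut S (B x0 r)))%E.
Proof.
move=> r0 v0 [N [mN N0 NS]].
have c0 := ball_inv_gt0 x0 r0; have cb0 : 0 < ball_inv x0 r `^ beta by rewrite powR_gt0.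
apply: le_ereal_inf_tmp => _ [l [l0 H] <-]; rewrite lee_fin.
rewrite ler_pdivrMr// -ler_pdivrMl// mulrC.
have vl0 : 0 <= v / l by rewrite divr_ge0// ltW.
have m0 := fine_ball_gt0 HX x0 r0.
have muD : (mu (B x0 r) <= mu (B x0 r `\` N))%E.
  rewrite -[leRHS]adde0 -N0; apply: le_trans (measureU2 _ _ _) => //; last exact: measurableD.
  apply: le_measure; rewrite ?inE//; first by apply: measurableU => //; exact: measurableD.
  by move=> y yB; have [|] := pselect (N y); [right|left].
have Psi_ge0 y : (0 <= Phi ((`|cut S (B x0 r) y| / l) `^ beta^-1))%E.
  by apply: youngY_ge0 => //; exact: powR_ge0.
have key : F ((v / l) `^ beta^-1) <= (fine (mu (B x0 r)))^-1.
  rewrite -[leRHS]mul1r ler_pdivlMr// -lee_fin EFinM fineK ?(qball_mu_fin HX)//.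
  apply: le_trans H; apply: le_trans (@le_lower_integral_subset _ _ _ mu (B x0 r `\` N)
    setT _ _ _) => //.
  apply: (@le_trans _ _ (\int[mu]_(x in B x0 r `\` N) (F ((v / l) `^ beta^-1))%:E)%E).
    rewrite integral_cst_EFin; last exact: measurableD.
    by apply: lee_wpmul2l => //; rewrite lee_fin young_fun_ge0// powR_ge0.
  apply: le_lower_integral => y [yB yN]; first by rewrite lee_fin young_fun_ge0// powR_ge0.
  rewrite -(young_funE PhiY (powR_ge0 _ _)); apply: (youngY_le PhiY); first exact: powR_ge0.
  have vS : v <= `|S y|.
    by apply: contrapT => nv; apply/yN/NS => /(_ yB).
  rewrite /Defs.cut indicE mem_set// mulr1.
  apply: ge0_ler_powR; rewrite ?nnegrE ?invr_ge0 ?(ltW b0)//.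
    by rewrite divr_ge0// ltW.
  by rewrite ler_pM2r ?invr_gt0.
have u0 : 0 <= (v / l) `^ beta^-1 by exact: powR_ge0.
have := young_cinv_ge_of PhiY (s_gt0 x0 r0) u0 key => h.
rewrite -[leLHS](_ : ((v / l) `^ beta^-1) `^ beta = v / l); last first.
  by rewrite -powRrM mulVf ?gt_eqF// powRr1.
by apply: ge0_ler_powR; rewrite ?nnegrE ?(ltW b0) ?(ltW c0).
Qed.

Lemma young_inv_power_ge x r : 0 < r ->
  ((ball_inv x r `^ beta)%:E <= young_inv Psi (mu (B x r))^-1)%E.
Proof.
move=> r0; have c0 := ball_inv_gt0 x r0.
rewrite (ball_inve HX)//; apply: le_ereal_inf_tmp => _ [u [u0 h] <-]; rewrite lee_fin.
have ub0 : 0 <= u `^ beta^-1 by exact: powR_ge0.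
rewrite (young_funE PhiY ub0) lte_fin in h.
have := young_cinv_le_of PhiY (s_gt0 x r0) ub0 h => h'.
rewrite -[leRHS](_ : (u `^ beta^-1) `^ beta = u); last first.
  by rewrite -powRrM mulVf ?gt_eqF// powRr1.
by apply: ge0_ler_powR; rewrite ?nnegrE ?(ltW b0) ?(ltW c0).
Qed.

(** In the Morrey norm of the image, the inverse of Psi and the lower bound for the Luxemburg norm
    carry the same power of [ball_inv], which cancels; only [v] and the power of [phi r] remain. *)
Lemma bounded_lower kk (C Cf : R) x0 r v : 0 < r -> 0 < v ->
  morrey d mu Phi phi (ind x0 r) ->
  (morrey_norm d mu Phi phi (ind x0 r) <= (Cf / phi r)%:E)%E -> 0 < C ->
  (forall f, morrey d mu Phi phi f ->
    [/\ {ae mu, forall x, mu.-integrable setT (fun y => (kk x y * f y)%:E)},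
        measurable_fun setT (integral_operator mu kk f) ->
          morrey d mu Psi eta (integral_operator mu kk f) &
        (morrey_norm d mu Psi eta (integral_operator mu kk f)
          <= C%:E * morrey_norm d mu Phi phi f)%E]) ->
  (forall x, B x0 r x -> (v%:E <= \int[mu]_y (kk x y * ind x0 r y)%:E)%E) ->
  v * phi r <= C * Cf * phi r `^ beta.
Proof.
move=> r0 v0 mf nf C0 /(_ _ mf)[hae _ hn] hv.
have p0 := phi_gt0 r0; have pb0 : 0 < phi r `^ beta by rewrite powR_gt0.
have c0 := ball_inv_gt0 x0 r0; have cb0 : 0 < ball_inv x0 r `^ beta by rewrite powR_gt0.
set S := integral_operator mu kk (ind x0 r) in hn.
have hS : {ae mu, forall x, B x0 r x -> v <= `|S x|}.
  apply: filterS hae => x ix xB.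
  apply: le_trans (ler_norm _); rewrite -lee_fin /S /integral_operator /Rintegral fineK.
    exact: hv.
  exact: integrable_fin_num.
have lux := luxemburg_power_ge r0 v0 hS.
have psi := young_inv_power_ge x0 r0.
have up : (((phi r `^ beta)^-1)%:E * young_inv Psi (mu (B x0 r))^-1 *
    luxemburg mu Psi (cut S (B x0 r)) <= morrey_norm d mu Psi eta S)%E.
  by apply: ereal_sup_ubound; exists (x0, r).
have lo : (((phi r `^ beta)^-1 * v)%:E <= morrey_norm d mu Psi eta S)%E.
  apply: le_trans up; apply: (@le_trans _ _ (((phi r `^ beta)^-1)%:E * (ball_inv x0 r `^ beta)%:E *
      (v / ball_inv x0 r `^ beta)%:E)%E).
    by rewrite -!EFinM lee_fin le_eqVlt; apply/orP; left; apply/eqP; field; rewrite !gt_eqF.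
  apply: lee_pmul => //.
  - by rewrite -EFinM lee_fin mulr_ge0 ?invr_ge0 ?powR_ge0.
  - by rewrite lee_fin divr_ge0// ltW.
  - by apply: lee_wpmul2l => //; rewrite lee_fin invr_ge0 powR_ge0.
have := le_trans lo (le_trans hn (lee_wpmul2l _ nf)).
rewrite -EFinM !lee_fin => /(_ (ltW C0)).
rewrite ler_pdivrMl// => h; rewrite -ler_pdivlMr//; apply: (le_trans h).
by rewrite le_eqVlt; apply/orP; left; apply/eqP; ring.
Qed.

Variable alpha : R.
Hypothesis alpha_bounds : 0 < alpha < Q.

Lemma star_necessary (x0 : X) : classG Phi Q phi ->
  (forall b, BMO d mu b ->
    morrey_bounded d mu (abs_commutator_kernel d Q alpha b) Phi phi Psi eta) ->
  exists2 C : R, 0 < C & forall t, 0 < t -> t `^ alpha * phi t <= C * phi t `^ beta.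
Proof.
move=> HG Hbd; have [Cf Cf0 Hf] := indic_morrey HG.
have [[Cd Cd0 dec] _] := HG.
have Q0 := Q_gt0 HX; have /andP[_ b1] := beta_bounds; have /andP[a0 aQ] := alpha_bounds.
pose M := Num.max 2 ((2 * K3 * K3) `^ Q^-1).
have M1 : 1 < M by rewrite lt_max ltr1n.
have M0 : 0 < M by exact: lt_trans M1.
have MQ : 2 * K3 * K3 <= M `^ Q.
  have KK0 : 0 <= 2 * K3 * K3 by rewrite !mulr_ge0// ltW.
  rewrite -[leLHS](_ : ((2 * K3 * K3) `^ Q^-1) `^ Q = _); last first.
    by rewrite -powRrM mulVf ?gt_eqF// powRr1.
  by apply: ge0_ler_powR; rewrite ?nnegrE ?powR_ge0 ?(ltW M0) ?(ltW Q0)// /M le_max lexx orbT.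
have mE := measurable_even_annuli HX x0 M.
have [C C0 HC] := Hbd _ (BMO_indic HX mE).
set c := annuli_cst Q K1 K3 M alpha.
have c0 : 0 < c by exact: (annuli_cst_gt0 HX).
have star_radius i : annulus_radius M i `^ alpha * phi (annulus_radius M i)
  <= C * Cf / c * phi (annulus_radius M i) `^ beta.
  have r0 : 0 < annulus_radius M i by exact: annulus_radius_gt0.
  have v0 : 0 < c * annulus_radius M i `^ alpha by rewrite mulr_gt0 ?powR_gt0.
  have [mf nf] := Hf x0 _ r0.
  have h := bounded_lower r0 v0 mf nf C0 HC (@annuli_kernel_ge _ _ _ _ _ _ _ _ HX x0 M M1 MQ
    alpha alpha_bounds i).
  by rewrite [leRHS]mulrAC ler_pdivlMr// mulrC mulrA; exact: h.
exists (M `^ alpha * (C * Cf / c) / Cd `^ (1 - beta)).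
  apply: divr_gt0; last by rewrite powR_gt0.
  by apply: mulr_gt0; [rewrite powR_gt0|apply: divr_gt0 => //; exact: mulr_gt0].
move=> t t0.
have lM : 0 < ln M by rewrite ln_gt0.
(* The estimate is known at the radii [annulus_radius M i] only; [t] lies between two consecutive
   ones. *)
pose i := Num.floor (ln t / ln M).
have radE j : annulus_radius M j = expR (j%:~R * ln M) by rewrite /annulus_radius /powR gt_eqF.
have tE : t = expR (ln t) by rewrite lnK// posrE.
have lo : annulus_radius M i <= t.
  by rewrite radE [leRHS]tE ler_expR -ler_pdivlMr// floor_le_tmp.
have up : t <= annulus_radius M (i + 1).
  rewrite radE [leLHS]tE ler_expR -ler_pdivrMr// ltW//; exact: floorD1_gt.
have r0 := annulus_radius_gt0 M1 i.
have star := star_radius i.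
set rr := annulus_radius M i in lo r0 star.
have p0 := phi_gt0 t0; have pr0 := phi_gt0 r0.
have pd : Cd * phi t <= phi rr by rewrite -lee_fin; exact: dec.
have b1' : 0 < 1 - beta by rewrite subr_gt0.
have split_pow (u : R) : 0 < u -> u = u `^ (1 - beta) * u `^ beta.
  move=> u0; rewrite -powRD; last by apply/implyP => _; rewrite gt_eqF.
  by rewrite subrK powRr1// ltW.
(* Dividing by the power [beta] of [phi] leaves a quantity whose two factors pass from [rr] to [t]
   at bounded cost: the radius changes by at most [M], and [phi] is almost decreasing. *)
have star' : rr `^ alpha * phi rr `^ (1 - beta) <= C * Cf / c.
  have pb0 : 0 < phi rr `^ beta by rewrite powR_gt0.
  by rewrite -(ler_pM2r pb0) -[leLHS]mulrA -(split_pow _ pr0).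
rewrite [X in _ * X <= _](split_pow _ p0) [leLHS]mulrA ler_pM2r ?powR_gt0//.
rewrite ler_pdivlMr ?powR_gt0// -[leLHS]mulrA.
apply: (@le_trans _ _ ((M * rr) `^ alpha * phi rr `^ (1 - beta))).
  apply: ler_pM; rewrite ?powR_ge0 ?mulr_ge0 ?powR_ge0//.
    apply: ge0_ler_powR; rewrite ?nnegrE ?(ltW t0) ?(ltW a0) ?mulr_ge0 ?(ltW M0) ?(ltW r0)//.
    by rewrite -(annulus_radius_succ M1).
  rewrite mulrC -powRM ?(ltW Cd0) ?(ltW p0)//.
  by apply: ge0_ler_powR; rewrite ?nnegrE ?mulr_ge0 ?(ltW b1') ?(ltW Cd0) ?(ltW p0) ?(ltW pr0).
by rewrite powRM ?(ltW M0) ?(ltW r0)// -mulrA ler_pM2l ?powR_gt0.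
Qed.

End necessity.

Local Open Scope ereal_scope.

Theorem theorem6p3 (R : realType) (disp : measure_display)
  (X : topMeasurableType disp) (d : X -> X -> R)
  (mu : {measure set X -> \bar R}) (Q alpha beta : R)
  (Phi : R -> \bar R) (phi : R -> R)
  (X_homogeneous : homogeneous_type d mu)
  (mu_infinite : mu setT = +oo)
  (L1_density : Cc_dense_L1 mu)
  (Q_gt0 : (0 < Q)%R)
  (X_Q_homogeneous : Q_homogeneous d mu Q)
  (alpha_bounds : (0 < alpha < Q)%R)
  (Phi_Y : youngY Phi)
  (beta_bounds : (0 < beta < 1)%R)
  (phi_gt0 : forall t : R, (0 < t)%R -> (0 < phi t)%R)
  (phi_measurable : measurable_fun (`]0%R, +oo[%classic : set R) phi) :
  let eta : R -> R := fun t => (phi t `^ beta)%R in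
  let Psi : R -> \bar R := fun t => Phi (t `^ beta^-1)%R in
  let condition_star : Prop :=
    exists2 C : R, (0 < C)%R &
      forall t : R, (0 < t)%R -> (t `^ alpha * phi t <= C * phi t `^ beta)%R in
  [/\
    (Delta2 Phi /\ nabla2 Phi ->
     (exists2 C : R, (0 < C)%R & forall r : R, (0 < r)%R ->
        ereal_sup [set (1 + ln (t / r))%:E * young_inv Phi (t `^ (- Q))%:E
                         * ess_inf_above t (young_ratio Phi Q phi)
                  | t in [set t : R | (r < t)%R]]
        <= (C * phi r)%:E) ->
     (exists2 C : R, (0 < C)%R & forall r : R, (0 < r)%R ->
        (r `^ alpha * phi r)%:E
          + \int[lebesgue_measure]_(t in `]r, +oo[)
              ((1 + ln (t / r)) * phi t * t `^ alpha / t)%:E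
        <= (C * phi r `^ beta)%:E) ->
     forall b : X -> R, BMO d mu b ->
       morrey_bounded d mu (commutator_kernel d Q alpha b) Phi phi Psi eta),

    (Delta2 Phi -> classG Phi Q phi ->
     (forall b : X -> R, BMO d mu b ->
        morrey_bounded d mu (abs_commutator_kernel d Q alpha b) Phi phi Psi eta) ->
     condition_star) &

    (Delta2 Phi /\ nabla2 Phi -> classG Phi Q phi ->
     (exists2 C : R, (0 < C)%R & forall r : R, (0 < r)%R ->
        ereal_sup [set ((1 + ln (t / r)) * phi t)%:E
                  | t in [set t : R | (r < t)%R]]
        <= (C * phi r)%:E) ->
     (exists2 C : R, (0 < C)%R & forall r : R, (0 < r)%R ->
        \int[lebesgue_measure]_(t in `]r, +oo[)
          ((1 + ln (t / r)) * phi t * t `^ alpha / t)%:E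
        <= (C * r `^ alpha * phi r)%:E) ->
     (condition_star <->
      forall b : X -> R, BMO d mu b ->
        morrey_bounded d mu (abs_commutator_kernel d Q alpha b)
          Phi phi Psi eta)) ].
Proof.
move=> eta Psi star.
have [K1 [K3 HX]] := Qspace_homogeneous X_homogeneous Q_gt0 X_Q_homogeneous.
(* The dense sequence and the annuli need a base point, which exists because the total measure is
   infinite. *)
have [x0] : exists x0 : X, True.
  apply: contrapT => nX; move: mu_infinite; rewrite (_ : setT = set0) ?measure0//.
  by apply/seteqP; split => // x _; apply: nX; exists x.
move=> _; split.
- move=> [D2 N2] [C C0 HC] [Cs Cs0 HCs] b Hb.
  have H1 := log_minorant_of_essinf Phi_Y phi_gt0 HC.
  have C1 : (1 <= Num.max 1 C)%R by rewrite le_max lexx.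
  have star1 := star_of_integral phi_gt0 HCs.
  have [bounded _] := commutators_bounded HX L1_density Phi_Y phi_gt0 alpha_bounds beta_bounds
    D2 N2 x0 Hb C1 H1 Cs0 star1.
  exact: bounded.
- move=> _ HG Hb.
  exact: (star_necessary HX Phi_Y phi_gt0 beta_bounds alpha_bounds x0 HG Hb).
- move=> [D2 N2] HG [C C0 HC] _; split; last first.
    exact: (star_necessary HX Phi_Y phi_gt0 beta_bounds alpha_bounds x0 HG).
  move=> [Cs Cs0 HCs] b Hb.
  have [C1 C11 H1] := log_minorant_of_classG HX Phi_Y phi_gt0 HG HC.
  have [_ bounded] := commutators_bounded HX L1_density Phi_Y phi_gt0 alpha_bounds beta_bounds
    D2 N2 x0 Hb C11 H1 Cs0 HCs.
  exact: bounded.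
Qed.
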